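(* Let $(M,H,\omega)$ be an almost hypercomplex skew-Hermitian manifold of dimension $4n$, $n>1$, with canonical connection $\nabla^{H,\omega}$. Then $\omega$ is symplectic (i.e. $d\omega=0$) if and only if $(H,\omega)$ is of type $\mathcal{X}_{1567}$, that is, the components of the torsion of $\nabla^{H,\omega}$ in $\mathcal{X}_2=[\Lambda^3\mathsf{E}\,S^3\mathsf{H}]^*$, $\mathcal{X}_3=[\mathsf{K}\mathsf{H}]^*$ and $\mathcal{X}_4=[\mathsf{E}\mathsf{H}]^*$ vanish.
   Context: $M$ is a connected smooth $4n$-manifold, $n>1$. An almost hypercomplex structure is a triple $H=\{J_1,J_2,J_3\}$ of almost complex structures with $J_1J_2=-J_2J_1=J_3$. A scalar 2-form with respect to $H$ is a non-degenerate 2-form $\omega$ with $\omega(J_aX,J_aY)=\omega(X,Y)$, $a=1,2,3$; then $(H,\omega)$ is an almost hypercomplex skew-Hermitian structure (equivalently an $\mathsf{SO}^*(2n)$-structure). Modules (for $\mathsf{SO}^*(2n)\mathsf{Sp}(1)$): $\mathsf{E}=\mathbb{C}^{2n}$, $\mathsf{H}=\mathbb{C}^2$ are the standard representations of $\mathsf{SO}^*(2n)$, $\mathsf{Sp}(1)$; $[\,\cdot\,]$ denotes the real form; $T_xM\cong[\mathsf{EH}]$. $\mathsf{E}$ carries an invariant complex symmetric form; $S^k_0\mathsf{E}$ denotes trace-free symmetric tensors. $\mathsf{E}\otimes\Lambda^2\mathsf{E}=\Lambda^3\mathsf{E}\oplus\mathsf{K}\oplus\mathsf{E}$ (totally skew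 part; kernel $\mathsf{K}$ of total antisymmetrization and trace; pure trace part), and $\mathsf{E}\otimes S^2_0\mathsf{E}\cong S^3_0\mathsf{E}\oplus\mathsf{K}\oplus\mathsf{E}$. In $\Lambda^2[\mathsf{EH}]^*\otimes[\mathsf{EH}]$ the $S^3\mathsf{H}$-isotypic part for $\mathsf{Sp}(1)$ is $[(\mathsf{E}\otimes\Lambda^2\mathsf{E})S^3\mathsf{H}]^*=[\mathsf{K}S^3\mathsf{H}]^*\oplus[\Lambda^3\mathsf{E}S^3\mathsf{H}]^*\oplus[\mathsf{E}S^3\mathsf{H}]^*=:\mathcal{X}_1\oplus\mathcal{X}_2\oplus\mathcal{X}_6$. Identify $[S^2_0\mathsf{E}]^*$ with the trace-free endomorphisms $B$ commuting with all $J_a$ for which $\omega(B\cdot,\cdot)$ is skew. With $\delta(A)(X,Y)=A(X,Y)-A(Y,X)$, the images under $\delta$ of the components $[\mathsf{KH}]^*,[\mathsf{EH}]^*,[S^3_0\mathsf{EH}]^*$ of $[\mathsf{EH}]^*\otimes[S^2_0\mathsf{E}]^*$ are $\mathcal{X}_3,\mathcal{X}_4,\mathcal{X}_5$. With $\pi_\omega(T)(X,Y,Z)=\mathfrak{S}_{X,Y,Z}\,\omega(T(X,Y),Z)$ (cyclic sum), $\mathcal{X}_7\cong[\mathsf{EH}]^*$ is the intersection of $\ker\pi_\omega$ with $\mathcal{X}_4\oplus\delta([\mathsf{EH}]^*\otimes\mathrm{Id})$. Write $\mathcal{X}_{i_1\ldots i_j}=\mathcal{X}_{i_1}\oplus\cdots\oplus\mathcal{X}_{i_j}$.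 Connections: the Obata connection $\nabla^H$ is the unique connection preserving $H$ with torsion $T^H=\frac16(N_{J_1}+N_{J_2}+N_{J_3})$, where $N_J(X,Y)=[JX,JY]-[X,Y]-J[JX,Y]-J[X,JY]$ (equivalently, its torsion lies in $\mathcal{X}_{126}$). The canonical connection is $\nabla^{H,\omega}=\nabla^H+A$, with $\omega(A(X,Y),Z)=\frac12(\nabla^H_X\omega)(Y,Z)$; it preserves $H$ and $\omega$ and its torsion takes values in $\mathcal{X}_{1234567}$. $(H,\omega)$ is of type $\mathcal{X}_{i_1\ldots i_j}$ if the torsion of $\nabla^{H,\omega}$ takes values in $\mathcal{X}_{i_1\ldots i_j}$. *)

(* Defs.v *)
From HB Require Import structures.
From mathcomp Require Import all_boot all_order all_algebra.
From mathcomp Require Import complex.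
From mathcomp Require Import all_classical all_reals all_analysis.

Set Implicit Arguments.
Unset Strict Implicit.
Unset Printing Implicit Defensive.

Import Order.TTheory GRing.Theory Num.Theory.
Import numFieldNormedType.Exports.

Local Open Scope classical_set_scope.
Local Open Scope ring_scope.

Section SmoothFunctions.
Variables (R : realType) (m : nat).

Fixpoint Ck (k : nat) (U : set 'cV[R]_m) (f : 'cV[R]_m -> R) : Prop :=
  match k with
  | 0 => forall p, U p -> {for p, continuous f}
  | k'.+1 => (forall p, U p -> differentiable f p) /\
             (forall i : 'I_m, Ck k' U (fun p => 'D_(delta_mx i 0) f p))
  end.

(* f is C^oo on some neighbourhood of p; its values elsewhere are irrelevant *)
Definition smooth_near (p : 'cV[R]_m) (f : 'cV[R]_m -> R) : Prop :=
  exists U : set 'cV[R]_m, [/\ open U, U p & forall k, Ck k U f].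

End SmoothFunctions.

Record chart (R : realType) (m : nat) (M : topologicalType) := Chart {
  chart_source : set M;
  chart_target : set 'cV[R]_m;
  chart_fun : M -> 'cV[R]_m;
  chart_inv : 'cV[R]_m -> M;
  chart_source_open : open chart_source;
  chart_target_open : open chart_target;
  chart_funP : forall x, chart_source x -> chart_target (chart_fun x);
  chart_invP : forall p, chart_target p -> chart_source (chart_inv p);
  chart_funK : forall x, chart_source x -> chart_inv (chart_fun x) = x;
  chart_invK : forall p, chart_target p -> chart_fun (chart_inv p) = p;
  chart_fun_continuous :
    forall x, chart_source x -> {for x, continuous chart_fun};
  chart_inv_continuous :
    forall p, chart_target p -> {for p, continuous chart_inv}
}.

(* The smooth structure is the one generated by the atlas formed by the charts
   [chart_at x]; singling out one chart around each point lets T_xM be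
   represented by coordinate vectors with respect to [chart_at x]. *)
Record smoothManifold (R : realType) (m : nat) := SmoothManifold {
  mcarrier :> topologicalType;
  chart_at : mcarrier -> chart R m mcarrier;
  chart_at_source : forall x, chart_source (chart_at x) x;
  chart_at_compat : forall (x y : mcarrier) (p : 'cV[R]_m),
    chart_target (chart_at x) p ->
    chart_source (chart_at y) (chart_inv (chart_at x) p) ->
    forall i : 'I_m,
      smooth_near p
        (fun q => chart_fun (chart_at y) (chart_inv (chart_at x) q) i 0);
  manifold_hausdorff : hausdorff_space mcarrier;
  manifold_second_countable : @second_countable mcarrier;
  manifold_connected : connected [set: mcarrier]
}.

Section Fields.
Variables (R : realType) (m : nat) (M : smoothManifold R m).
Implicit Types (x : M) (f : M -> R).

(* Fields are arbitrary sections; smoothness is required only near the point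
   where an expression is evaluated, so that locally defined fields (extended
   by arbitrary values) are included. *)
Definition vfield := M -> 'cV[R]_m.
(* An endomorphism field J, with J_x acting on coordinate vectors, and a
   2-form w, with w_x(u,v) = u^T w_x v. *)
Definition mxfield := M -> 'M[R]_m.

Definition coord x : M -> 'cV[R]_m := chart_fun (chart_at x).
Definition coord_inv x : 'cV[R]_m -> M := chart_inv (chart_at x).

Definition smooth_fun_near x f : Prop :=
  smooth_near (coord x x) (f \o coord_inv x).

Definition dfun x (v : 'cV[R]_m) f : R := 'D_v (f \o coord_inv x) (coord x x).

(* the components of X in [chart_at x]: the vector X_y, given in the chart
   [chart_at y], is transported by the differential of the transition map *)
Definition local_rep x (X : vfield) (p : 'cV[R]_m) : 'cV[R]_m :=
  let y := coord_inv x p in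
  'D_(X y) (coord x \o coord_inv y : 'cV[R]_m -> 'cV[R]_m) (coord y y).

Definition smooth_vfield_near x (X : vfield) : Prop :=
  forall i : 'I_m, smooth_near (coord x x) (fun p => local_rep x X p i 0).

Definition bracket (X Y : vfield) : vfield := fun x =>
  'D_(X x) (local_rep x Y) (coord x x) - 'D_(Y x) (local_rep x X) (coord x x).

Definition mxform (w : 'M[R]_m) (u v : 'cV[R]_m) : R := (u^T *m w *m v) 0 0.

Definition app_endo (J : mxfield) (X : vfield) : vfield := fun x => J x *m X x.
Definition app_form (w : mxfield) (X Y : vfield) : M -> R :=
  fun x => mxform (w x) (X x) (Y x).

Definition smooth_endo (J : mxfield) : Prop :=
  forall x X, smooth_vfield_near x X -> smooth_vfield_near x (app_endo J X).
Definition smooth_form (w : mxfield) : Prop :=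
  forall x X Y, smooth_vfield_near x X -> smooth_vfield_near x Y ->
    smooth_fun_near x (app_form w X Y).

Definition ext_d (w : mxfield) (X Y Z : vfield) (x : M) : R :=
  dfun x (X x) (app_form w Y Z) + dfun x (Y x) (app_form w Z X)
  + dfun x (Z x) (app_form w X Y)
  - app_form w (bracket X Y) Z x - app_form w (bracket Y Z) X x
  - app_form w (bracket Z X) Y x.

Definition closed_form (w : mxfield) : Prop :=
  forall x X Y Z, smooth_vfield_near x X -> smooth_vfield_near x Y ->
    smooth_vfield_near x Z -> ext_d w X Y Z x = 0.

Definition nijenhuis (J : mxfield) (X Y : vfield) : vfield := fun x =>
  bracket (app_endo J X) (app_endo J Y) x - bracket X Y x
  - J x *m bracket (app_endo J X) Y x - J x *m bracket X (app_endo J Y) x.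

(* [nabla x v Y] is (nabla_v Y)(x); it is meaningful for Y smooth near x *)
Definition covderiv := M -> 'cV[R]_m -> vfield -> 'cV[R]_m.

Record is_connection (nabla : covderiv) : Prop := IsConnection {
  connection_linear : forall x Y, smooth_vfield_near x Y ->
    forall (a : R) u v,
      nabla x (a *: u + v) Y = a *: nabla x u Y + nabla x v Y;
  connection_additive : forall x v Y Z,
    smooth_vfield_near x Y -> smooth_vfield_near x Z ->
    nabla x v (fun y => Y y + Z y) = nabla x v Y + nabla x v Z;
  connection_leibniz : forall x v f Y,
    smooth_fun_near x f -> smooth_vfield_near x Y ->
    nabla x v (fun y => f y *: Y y) = dfun x v f *: Y x + f x *: nabla x v Y;
  connection_smooth : forall x X Y,
    smooth_vfield_near x X -> smooth_vfield_near x Y ->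
    smooth_vfield_near x (fun y => nabla y (X y) Y)
}.

Definition torsion (nabla : covderiv) (X Y : vfield) : vfield := fun x =>
  nabla x (X x) Y - nabla x (Y x) X - bracket X Y x.

Definition parallel_endo (nabla : covderiv) (J : mxfield) : Prop :=
  forall x v Y, smooth_vfield_near x Y ->
    nabla x v (app_endo J Y) = J x *m nabla x v Y.

Definition cov_form (nabla : covderiv) (w : mxfield) x (v : 'cV[R]_m)
    (Y Z : vfield) : R :=
  dfun x v (app_form w Y Z)
  - mxform (w x) (nabla x v Y) (Z x) - mxform (w x) (Y x) (nabla x v Z).

(* t is the value at x of the torsion tensor *)
Definition torsion_at (nabla : covderiv) x
    (t : 'cV[R]_m -> 'cV[R]_m -> 'cV[R]_m) : Prop :=
  forall X Y, smooth_vfield_near x X -> smooth_vfield_near x Y ->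
    torsion nabla X Y x = t (X x) (Y x).

Record almostHypercomplex := AlmostHypercomplex {
  J1 : mxfield;
  J2 : mxfield;
  J3 : mxfield;
  J1_smooth : smooth_endo J1;
  J2_smooth : smooth_endo J2;
  J3_smooth : smooth_endo J3;
  J1_sqr : forall x, J1 x *m J1 x = - 1%:M;
  J2_sqr : forall x, J2 x *m J2 x = - 1%:M;
  J3_sqr : forall x, J3 x *m J3 x = - 1%:M;
  J12 : forall x, J1 x *m J2 x = J3 x;
  J21 : forall x, - (J2 x *m J1 x) = J3 x
}.

Record scalarForm (H : almostHypercomplex) := ScalarForm {
  sform :> mxfield;
  sform_smooth : smooth_form sform;
  sform_skew : forall x, (sform x)^T = - sform x;
  sform_nondegenerate : forall x, sform x \in unitmx;
  sform_J1 : forall x u v,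
    mxform (sform x) (J1 H x *m u) (J1 H x *m v) = mxform (sform x) u v;
  sform_J2 : forall x u v,
    mxform (sform x) (J2 H x *m u) (J2 H x *m v) = mxform (sform x) u v;
  sform_J3 : forall x u v,
    mxform (sform x) (J3 H x *m u) (J3 H x *m v) = mxform (sform x) u v
}.

Record is_obata (H : almostHypercomplex) (nabla : covderiv) : Prop := IsObata {
  obata_connection : is_connection nabla;
  obata_J1 : parallel_endo nabla (J1 H);
  obata_J2 : parallel_endo nabla (J2 H);
  obata_J3 : parallel_endo nabla (J3 H);
  obata_torsion : forall x X Y,
    smooth_vfield_near x X -> smooth_vfield_near x Y ->
    torsion nabla X Y x =
      6%:R^-1 *: (nijenhuis (J1 H) X Y x + nijenhuis (J2 H) X Y x
                  + nijenhuis (J3 H) X Y x)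
}.

(* nabla = nablaH + A, where w(A(X,Y),Z) = 1/2 (nablaH_X w)(Y,Z); A is
   determined by this equation because w is nondegenerate *)
Definition is_canonical (w : mxfield) (nablaH nabla : covderiv) : Prop :=
  exists A : M -> 'cV[R]_m -> 'cV[R]_m -> 'cV[R]_m,
    (forall x v Y Z, smooth_vfield_near x Y -> smooth_vfield_near x Z ->
       mxform (w x) (A x v (Y x)) (Z x) = 2%:R^-1 * cov_form nablaH w x v Y Z)
    /\ (forall x v Y, smooth_vfield_near x Y ->
          nabla x v Y = nablaH x v Y + A x v (Y x)).

End Fields.

Section Modules.
Variables (R : realType) (n : nat).
(* a tangent space with the values at that point of J_1, J_2, J_3 and w *)
Variables (j1 j2 j3 w : 'M[R]_(4 * n)).

Local Notation C := R[i].
Local Notation V := 'cV[R]_(4 * n).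
Local Notation VC := 'cV[C]_(4 * n).
Local Notation toVC := (map_mx (real_complex R)).
Local Notation iC := (Complex (0 : R) 1).

(* the matrix S of the quaternionic structure z |-> S conj(z) of C^(2k):
   e_i |-> e_(k+i) and e_(k+i) |-> - e_i for i < k *)
Definition quat_mx (k : nat) : 'M[C]_(2 * k) :=
  \matrix_(p, q) ((p == q + k :> nat)%N%:R - (q == p + k :> nat)%N%:R).

Local Notation S_E := (quat_mx n).
(* S_H is also the matrix of the Sp(1)-invariant skew form of H *)
Local Notation S_H := (quat_mx 1 : 'M[C]_2).

(* the action of J_1, J_2, J_3 on H *)
Definition q1 : 'M[C]_2 := \matrix_(a, b) ((a == b)%:R * (-1) ^+ a * iC).
Definition q2 : 'M[C]_2 := S_H.
Definition q3 : 'M[C]_2 := q1 *m q2.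

Definition mapC (B : 'M[R]_(4 * n)) : 'M[C]_(4 * n) := toVC B.
Definition wC (u v : VC) : C := (u^T *m mapC w *m v) 0 0.

Definition complexify (t : V -> V -> V) (u v : VC) : VC :=
  let ru := map_mx (@complex.Re R) u in let iu := map_mx (@complex.Im R) u in
  let rv := map_mx (@complex.Re R) v in let iv := map_mx (@complex.Im R) v in
  toVC (t ru rv - t iu iv) + iC *: toVC (t ru iv + t iu rv).

(* An isomorphism of V with [EH]: f i a is the image of e_i (x) h_a under a
   complex linear isomorphism of E (x) H, E = C^(2n), H = C^2, with the
   complexification of V which matches the actions of Sp(1), carries g (x) w_H
   to w (g the standard complex symmetric form of E, w_H given by S_H), and
   is real, i.e. carries the tensor product of the quaternionic structures of
   E and H to complex conjugation. It is bijective by [adapted_w]. *)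
Definition EHframe := 'I_(2 * n) -> 'I_2 -> VC.

Record adapted (f : EHframe) : Prop := Adapted {
  adapted_real : forall i a,
    map_mx (@conjc R) (f i a) = \sum_j \sum_b (S_E j i * S_H b a) *: f j b;
  adapted_j1 : forall i a, mapC j1 *m f i a = \sum_b q1 b a *: f i b;
  adapted_j2 : forall i a, mapC j2 *m f i a = \sum_b q2 b a *: f i b;
  adapted_j3 : forall i a, mapC j3 *m f i a = \sum_b q3 b a *: f i b;
  adapted_w : forall i j a b, wC (f i a) (f j b) = (i == j)%:R * S_H a b
}.

(* Elements of E (x) E (x) E and of H (x) H (x) H, by components in the standard
   bases. E is identified with its dual by g, and H by w_H. *)
Definition Etensor := 'I_(2 * n) -> 'I_(2 * n) -> 'I_(2 * n) -> C.
Definition Htensor := 'I_2 -> 'I_2 -> 'I_2 -> C.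

(* the components of w(t(X,Y),Z), an element of the third tensor power of EH *)
Definition EHcomp (f : EHframe) (t : V -> V -> V)
    (i j k : 'I_(2 * n)) (a b c : 'I_2) : C :=
  wC (complexify t (f i a) (f j b)) (f k c).

(* w(t(X,Y),Z) belongs to [W (x) S], where W and S are submodules of the third
   tensor powers of E and of H *)
Definition in_real_form (W : Etensor -> Prop) (S : Htensor -> Prop)
    (f : EHframe) (t : V -> V -> V) : Prop :=
  exists (N : nat) (F : 'I_N -> Etensor) (s : 'I_N -> Htensor),
    [/\ forall r, W (F r),
        forall r, S (s r)
      & forall i j k a b c,
          EHcomp f t i j k a b c = \sum_r F r i j k * s r a b c].

(* submodules of E (x) Lambda^2 E; Lambda^2 E occupies the first two slots *)
Definition Lambda3E : set Etensor := [set F |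
  (forall i j k, F i j k = - F j i k) /\ (forall i j k, F i j k = - F i k j)].
Definition K_skew : set Etensor := [set F |
  [/\ forall i j k, F i j k = - F j i k,
      forall i j k, F i j k + F j k i + F k i j = 0
    & forall j, \sum_i F i j i = 0]].
Definition E_skew : set Etensor := [set F |
  exists th : 'I_(2 * n) -> C, forall i j k,
    F i j k = (i == k)%:R * th j - (j == k)%:R * th i].

(* submodules of E (x) S^2_0 E; S^2_0 E occupies the last two slots *)
Definition in_E_S20E (F : Etensor) : Prop :=
  (forall i j k, F i j k = F i k j) /\ (forall i, \sum_j F i j j = 0).
Definition S30E : set Etensor := [set F |
  in_E_S20E F /\ forall i j k, F i j k = F j i k].
Definition K_sym : set Etensor := [set F |
  [/\ in_E_S20E F,
      forall i j k, F i j k + F j k i + F k i j = 0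
    & forall k, \sum_i F i i k = 0]].
Definition E_sym : set Etensor := [set F |
  exists th : 'I_(2 * n) -> C, forall i j k,
    F i j k = (i == j)%:R * th k + (i == k)%:R * th j
              - n%:R^-1 * ((j == k)%:R * th i)].

Definition S3H : set Htensor := [set s |
  (forall a b c, s a b c = s b a c) /\ (forall a b c, s a b c = s a c b)].
(* the copy of H in H (x) H (x) H that pairs with endomorphisms commuting with
   the J_a: if B acts on E only, then w(B(e h), e' h') = g(B e, e') w_H(h, h') *)
Definition Hslot1 : set Htensor := [set s |
  exists eta : 'I_2 -> C, forall a b c, s a b c = eta a * S_H b c].

Definition two_form_valued (t : V -> V -> V) : Prop :=
  [/\ forall u, linear (t u), forall v, linear (t^~ v)
    & forall u v, t u v = - t v u].

Definition S20E_endo (B : 'M[R]_(4 * n)) : Prop :=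
  [/\ \tr B = 0,
      [/\ B *m j1 = j1 *m B, B *m j2 = j2 *m B & B *m j3 = j3 *m B]
    & forall u v, mxform w (B *m u) v = - mxform w (B *m v) u].

Definition delta (A : V -> 'M[R]_(4 * n)) : V -> V -> V :=
  fun u v => A u *m v - A v *m u.

Definition pi_w (t : V -> V -> V) (x y z : V) : R :=
  mxform w (t x y) z + mxform w (t y z) x + mxform w (t z x) y.

(* [W S^3 H]^* in Lambda^2 V^* (x) V, for W in E (x) Lambda^2 E; the
   S^3 H-isotypic part of the third tensor power of H is the space of
   symmetric tensors *)
Definition S3H_part (W : set Etensor) (f : EHframe) (t : V -> V -> V) : Prop :=
  two_form_valued t /\ in_real_form W S3H f t.

(* the image under delta of [W H]^* in [EH]^* (x) [S^2_0 E]^* *)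
Definition delta_part (W : set Etensor) (f : EHframe) (t : V -> V -> V) : Prop :=
  exists A : V -> 'M[R]_(4 * n),
    [/\ linear A, forall u, S20E_endo (A u),
        in_real_form W Hslot1 f (fun u v => A u *m v)
      & forall u v, t u v = delta A u v].

Definition X1 := S3H_part K_skew.
Definition X2 := S3H_part Lambda3E.
Definition X3 := delta_part K_sym.
Definition X4 := delta_part E_sym.
Definition X5 := delta_part S30E.
Definition X6 := S3H_part E_skew.
Definition X7 (f : EHframe) (t : V -> V -> V) : Prop :=
  (forall x y z, pi_w t x y z = 0) /\
  exists (t4 : V -> V -> V) (th : V -> R),
    [/\ X4 f t4, scalar th
      & forall u v, t u v = t4 u v + delta (fun y => (th y)%:M) u v].

Definition Xmod (i : nat) (f : EHframe) (t : V -> V -> V) : Prop :=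
  match i with
  | 1 => X1 f t | 2 => X2 f t | 3 => X3 f t | 4 => X4 f t
  | 5 => X5 f t | 6 => X6 f t | 7 => X7 f t
  | _ => False
  end.

(* the t_ i, for i in s, are the components of t in the sum of the X_i *)
Definition Xcomponents (s : seq nat) (f : EHframe) (t : V -> V -> V)
    (t_ : nat -> V -> V -> V) : Prop :=
  (forall i, i \in s -> Xmod i f (t_ i)) /\
  (forall u v, t u v = \sum_(i <- s) t_ i u v).

End Modules.

Section Types.
Variables (R : realType) (n : nat) (M : smoothManifold R (4 * n)).
Variables (H : almostHypercomplex M) (w : scalarForm H).

Definition adapted_at (x : M) : EHframe R n -> Prop :=
  adapted (J1 H x) (J2 H x) (J3 H x) (sform w x).

Definition Xcomponents_at (x : M) :=
  Xcomponents (J1 H x) (J2 H x) (J3 H x) (sform w x).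

(* The submodules do not depend on the choice of the adapted frame f, and
   adapted frames exist at every point. *)
Definition torsion_type (nabla : covderiv M) (s : seq nat) : Prop :=
  forall x : M, exists (f : EHframe R n) t t_,
    [/\ adapted_at x f, torsion_at nabla x t & Xcomponents_at x s f t t_].

Definition torsion_components_vanish (nabla : covderiv M) (s : seq nat) : Prop :=
  forall (x : M) (f : EHframe R n) t t_,
    adapted_at x f -> torsion_at nabla x t ->
    Xcomponents_at x [:: 1; 2; 3; 4; 5; 6; 7]%N f t t_ ->
    forall i, i \in s -> forall u v, t_ i u v = 0.

End Types.

(* Main.v *)
(* At a point, write a torsion t through its components w(t(X,Y),Z) in an
   adapted frame of E (x) H. Since the canonical connection preserves w, dw is
   the cyclic sum pi_w of its torsion, so the theorem is linear algebra: pi_w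
   kills X_1, X_5, X_6, X_7 and is injective on X_2 + X_3 + X_4. For the
   injectivity, cyc t_2 = 3 t_2 is symmetric in the H slots, while the cyclic
   sum of an element of X_3 + X_4 = delta(G (x) w_H) vanishes after
   symmetrisation in the H slots; so t_2 = 0, and then G is invariant under
   cyclic permutation of its E slots, which is impossible in K + E unless G = 0.
   That the torsion has components in X_1, ..., X_7 at all is seen by splitting
   it as T^H + delta(A): each N_J anticommutes with J in both arguments, which
   forces T^H to be totally symmetric in the H slots, and A commutes with the
   J_a, which forces its last two H slots to be proportional to w_H. The
   components are then explicit projections, averaged with their conjugates to
   make them real. *)

Require Import Defs.
From HB Require Import structures.
From mathcomp Require Import all_boot all_order all_algebra.
From mathcomp Require Import complex.
From mathcomp Require Import all_classical all_reals all_analysis.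
From mathcomp Require Import ring lra zify.

Set Implicit Arguments.
Unset Strict Implicit.
Unset Printing Implicit Defensive.

Import Order.TTheory GRing.Theory Num.Theory.
Import numFieldNormedType.Exports.

Local Open Scope classical_set_scope.
Local Open Scope ring_scope.

(** The modules are real forms, while all computations run on complex components. [realization] goes
    back from components to real tensors by taking a real part; since this averages the components
    with their conjugates, the projections may be arbitrary complex formulas and only the submodules
    must be stable under conjugation. A type asserts that a frame exists at each point, so adapted
    frames have to be built. This is a Gram-Schmidt process for a quaternionic skew-Hermitian form.
    No signature obstructs it: inside one quaternionic line the triple of values w(v, J_a v) can be
    turned in any direction, in particular to the sign that the normal form wants. The endomorphisms
    commuting with the J_a and symmetric on E form S^2 E, which contains the line of Id besides
    S^2_0 E. That line enters the torsion only through X_7, coupled with an E part of S^2_0 E, and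
    the coupled part has to be taken out of the X_4 component. Fields are arbitrary sections that
    are smooth near a point only, so connections must first be shown to be local before Christoffel
    symbols, and with them torsion tensors, are available. *)

Section LinearMaps.
Variables (K : pzRingType) (U V : lmodType K) (h : U -> V).
Hypothesis h_lin : linear h.

Let hL : {linear U -> V} := HB.pack h (GRing.isLinear.Build K U V *:%R h h_lin).

Lemma lin_sum I (r : seq I) (P : pred I) (F : I -> U) :
  h (\sum_(i <- r | P i) F i) = \sum_(i <- r | P i) h (F i).
Proof. exact: (linear_sum hL). Qed.

Lemma linD u v : h (u + v) = h u + h v. Proof. exact: (linearD hL). Qed.
Lemma linB u v : h (u - v) = h u - h v. Proof. exact: (linearB hL). Qed.
Lemma linN u : h (- u) = - h u. Proof. exact: (linearN hL). Qed.
Lemma linZ a u : h (a *: u) = a *: h u. Proof. exact: (linearZZ hL). Qed.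
Lemma lin0 : h 0 = 0. Proof. exact: (linear0 hL). Qed.
End LinearMaps.

Lemma scalZ (K : pzRingType) (U : lmodType K) (h : U -> K) (h_lin : scalar h) a u :
  h (a *: u) = a * h u.
Proof. exact: (@linZ K U K^o h h_lin). Qed.

Lemma ord2P (P : 'I_2 -> Prop) : P 0 -> P 1 -> forall a, P a.
Proof.
move=> P0 P1 [[|[|//]] h].
  by rewrite (_ : Ordinal h = 0) //; apply: val_inj.
by rewrite (_ : Ordinal h = 1) //; apply: val_inj.
Qed.

Lemma big_ord2 (V : nmodType) (F : 'I_2 -> V) : \sum_a F a = F 0 + F 1.
Proof.
rewrite big_ord_recl big_ord_recl big_ord0 addr0; congr (F _ + F _).
exact: val_inj.
Qed.

Lemma col_sum_delta (K : pzRingType) k (u : 'cV[K]_k) : u = \sum_i u i 0 *: delta_mx i 0.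
Proof. by rewrite {1}[u]matrix_sum_delta; apply: eq_bigr => i _; rewrite big_ord1. Qed.

(** * The quaternionic structures of E and H in coordinates *)

Section QuaternionicStructure.
Variable R : realType.
Local Notation C := R[i].
Local Notation iC := (Complex (0 : R) 1).

Lemma iC_sqr : iC * iC = -1 :> C. Proof. by rewrite -expr2 sqr_i. Qed.

Lemma quat_mx1E : ((quat_mx R 1 0 0 = 0) * (quat_mx R 1 0 1 = -1)
  * (quat_mx R 1 1 0 = 1) * (quat_mx R 1 1 1 = 0))%type.
Proof. by rewrite !mxE /= !subr0 !sub0r. Qed.

Lemma q1E : ((q1 R 0 0 = Complex 0 1) * (q1 R 0 1 = 0) * (q1 R 1 0 = 0)
  * (q1 R 1 1 = - Complex 0 1))%type.
Proof.
by split; first split; first split; rewrite !mxE /= ?expr1 ?mul1r ?mul0r ?mulN1r.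
Qed.

Lemma quat_mx1_skew a b : quat_mx R 1 a b = - quat_mx R 1 b a.
Proof.
by elim/ord2P: a; elim/ord2P: b; rewrite !quat_mx1E ?opprK ?oppr0.
Qed.

Section Bar.
Variable k : nat.

Lemma bar_ord_subproof (i : 'I_(2 * k)) :
  ((if i < k then i + k else i - k) < 2 * k)%N.
Proof. have := ltn_ord i; case: (ltnP i k) => hi; lia. Qed.

(* the columns of [quat_mx k] are e_i |-> sg i * e_(bar i) *)
Definition bar_ord (i : 'I_(2 * k)) : 'I_(2 * k) := Ordinal (bar_ord_subproof i).
Definition bar_sign (i : 'I_(2 * k)) : C := (-1) ^+ (k <= i)%N.

Lemma bar_ordK : involutive bar_ord.
Proof.
move=> i; apply: val_inj => /=; have := ltn_ord i.
by case: (ltnP i k) => hi hi2; case: ifP => hj; lia.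
Qed.

Lemma quat_mxE j i : quat_mx R k j i = bar_sign i * (j == bar_ord i)%:R.
Proof.
rewrite mxE /bar_sign -(inj_eq val_inj j) /=; have := ltn_ord i; have := ltn_ord j.
case: (ltnP i k) => hi hj hi2.
  rewrite expr0 mul1r (_ : (nat_of_ord i == j + k)%N = false) ?subr0 //.
  by apply/eqP; lia.
rewrite expr1 mulN1r (_ : (nat_of_ord j == i + k)%N = false) ?sub0r.
  by congr (- _%:R); congr (nat_of_bool _); apply/eqP/eqP; lia.
by apply/eqP; lia.
Qed.

Lemma bar_sign_sqr i : bar_sign i * bar_sign i = 1.
Proof. by rewrite /bar_sign -expr2 sqrr_sign. Qed.

Lemma conj_bar_sign i : conjc (bar_sign i) = bar_sign i.
Proof. by rewrite /bar_sign rmorphXn rmorphN rmorph1. Qed.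

End Bar.

Lemma bar_sign1E : ((bar_sign (k := 1) 0 = 1) * (bar_sign (k := 1) 1 = -1))%type.
Proof. by []. Qed.

Lemma bar_ord1E : ((bar_ord (k := 1) 0 = 1) * (bar_ord (k := 1) 1 = 0))%type.
Proof. by split; apply: val_inj. Qed.

End QuaternionicStructure.

(** * Complexification of real bilinear maps *)

Section ComplexVectors.
Variables (R : realType) (n : nat) (w : 'M[R]_(4 * n)).
Local Notation C := R[i].
Local Notation V := 'cV[R]_(4 * n).
Local Notation VC := 'cV[C]_(4 * n).
Local Notation toVC := (map_mx (real_complex R)).
Local Notation iC := (Complex (0 : R) 1).
Local Notation ReV := (map_mx (@complex.Re R)).
Local Notation ImV := (map_mx (@complex.Im R)).
Local Notation cc := (map_mx (@conjc R)).

Lemma toVC_re_im (u : VC) : u = toVC (ReV u) + iC *: toVC (ImV u).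
Proof. by apply/matrixP=> i j; rewrite !mxE; exact: complexE. Qed.

Lemma cc_re_im (u : VC) : cc u = toVC (ReV u) - iC *: toVC (ImV u).
Proof.
apply/matrixP=> i j; rewrite !mxE; case: (u i j) => a b /=.
by rewrite -[RHS]/(Complex _ _); simpc.
Qed.

Lemma ReV_toVC (u : V) : ReV (toVC u) = u.
Proof. by apply/matrixP=> i j; rewrite !mxE. Qed.

Lemma ImV_toVC (u : V) : ImV (toVC u) = 0.
Proof. by apply/matrixP=> i j; rewrite !mxE. Qed.

Lemma toVC_ReV (u : VC) : toVC (ReV u) = 2^-1 *: (u + cc u).
Proof.
apply/matrixP=> i j; rewrite !mxE; case: (u i j) => a b /=.
have two_neq0 : (2 : C) != 0 by rewrite pnatr_eq0.
apply: (mulfI two_neq0); rewrite mulrA mulfV // mul1r mulr_natl mulr2n.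
by rewrite -[RHS]/(Complex _ _) subrr -[LHS]/(Complex _ _) addr0.
Qed.

Lemma ccK : involutive (cc : VC -> VC).
Proof. by move=> u; apply/matrixP=> i j; rewrite !mxE conjcK. Qed.

Lemma cc_toVC (u : V) : cc (toVC u) = toVC u.
Proof. by apply/matrixP=> i j; rewrite !mxE conjc_real. Qed.

Lemma ccZ a (u : VC) : cc (a *: u) = conjc a *: cc u.
Proof. by rewrite map_mxZ. Qed.

Lemma wC_linl v : scalar (fun u => wC w u v).
Proof.
by move=> a u u'; rewrite /wC linearD linearZ /= !mulmxDl -!scalemxAl !mxE.
Qed.

Lemma wC_linr u : scalar (wC w u).
Proof. by move=> a v v'; rewrite /wC linearD linearZ /= !mxE. Qed.

Lemma wC_toVC u v : wC w (toVC u) (toVC v) = (mxform w u v)%:C%C.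
Proof. by rewrite /wC /mapC map_trmx -!map_mxM mxE. Qed.

Lemma wC_cc u v : wC w (cc u) (cc v) = conjc (wC w u v).
Proof.
rewrite /wC map_trmx; have {1}-> : mapC w = cc (mapC w).
  by apply/matrixP=> i j; rewrite !mxE conjc_real.
by rewrite -!map_mxM mxE.
Qed.

Lemma mxform_linl v : scalar (fun u => mxform w u v).
Proof.
by move=> a u u'; rewrite /mxform linearD linearZ /= !mulmxDl -!scalemxAl !mxE.
Qed.

Lemma mxform_linr u : scalar (mxform w u).
Proof. by move=> a v v'; rewrite /mxform linearD linearZ /= !mxE. Qed.

Section Skew.
Hypothesis w_skew : w^T = - w.

Lemma mxform_skew u v : mxform w u v = - mxform w v u.
Proof.
have -> : mxform w u v = ((u^T *m w *m v)^T) 0 0 by rewrite mxE.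
by rewrite !trmx_mul trmxK w_skew mulNmx mulmxN mxE mulmxA.
Qed.

Lemma wC_skew u v : wC w u v = - wC w v u.
Proof.
have w_skewC : (mapC w)^T = - mapC w by rewrite /mapC map_trmx w_skew map_mxN.
have -> : wC w u v = ((u^T *m mapC w *m v)^T) 0 0 by rewrite mxE.
by rewrite !trmx_mul trmxK w_skewC mulNmx mulmxN mxE mulmxA.
Qed.
End Skew.

Definition bilin (t : V -> V -> V) :=
  (forall u, linear (t u)) /\ (forall v, linear (t^~ v)).

(** [complexify] is written with real and imaginary parts, which hides its complex bilinearity. In a
    real basis the coefficients are products of complex coordinates, and linearity in each argument
    can be read off. *)
Lemma complexifyE t : bilin t -> forall U W : VC, complexify t U W =
  \sum_i \sum_j (U i 0 * W j 0) *: toVC (t (delta_mx i 0) (delta_mx j 0)).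
Proof.
move=> [tr tl] U W.
have expand (u v : V) : toVC (t u v) =
    \sum_i \sum_j ((u i 0)%:C * (v j 0)%:C)%C *: toVC (t (delta_mx i 0) (delta_mx j 0)).
  rewrite {1}[u]col_sum_delta (lin_sum (tl v)) raddf_sum; apply: eq_bigr => i _.
  rewrite (linZ (tl v)) {1}[v]col_sum_delta (lin_sum (tr _)) scaler_sumr raddf_sum.
  apply: eq_bigr => j _; rewrite (linZ (tr _)) scalerA.
  by rewrite /= map_mxZ rmorphM.
rewrite /complexify !raddfD !raddfN /= !expand.
rewrite !scaler_sumr -sumrB -!big_split; apply: eq_bigr => i _ /=.
rewrite !scaler_sumr -sumrB -!big_split; apply: eq_bigr => j _ /=.
rewrite !mxE !scalerA -!scalerBl -!scalerDl; congr (_ *: _).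
rewrite [U i 0 in RHS]complexE [W j 0 in RHS]complexE.
set a := (complex.Re (U i 0))%:C%C; set b := (complex.Im (U i 0))%:C%C.
set c := (complex.Re (W j 0))%:C%C; set d := (complex.Im (W j 0))%:C%C.
rewrite mulrDl !mulrDr; have -> : iC * b * (iC * d) = - (b * d).
  by rewrite mulrACA iC_sqr mulN1r.
ring.
Qed.

Lemma complexify_linl t W : bilin t -> linear (fun U => complexify t U W).
Proof.
move=> t_bil a U U'; rewrite !complexifyE // scaler_sumr -big_split.
apply: eq_bigr => i _ /=; rewrite scaler_sumr -big_split; apply: eq_bigr => j _ /=.
by rewrite !mxE scalerA -scalerDl; congr (_ *: _); ring.
Qed.

Lemma complexify_linr t U : bilin t -> linear (complexify t U).
Proof.
move=> t_bil a W W'; rewrite !complexifyE // scaler_sumr -big_split.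
apply: eq_bigr => i _ /=; rewrite scaler_sumr -big_split; apply: eq_bigr => j _ /=.
by rewrite !mxE scalerA -scalerDl; congr (_ *: _); ring.
Qed.

Lemma complexify_toVC t u v : bilin t ->
  complexify t (toVC u) (toVC v) = toVC (t u v).
Proof.
move=> [tr tl]; rewrite /complexify !ReV_toVC !ImV_toVC.
by rewrite !(lin0 (tr _)) (lin0 (tl _)) subr0 addr0 map_mx0 scaler0 addr0.
Qed.

End ComplexVectors.

(** * Tensors in an adapted frame *)

(** [mulmx1C] wants square matrices, while [4 * n] and the number of frame indices are equal without
    being convertible. *)
Lemma mulmx1C_rect (K : comUnitRingType) (m p : nat) (A : 'M[K]_(m, p)) (B : 'M[K]_(p, m)) :
  p = m -> A *m B = 1%:M -> B *m A = 1%:M.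
Proof. by move=> pm; subst p; exact: mulmx1C. Qed.

Lemma big_pair_ord2 (I : finType) (V : nmodType) (F : I * 'I_2 -> V) :
  \sum_p F p = \sum_i (F (i, 0) + F (i, 1)).
Proof.
rewrite (eq_bigr (fun p => F (p.1, p.2))); last by case.
rewrite -(pair_bigA _ (fun i a => F (i, a))) /=.
by apply: eq_bigr => i _; rewrite big_ord2.
Qed.

Lemma sum_quat_mx (R : realType) (n : nat) (V : lmodType R[i])
    (F : 'I_(2 * n) -> 'I_2 -> V) i a :
  \sum_j \sum_b (quat_mx R n j i * quat_mx R 1 b a) *: F j b =
  (bar_sign R i * bar_sign R (k := 1) a) *: F (bar_ord i) (bar_ord (k := 1) a).
Proof.
have SHbar (b : 'I_2) :
    quat_mx R 1 b a = bar_sign R (k := 1) a * (b == bar_ord (k := 1) a)%:R.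
  exact: (@quat_mxE R 1 b a).
rewrite (bigD1 (bar_ord i)) //= [X in _ + X]big1.
  rewrite addr0 (bigD1 (bar_ord (k := 1) a)) //= [X in _ + X]big1.
    by rewrite addr0 quat_mxE SHbar !eqxx !mulr1.
  by move=> b bp; rewrite SHbar (negbTE bp) !mulr0 scale0r.
by move=> j jp; apply: big1 => b _; rewrite quat_mxE (negbTE jp) mulr0 mul0r scale0r.
Qed.

Section Frame.
Variables (R : realType) (n : nat) (j1 j2 j3 w : 'M[R]_(4 * n)) (f : EHframe R n).
Hypothesis f_adapted : adapted j1 j2 j3 w f.
Hypothesis w_skew : w^T = - w.
Local Notation C := R[i].
Local Notation V := 'cV[R]_(4 * n).
Local Notation VC := 'cV[C]_(4 * n).
Local Notation toVC := (map_mx (real_complex R)).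
Local Notation iC := (Complex (0 : R) 1).
Local Notation ReV := (map_mx (@complex.Re R)).
Local Notation ImV := (map_mx (@complex.Im R)).
Local Notation cc := (map_mx (@conjc R)).
Local Notation T := ('I_(2 * n) * 'I_2)%type.
Local Notation SH := (quat_mx R 1).
Local Notation tensor := (T -> T -> T -> C).
Implicit Types (p q r : T) (c : tensor).

Definition frame_vec p : VC := f p.1 p.2.
(** The frame dual to [frame_vec] under [wC w]: the frame is orthonormal on the E side, and [S_H] is
    an orthogonal matrix, so contracting the H index with it inverts the pairing. *)
Definition fd p : VC := \sum_b SH b p.2 *: f p.1 b.

Lemma fd0 i : fd (i, 0) = frame_vec (i, 1).
Proof. by rewrite /fd big_ord2 !quat_mx1E scale0r add0r scale1r. Qed.

Lemma fd1 i : fd (i, 1) = - frame_vec (i, 0).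
Proof. by rewrite /fd big_ord2 !quat_mx1E scale0r addr0 scaleN1r. Qed.

Lemma wC_fr p q : wC w (frame_vec p) (frame_vec q) = (p.1 == q.1)%:R * SH p.2 q.2.
Proof. exact: (adapted_w f_adapted). Qed.

Lemma wC_fd_fr p q : wC w (fd p) (frame_vec q) = (p == q)%:R.
Proof.
case: p => i a; case: q => j b; rewrite xpair_eqE.
elim/ord2P: a.
  by rewrite fd0 wC_fr /=; elim/ord2P: b; rewrite !quat_mx1E ?mulr0 ?mulr1 ?andbT ?andbF.
rewrite fd1 (linN (@wC_linl _ _ w _)) wC_fr /=.
by elim/ord2P: b; rewrite !quat_mx1E ?mulr0 ?mulrN1 ?opprK ?oppr0 ?andbT ?andbF.
Qed.

(** Duality gives a one-sided inverse [Q *m P = 1]; since there are as many frame vectors as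
    dimensions, the inverse is two-sided and the frame spans. *)
Lemma fr_expand (u : VC) : u = \sum_p wC w (fd p) u *: frame_vec p.
Proof.
pose P : 'M[C]_(4 * n, #|{: T}|) := \matrix_(x, k) frame_vec (enum_val k) x 0.
pose Q : 'M[C]_(#|{: T}|, 4 * n) :=
  \matrix_(k, x) ((fd (enum_val k))^T *m mapC w) 0 x.
have QP : Q *m P = 1%:M.
  apply/matrixP=> k l; rewrite [RHS]mxE -(inj_eq enum_val_inj) -wC_fd_fr /wC !mxE.
  by apply: eq_bigr => x _; rewrite [Q _ _]mxE [P _ _]mxE.
have cardT : (4 * n)%N = #|{: T}| by rewrite card_prod !card_ord; lia.
have PQ := mulmx1C_rect cardT QP.
rewrite -[u in LHS]mul1mx -PQ -mulmxA; apply/matrixP=> x y.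
rewrite ord1 mxE summxE (reindex (@enum_val T {: T})) /=; last first.
  by apply: onW_bij; exact: enum_val_bij.
apply: eq_bigr => k _; rewrite [P _ _]mxE [RHS]mxE mulrC; congr (_ * _).
by rewrite /wC !mxE; apply: eq_bigr => z _; rewrite [Q _ _]mxE.
Qed.

Lemma fd_expand (u : VC) : u = \sum_p wC w u (frame_vec p) *: fd p.
Proof.
rewrite [LHS]fr_expand !big_pair_ord2; apply: eq_bigr => i _; rewrite fd0 fd1.
rewrite (linN (@wC_linl _ _ w _)).
rewrite (wC_skew w_skew u (frame_vec (i, 0))) (wC_skew w_skew u (frame_vec (i, 1))).
move: (frame_vec (i, 0)) (frame_vec (i, 1)) => x y; move: (wC w x u) (wC w y u) => a b.
by rewrite addrC scaleNr scaleNr scalerN opprK.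
Qed.

Lemma eq_wC_fr (u v : VC) : (forall p, wC w u (frame_vec p) = wC w v (frame_vec p)) -> u = v.
Proof.
by move=> uv; rewrite [u]fd_expand [v]fd_expand; apply: eq_bigr => p _; rewrite uv.
Qed.

Definition bar p : T := (bar_ord p.1, bar_ord (k := 1) p.2).
Definition sgn p : C := bar_sign R p.1 * bar_sign R (k := 1) p.2.

Lemma cc_fr p : cc (frame_vec p) = sgn p *: frame_vec (bar p).
Proof. by rewrite (adapted_real f_adapted) sum_quat_mx. Qed.

Lemma conj_sgn p : conjc (sgn p) = sgn p.
Proof. by rewrite /sgn rmorphM /= !conj_bar_sign. Qed.

(* complex conjugation, read on components in the frame f *)
Definition sigma c : tensor := fun p q r =>
  sgn p * sgn q * sgn r * conjc (c (bar p) (bar q) (bar r)).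

Definition EHtensor (t : V -> V -> V) : tensor := fun p q r =>
  wC w (complexify t (frame_vec p) (frame_vec q)) (frame_vec r).

(** The complex bilinear map with components [c]. Its values are expanded in the dual frame because
    components lower the third slot by [w]. *)
Definition of_comp c (U W : VC) : VC :=
  \sum_p \sum_q \sum_r (wC w (fd p) U * wC w (fd q) W * c p q r) *: fd r.

Lemma of_comp_linl c W : linear (fun U => of_comp c U W).
Proof.
move=> a U U'; do 3![rewrite scaler_sumr -big_split; apply: eq_bigr => ? _ /=].
by rewrite wC_linr scalerA -scalerDl; congr (_ *: _); ring.
Qed.

Lemma of_comp_linr c U : linear (of_comp c U).
Proof.
move=> a W W'; do 3![rewrite scaler_sumr -big_split; apply: eq_bigr => ? _ /=].
by rewrite wC_linr scalerA -scalerDl; congr (_ *: _); ring.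
Qed.

Lemma of_comp_fr c p q r : wC w (of_comp c (frame_vec p) (frame_vec q)) (frame_vec r) = c p q r.
Proof.
have linl := @wC_linl _ _ w (frame_vec r).
rewrite (lin_sum linl) (bigD1 p) //= [X in _ + X]big1 ?addr0; last first.
  move=> p' p'p; rewrite !big1 ?(lin0 linl) // => q' _.
  by rewrite big1 // => r' _; rewrite wC_fd_fr (negbTE p'p) !mul0r scale0r.
rewrite (lin_sum linl) (bigD1 q) //= [X in _ + X]big1 ?addr0; last first.
  move=> q' q'q; rewrite !big1 ?(lin0 linl) // => r' _.
  by rewrite !wC_fd_fr (negbTE q'q) mulr0 mul0r scale0r.
rewrite (lin_sum linl) (bigD1 r) //= [X in _ + X]big1 ?addr0; last first.
  by move=> r' r'r; rewrite (scalZ linl) !wC_fd_fr (negbTE r'r) mulr0.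
by rewrite (scalZ linl) !wC_fd_fr !eqxx mulr1 !mul1r.
Qed.

Lemma eq_form_fr (h h' : VC -> VC -> C) :
  (forall W, scalar (h^~ W)) -> (forall U, scalar (h U)) ->
  (forall W, scalar (h'^~ W)) -> (forall U, scalar (h' U)) ->
  (forall p q, h (frame_vec p) (frame_vec q) = h' (frame_vec p) (frame_vec q)) -> forall U W, h U W = h' U W.
Proof.
move=> hl hr hl' hr' hh U W; rewrite [U]fr_expand.
rewrite (lin_sum (hl W)) (lin_sum (hl' W)); apply: eq_bigr => p _.
rewrite (scalZ (hl W)) (scalZ (hl' W)) [W]fr_expand; congr (_ * _).
rewrite (lin_sum (hr _)) (lin_sum (hr' _)); apply: eq_bigr => q _.
by rewrite (scalZ (hr _)) (scalZ (hr' _)) hh.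
Qed.

(** The rows [(fd p)^T *m mapC w] are the coordinate functionals of the frame, so [B] is a sum of
    rank-one matrices. *)
Lemma mxtrace_fr (B : 'M[C]_(4 * n)) : \tr B = \sum_p wC w (fd p) (B *m frame_vec p).
Proof.
have EB : B = \sum_p (B *m frame_vec p) *m ((fd p)^T *m mapC w).
  apply/matrixP=> x y; pose e : VC := delta_mx y 0.
  have /matrixP/(_ x 0) : B *m e = (\sum_p (B *m frame_vec p) *m ((fd p)^T *m mapC w)) *m e.
    rewrite {1}[e]fr_expand mulmx_sumr mulmx_suml; apply: eq_bigr => p _.
    rewrite -scalemxAr -[RHS]mulmxA [_ *m e]mx11_scalar /=.
    by rewrite mul_mx_scalar.
  by rewrite /e -!colE !mxE.
rewrite {1}EB raddf_sum; apply: eq_bigr => p _.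
by rewrite /= mxtrace_mulC /mxtrace big_ord1.
Qed.

Lemma of_comp_unique (h : VC -> VC -> VC) : (forall W, linear (h^~ W)) ->
  (forall U, linear (h U)) ->
  forall U W, h U W = of_comp (fun p q r => wC w (h (frame_vec p) (frame_vec q)) (frame_vec r)) U W.
Proof.
move=> hl hr U W; rewrite {1}[U]fr_expand (lin_sum (hl W)); apply: eq_bigr => p _.
rewrite (linZ (hl W)) {1}[W]fr_expand (lin_sum (hr _)) scaler_sumr.
apply: eq_bigr => q _; rewrite (linZ (hr _)) scalerA.
rewrite {1}[h (frame_vec p) (frame_vec q)]fd_expand scaler_sumr.
by apply: eq_bigr => r _; rewrite scalerA.
Qed.

(** The real part makes any complex tensor real: the components of the result are the mean of [c]
    and [sigma c]. On the components of a real map this changes nothing. *)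
Definition realization c (u v : V) : V := ReV (of_comp c (toVC u) (toVC v)).

Lemma realize_bilin c : bilin (realization c).
Proof.
have toVCP a (u u' : V) : toVC (a *: u + u') = a%:C%C *: toVC u + toVC u'.
  by rewrite map_mxD map_mxZ.
have ReP (a : R) (u u' : VC) : ReV (a%:C%C *: u + u') = a *: ReV u + ReV u'.
  apply/matrixP=> i j; rewrite !mxE; case: (u i j) => x y; case: (u' i j) => x' y' /=.
  by rewrite mul0r subr0.
split=> u a v v'; rewrite /realization toVCP.
  by rewrite of_comp_linr ReP.
by rewrite of_comp_linl ReP.
Qed.

Lemma toVC_realize c u v : toVC (realization c u v) =
  2^-1 *: (of_comp c (toVC u) (toVC v) + cc (of_comp c (toVC u) (toVC v))).
Proof. exact: toVC_ReV. Qed.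

(** Conjugating the arguments and the value of [of_comp c] gives another complex bilinear map, equal
    on real vectors to the conjugate of [of_comp c]; it is the second summand. *)
Lemma complexify_realize c U W : complexify (realization c) U W =
  2^-1 *: (of_comp c U W + cc (of_comp c (cc U) (cc W))).
Proof.
have linl W' := @of_comp_linl c W'; have linr U' := @of_comp_linr c U'.
rewrite [X in of_comp c X _ + _]toVC_re_im [X in of_comp c _ X + _]toVC_re_im.
rewrite [cc U]cc_re_im [cc W]cc_re_im /complexify.
move: (ReV U) (ImV U) (ReV W) (ImV W) => a b a' b'.
rewrite [toVC (_ - _)]map_mxB [toVC (_ + _)]map_mxD.
have E u v := toVC_realize c u v.
move: (realization c) E => rc E.
move: (of_comp c) linl linr E => h linl linr E.
rewrite E. rewrite E. rewrite E. rewrite E.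
move: (toVC a) (toVC b) (toVC a') (toVC b') => {}a {}b {}a' {}b'.
rewrite !(linD (linl _)) !(linN (linl _)) !(linZ (linl _)).
rewrite !(linD (linr _)) !(linN (linr _)) !(linZ (linr _)).
move: (h a a') (h b b') (h a b') (h b a') => x y z t.
have conj_i : conjc iC = - iC by rewrite -[RHS]/(Complex _ _) oppr0.
rewrite !(map_mxD, map_mxN, ccZ) conj_i.
move: (iC) (iC_sqr R) => I I2 /=.
move: (cc x) (cc y) (cc z) (cc t) => x' y' z' t'.
apply/matrixP=> i k; rewrite !mxE.
move: (x i k) (y i k) (z i k) (t i k) (x' i k) (y' i k) (z' i k) (t' i k).
move=> x0 y0 z0 t0 x1 y1 z1 t1.
ring: I2.
Qed.

Lemma tcomp_realize c p q r :
  EHtensor (realization c) p q r = 2^-1 * (c p q r + sigma c p q r).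
Proof.
have linl := @wC_linl _ _ w (frame_vec r).
rewrite /EHtensor complexify_realize (scalZ linl) (linD linl) of_comp_fr.
(* Writing the third vector as a double conjugate allows the whole pairing to be conjugated, which
   bars all three indices at once. *)
congr (_ * (_ + _)); rewrite -[frame_vec r]ccK wC_cc !cc_fr.
rewrite (linZ (@of_comp_linl _ _)) (linZ (@of_comp_linr _ _)).
rewrite !(scalZ (@wC_linl _ _ w _)) (scalZ (@wC_linr _ _ w _)) of_comp_fr.
rewrite /sigma; move: (sgn p) (sgn q) (sgn r) (conj_sgn p) (conj_sgn q) (conj_sgn r).
by move=> x y z hx hy hz; rewrite !rmorphM /= hx hy hz; ring.
Qed.

Lemma complexify_tcomp t U W : bilin t -> complexify t U W = of_comp (EHtensor t) U W.
Proof.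
move=> t_bil; apply: (of_comp_unique (h := complexify t)) => ?.
  exact: complexify_linl.
exact: complexify_linr.
Qed.

Lemma tcomp_realK t u v : bilin t -> realization (EHtensor t) u v = t u v.
Proof.
by move=> t_bil; rewrite /realization -complexify_tcomp // complexify_toVC // ReV_toVC.
Qed.

Lemma eq_tcomp t t' : bilin t -> bilin t' ->
  (forall p q r, EHtensor t p q r = EHtensor t' p q r) -> forall u v, t u v = t' u v.
Proof.
move=> tb tb' tt' u v; have tt : EHtensor t = EHtensor t'.
  by apply/funext=> p; apply/funext=> q; apply/funext=> r; exact: tt'.
by have := tcomp_realK u v tb; rewrite tt (tcomp_realK u v tb') => ->.
Qed.

Lemma realizeD c c' u v :
  realization (fun p q r => c p q r + c' p q r) u v = realization c u v + realization c' u v.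
Proof.
rewrite /realization -raddfD /of_comp -big_split; congr (ReV _); apply: eq_bigr => p _ /=.
rewrite -big_split; apply: eq_bigr => q _ /=.
rewrite -big_split; apply: eq_bigr => r _ /=.
by rewrite mulrDr scalerDl.
Qed.

Lemma realizeN c u v : realization (fun p q r => - c p q r) u v = - realization c u v.
Proof.
rewrite /realization -raddfN /of_comp; congr (ReV _).
do 3![rewrite -sumrN; apply: eq_bigr => ? _].
by rewrite mulrN scaleNr.
Qed.

Lemma realize_swap c u v : realization (fun p q r => c q p r) u v = realization c v u.
Proof.
rewrite /realization /of_comp exchange_big; congr (ReV _).
apply: eq_bigr => p _; apply: eq_bigr => q _; apply: eq_bigr => r _.
by rewrite [X in X * _]mulrC.
Qed.
End Frame.

(** * Submodules of the third tensor power of E stable under conjugation *)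

Section RealSubmodules.
Variables (R : realType) (n : nat).
Local Notation C := R[i].
Local Notation tE := (Etensor R n).
Implicit Types (F G : tE) (W : tE -> Prop).

(** The antilinear map induced by the quaternionic structure of E. On an odd tensor power it squares
    to -1; only its product with the analogous map on H is a real structure. *)
Definition sigmaE F : tE := fun i j k =>
  bar_sign R i * bar_sign R j * bar_sign R k
  * conjc (F (bar_ord i) (bar_ord j) (bar_ord k)).

Record real_submodule W : Prop := RealSubmodule {
  submodule0 : W (fun _ _ _ => 0);
  submodule_lin : forall a F G, W F -> W G -> W (fun i j k => a * F i j k + G i j k);
  submodule_sigma : forall F, W F -> W (sigmaE F)
}.

Lemma submodule_ext W F G : W F -> (forall i j k, F i j k = G i j k) -> W G.
Proof.
move=> WF FG; suff <- : F = G by [].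
by apply/funext=> i; apply/funext=> j; apply/funext=> k.
Qed.

Section Closure.
Variables (W : tE -> Prop) (W_sub : real_submodule W).

Lemma submoduleZ a F : W F -> W (fun i j k => a * F i j k).
Proof.
move=> WF; apply: submodule_ext (submodule_lin W_sub a WF (submodule0 W_sub)) _.
by move=> *; rewrite addr0.
Qed.

Lemma submoduleD F G : W F -> W G -> W (fun i j k => F i j k + G i j k).
Proof.
move=> WF WG; apply: submodule_ext (submodule_lin W_sub 1 WF WG) _.
by move=> *; rewrite mul1r.
Qed.

Lemma submoduleB F G : W F -> W G -> W (fun i j k => F i j k - G i j k).
Proof.
move=> WF WG; apply: submodule_ext (submodule_lin W_sub (-1) WG WF) _.
by move=> *; rewrite mulN1r addrC.
Qed.

Lemma submodule_sum I (r : seq I) (F : I -> tE) (a : I -> C) :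
  (forall x, W (F x)) -> W (fun i j k => \sum_(x <- r) F x i j k * a x).
Proof.
move=> WF; elim: r => [|x r IHr].
  by apply: submodule_ext (submodule0 W_sub) _ => *; rewrite big_nil.
apply: submodule_ext (submodule_lin W_sub (a x) (WF x) IHr) _.
by move=> *; rewrite big_cons [a x * _]mulrC.
Qed.
End Closure.

(** Compatibility of the symmetric form of E with the quaternionic structure; it makes the trace
    parts stable under [sigmaE]. *)
Lemma bar_delta (i k : 'I_(2 * n)) : bar_sign R i * bar_sign R k *
  conjc ((bar_ord i == bar_ord k)%:R : C) = (i == k)%:R.
Proof.
rewrite (inj_eq (inv_inj (@bar_ordK n))) conjc_nat.
by have [->|_] := eqVneq i k; rewrite ?bar_sign_sqr ?mulr1 ?mulr0.
Qed.

Lemma bar_sum (F : 'I_(2 * n) -> C) : \sum_i F (bar_ord i) = \sum_i F i.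
Proof. by rewrite [RHS](reindex_inj (inv_inj (@bar_ordK n))). Qed.

Lemma Lambda3E_sub : real_submodule (@Lambda3E R n).
Proof.
split.
- by split=> *; rewrite oppr0.
- move=> a F G [F1 F2] [G1 G2]; split=> i j k.
    by rewrite F1 G1; ring.
  by rewrite F2 G2; ring.
- move=> F [F1 F2]; split=> i j k; rewrite /sigmaE.
    by rewrite F1 rmorphN /=; ring.
  by rewrite F2 rmorphN /=; ring.
Qed.

Lemma K_skew_sub : real_submodule (@K_skew R n).
Proof.
split.
- by split=> *; rewrite ?oppr0 ?addr0 ?big1.
- move=> a F G [F1 F2 F3] [G1 G2 G3]; split=> [i j k|i j k|j].
  + by rewrite F1 G1; ring.
  + transitivity (a * (F i j k + F j k i + F k i j) + (G i j k + G j k i + G k i j)).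
      by ring.
    by rewrite F2 G2 mulr0 addr0.
  + by rewrite big_split -mulr_sumr /= F3 G3 mulr0 addr0.
- move=> F [F1 F2 F3]; split=> [i j k|i j k|j]; rewrite /sigmaE.
  + by rewrite F1 rmorphN /=; ring.
  (* Conjugate the identity at the barred indices and multiply by the signs. *)
  + have := congr1 conjc (F2 (bar_ord i) (bar_ord j) (bar_ord k)).
    rewrite !rmorphD rmorph0 /= => /(congr1 (fun x => bar_sign R i * bar_sign R j * bar_sign R k * x)).
    by rewrite mulr0 => <-; ring.
  (* The summation index may be barred as well; its two signs cancel. *)
  + have := congr1 conjc (F3 (bar_ord j)).
    rewrite rmorph_sum rmorph0 /= -bar_sum => /(congr1 (fun x => bar_sign R j * x)).
    rewrite mulr0 mulr_sumr => E; rewrite -[RHS]E; apply: eq_bigr => i _.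
    by rewrite -[RHS]mul1r -(bar_sign_sqr R i); ring.
Qed.

Lemma E_skew_sub : real_submodule (@E_skew R n).
Proof.
split.
- by exists (fun=> 0) => i j k; rewrite !mulr0 subr0.
- move=> a F G [th Fth] [th' Gth']; exists (fun i => a * th i + th' i) => i j k.
  by rewrite Fth Gth'; ring.
- move=> F [th Fth]; exists (fun i => bar_sign R i * conjc (th (bar_ord i))) => i j k.
  rewrite /sigmaE Fth rmorphB !rmorphM /= -(bar_delta i k) -(bar_delta j k); ring.
Qed.

Lemma in_E_S20E_sub : real_submodule (@in_E_S20E R n).
Proof.
split.
- by split=> *; rewrite ?big1.
- move=> a F G [F1 F2] [G1 G2]; split=> [i j k|i].
    by rewrite F1 G1.
  by rewrite big_split -mulr_sumr /= F2 G2 mulr0 addr0.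
- move=> F [F1 F2]; split=> [i j k|i]; rewrite /sigmaE.
    by rewrite F1; ring.
  have := congr1 conjc (F2 (bar_ord i)).
  rewrite rmorph_sum rmorph0 /= -bar_sum => /(congr1 (fun x => bar_sign R i * x)).
  rewrite mulr0 mulr_sumr => E; rewrite -[RHS]E; apply: eq_bigr => j _.
  by rewrite -[RHS]mul1r -(bar_sign_sqr R j); ring.
Qed.

Lemma S30E_sub : real_submodule (@S30E R n).
Proof.
have [W0 Wl Ws] := in_E_S20E_sub.
split.
- by split.
- move=> a F G [F1 F2] [G1 G2]; split; first exact: Wl.
  by move=> i j k; rewrite F2 G2.
- move=> F [F1 F2]; split; first exact: Ws.
  by move=> i j k; rewrite /sigmaE F2; ring.
Qed.

Lemma K_sym_sub : real_submodule (@K_sym R n).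
Proof.
have [W0 Wl Ws] := in_E_S20E_sub.
split.
- by split=> // *; rewrite ?addr0 ?big1.
- move=> a F G [F1 F2 F3] [G1 G2 G3]; split=> [|i j k|k]; first exact: Wl.
  + transitivity (a * (F i j k + F j k i + F k i j) + (G i j k + G j k i + G k i j)).
      by ring.
    by rewrite F2 G2 mulr0 addr0.
  + by rewrite big_split -mulr_sumr /= F3 G3 mulr0 addr0.
- move=> F [F1 F2 F3]; split=> [|i j k|k]; first exact: Ws.
  + have := congr1 conjc (F2 (bar_ord i) (bar_ord j) (bar_ord k)).
    rewrite !rmorphD rmorph0 /= => /(congr1 (fun x => bar_sign R i * bar_sign R j * bar_sign R k * x)).
    by rewrite mulr0 => <-; rewrite /sigmaE; ring.
  + have := congr1 conjc (F3 (bar_ord k)).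
    rewrite rmorph_sum rmorph0 /= -bar_sum => /(congr1 (fun x => bar_sign R k * x)).
    rewrite mulr0 mulr_sumr => E; rewrite -[RHS]E; apply: eq_bigr => i _.
    by rewrite /sigmaE bar_sign_sqr mul1r.
Qed.

Lemma E_sym_sub : real_submodule (@E_sym R n).
Proof.
split.
- by exists (fun=> 0) => i j k; rewrite !mulr0 subr0 addr0.
- move=> a F G [th Fth] [th' Gth']; exists (fun i => a * th i + th' i) => i j k.
  by rewrite Fth Gth'; ring.
- move=> F [th Fth]; exists (fun i => bar_sign R i * conjc (th (bar_ord i))) => i j k.
  rewrite /sigmaE Fth rmorphB rmorphD !rmorphM /= conjc_inv (conjc_nat R n).
  by rewrite -(bar_delta i j) -(bar_delta i k) -(bar_delta j k); ring.
Qed.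

Lemma sum_delta (th : 'I_(2 * n) -> C) i : \sum_j (i == j)%:R * th j = th i.
Proof.
rewrite (bigD1 i) //= eqxx mul1r big1 ?addr0 // => j ji.
by rewrite eq_sym (negbTE ji) mul0r.
Qed.

Lemma sum_deltar (th : 'I_(2 * n) -> C) i : \sum_j (j == i)%:R * th j = th i.
Proof. by rewrite -[RHS]sum_delta; apply: eq_bigr => j _; rewrite eq_sym. Qed.

Lemma sum_delta_diag (c : C) : \sum_(j < 2 * n) (j == j)%:R * c = 2 * n%:R * c.
Proof.
under eq_bigr do rewrite eqxx mul1r.
by rewrite sumr_const card_ord -[_ *+ (2 * n)]mulr_natl natrM.
Qed.

(** The coefficient 1/n is made for this: the first two terms have trace [2 * th i], and the third
    runs over the 2n basis vectors of E. *)
Lemma E_sym_S20E F : (0 < n)%N -> E_sym F -> in_E_S20E F.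
Proof.
move=> n_gt0 [th Fth]; split=> [i j k|i].
  by rewrite !Fth (eq_sym j k); ring.
under eq_bigr do rewrite Fth eqxx mul1r.
rewrite sumrB big_split /= sum_delta sumr_const card_ord -[_ *+ (2 * n)]mulr_natl natrM.
have n_neq0 : (n%:R : C) != 0 by rewrite pnatr_eq0 -lt0n.
by rewrite mulrA mulfK //; ring.
Qed.

End RealSubmodules.

(** The data at one point. Invariance is kept in its infinitesimal form, equivalent to w(Jx, Jy) =
    w(x, y) because J^2 = -1; for [j3] it follows from [j1] and [j2]. *)
Record quat_skewHermitian (R : realType) (m : nat) (j1 j2 j3 w : 'M[R]_m) : Prop :=
  QuatSkewHermitian {
    qsh_skew : w^T = - w;
    qsh_unit : w \in unitmx;
    qsh_j1 : j1 *m j1 = - 1%:M;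
    qsh_j2 : j2 *m j2 = - 1%:M;
    qsh_j12 : j1 *m j2 = j3;
    qsh_j21 : - (j2 *m j1) = j3;
    qsh_w1 : j1^T *m w = - (w *m j1);
    qsh_w2 : j2^T *m w = - (w *m j2)
  }.

(** * Components of elements of the real modules, and their construction from tensors *)

Section Realization.
Variables (R : realType) (n : nat) (j1 j2 j3 w : 'M[R]_(4 * n)) (f : EHframe R n).
Hypothesis f_adapted : adapted j1 j2 j3 w f.
Hypothesis qsh : quat_skewHermitian j1 j2 j3 w.
Local Notation C := R[i].
Local Notation V := 'cV[R]_(4 * n).
Local Notation VC := 'cV[C]_(4 * n).
Local Notation toVC := (map_mx (real_complex R)).
Local Notation T := ('I_(2 * n) * 'I_2)%type.
Local Notation SH := (quat_mx R 1).
Local Notation tensor := (T -> T -> T -> C).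
Local Notation tE := (Etensor R n).
Local Notation tcomp := (EHtensor w f).
Local Notation realize := (realization w f).
Local Notation fr := (frame_vec f).
Local Notation fd := (fd f).
Implicit Types (p q r : T) (c : tensor) (W : tE -> Prop) (t : V -> V -> V).

Let w_skew := qsh_skew qsh.

Definition slice c (a b d : 'I_2) : tE := fun i j k => c (i, a) (j, b) (k, d).

Definition sym3H c := (forall i j k a b d, slice c a b d i j k = slice c b a d i j k)
  /\ (forall i j k a b d, slice c a b d i j k = slice c a d b i j k).

(** A symmetric tensor on H depends only on how many of its indices equal 1, so S^3 H has a basis of
    four vectors and four terms always suffice. Membership thus becomes a condition on each
    slice. *)
Lemma in_real_form_S3HP W t : real_submodule W ->
  in_real_form w W (@S3H R) f t <-> sym3H (tcomp t) /\ forall a b d, W (slice (tcomp t) a b d).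
Proof.
move=> W_sub; split=> [[N [F [s [WF Ss comp_t]]]]|[[sym1 sym2] Wsl]].
  have slE a b d i j k : slice (tcomp t) a b d i j k = \sum_r F r i j k * s r a b d.
    exact: comp_t.
  split; last first.
    move=> a b d; have := submodule_sum W_sub (index_enum 'I_N) (fun x => s x a b d) WF.
    move/submodule_ext; apply.
    by move=> i j k; rewrite slE.
  split=> i j k a b d; rewrite !slE; apply: eq_bigr => r _; have [s1 s2] := Ss r.
    by rewrite s1.
  by rewrite s2.
pose bit (x : bool) : 'I_2 := if x then 1 else 0.
(* The slice at the sorted triple of H indices with [r] ones represents all triples with that
   sum. *)
pose F (r : 'I_4) := slice (tcomp t) (bit (2 < r)%N) (bit (1 < r)%N) (bit (0 < r)%N).
pose s (r : 'I_4) : Htensor R := fun a b d => (a + b + d == r :> nat)%N%:R.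
exists 4, F, s; split=> [r|r|i j k a b d]; first exact: Wsl.
  by split=> a b d; rewrite /s; congr ((_ == _)%:R : C); lia.
have abd : (a + b + d < 4)%N by move: (ltn_ord a) (ltn_ord b) (ltn_ord d); lia.
rewrite (bigD1 (Ordinal abd)) //= [X in _ + X]big1 => [|x xabd]; last first.
  rewrite /s; case: eqP => [E|_]; last by rewrite mulr0.
  by case/eqP: xabd; apply: val_inj.
rewrite addr0 /s eqxx mulr1 /F /= -[LHS]/(slice (tcomp t) a b d i j k).
have ord2_val : ((nat_of_ord (0 : 'I_2) = 0%N) * (nat_of_ord (1 : 'I_2) = 1%N))%type.
  by [].
move: (slice _) sym1 sym2 => S sym1 sym2 {abd}.
elim/ord2P: a; elim/ord2P: b; elim/ord2P: d; rewrite !ord2_val //;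
  by [rewrite sym2 | rewrite sym1 | rewrite sym1 sym2 | rewrite sym2 sym1].
Qed.

Lemma in_real_form_HslotI W t (G : 'I_2 -> tE) : (forall a, W (G a)) ->
  (forall i j k a b d, tcomp t (i, a) (j, b) (k, d) = G a i j k * SH b d) ->
  in_real_form w W (@Hslot1 R) f t.
Proof.
move=> WG tG; exists 2, G, (fun x a b d => (a == x)%:R * SH b d); split=> //.
  by move=> x; exists (fun a => (a == x)%:R).
move=> i j k a b d; rewrite -[LHS]/(tcomp t (i, a) (j, b) (k, d)) tG.
rewrite (bigD1 a) //= eqxx mul1r big1 ?addr0 // => x xa.
by rewrite eq_sym (negbTE xa) mul0r mulr0.
Qed.

Lemma in_real_form_HslotE W t : real_submodule W ->
  in_real_form w W (@Hslot1 R) f t -> exists G : 'I_2 -> tE, (forall a, W (G a)) /\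
  (forall i j k a b d, tcomp t (i, a) (j, b) (k, d) = G a i j k * SH b d).
Proof.
move=> W_sub [N [F [s [WF Hs comp_t]]]].
have /choice[eta etaP] := Hs.
exists (fun a i j k => \sum_x F x i j k * eta x a); split.
  move=> a; exact: (submodule_sum W_sub (index_enum 'I_N) (fun x => eta x a) WF).
move=> i j k a b d; rewrite -[LHS]/(EHcomp w f t i j k a b d) comp_t mulr_suml.
by apply: eq_bigr => x _; rewrite etaP mulrA.
Qed.

Definition sgn3 (a b d : 'I_2) : C :=
  bar_sign R (k := 1) a * bar_sign R (k := 1) b * bar_sign R (k := 1) d.

Lemma slice_sigma c a b d i j k : slice (sigma c) a b d i j k = sgn3 a b d *
  sigmaE (slice c (bar_ord (k := 1) a) (bar_ord (k := 1) b) (bar_ord (k := 1) d)) i j k.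
Proof. by rewrite /slice /sigma /sgn /sgn3 /sigmaE /bar /=; ring. Qed.

Lemma slice_realize c a b d i j k : slice (tcomp (realize c)) a b d i j k =
  2^-1 * (slice c a b d i j k + sgn3 a b d *
  sigmaE (slice c (bar_ord (k := 1) a) (bar_ord (k := 1) b) (bar_ord (k := 1) d)) i j k).
Proof. by rewrite -slice_sigma; exact: (tcomp_realize f_adapted). Qed.

Lemma S3H_part_realize W c : real_submodule W ->
  (forall p q r, c p q r = - c q p r) -> sym3H c ->
  (forall a b d, W (slice c a b d)) -> S3H_part w W f (realize c).
Proof.
move=> W_sub c_skew [sym1 sym2] Wc; split.
  have [lr ll] := realize_bilin w f c.
  have c_skewE : c = (fun p q r => - c q p r).
    by apply/funext=> p; apply/funext=> q; apply/funext=> r; exact: c_skew.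
  by split=> // u v; rewrite {1}c_skewE realizeN realize_swap.
apply/(in_real_form_S3HP _ W_sub); split; last first.
  move=> a b d; have Ws := submodule_sigma W_sub
    (Wc (bar_ord (k := 1) a) (bar_ord (k := 1) b) (bar_ord (k := 1) d)).
  have := submoduleZ W_sub 2^-1 (submoduleD W_sub (Wc a b d) (submoduleZ W_sub (sgn3 a b d) Ws)).
  by move/submodule_ext; apply=> i j k; rewrite slice_realize.
split=> i j k a b d; rewrite !slice_realize /sgn3 /sigmaE.
  by rewrite sym1 (sym1 (bar_ord i)); ring.
by rewrite sym2 (sym2 (bar_ord i)); ring.
Qed.

Lemma adapted_j1_fr q : mapC j1 *m fr q = \sum_b q1 R b q.2 *: fr (q.1, b).
Proof. exact: (adapted_j1 f_adapted). Qed.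

Lemma adapted_j2_fr q : mapC j2 *m fr q = \sum_b SH b q.2 *: fr (q.1, b).
Proof. exact: (adapted_j2 f_adapted). Qed.

Lemma scalar_mapC_fr (j : 'M[R]_(4 * n)) (Q : 'M[C]_2) (h : VC -> C) q :
  (forall q, mapC j *m fr q = \sum_b Q b q.2 *: fr (q.1, b)) -> scalar h ->
  h (mapC j *m fr q) = \sum_b Q b q.2 * h (fr (q.1, b)).
Proof.
move=> jQ h_lin; rewrite jQ (lin_sum h_lin); apply: eq_bigr => b _.
exact: (scalZ h_lin).
Qed.

Lemma wC_mapC_skew (j : 'M[R]_(4 * n)) : j^T *m w = - (w *m j) ->
  forall u v, wC w (mapC j *m u) v = - wC w u (mapC j *m v).
Proof.
move=> jw u v; rewrite /wC trmx_mul -(mulmxA u^T).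
have -> : (mapC j)^T *m mapC w = - (mapC w *m mapC j).
  by rewrite /mapC map_trmx -!map_mxM -map_mxN jw.
by rewrite mulmxN mulNmx !mulmxA mxE.
Qed.

Lemma eq_mapC_fr (A B : 'M[R]_(4 * n)) :
  (forall q r, wC w (mapC A *m fr q) (fr r) = wC w (mapC B *m fr q) (fr r)) -> A = B.
Proof.
move=> AB; have ABu (u : VC) : mapC A *m u = mapC B *m u.
  rewrite [u](fr_expand f_adapted) !mulmx_sumr; apply: eq_bigr => q _.
  rewrite -!scalemxAr; congr (_ *: _).
  by apply: (eq_wC_fr f_adapted w_skew) => r; exact: AB.
apply: (@map_mx_inj _ _ (real_complex R)); apply/matrixP=> x y.
by have /matrixP/(_ x 0) := ABu (delta_mx y 0); rewrite -!colE !mxE.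
Qed.

Lemma mapC_mul (A B : 'M[R]_(4 * n)) : mapC (A *m B) = mapC A *m mapC B.
Proof. exact: map_mxM. Qed.

(* [B] acts on E alone; [K] is the matrix of the bilinear form g(B e, e') *)
Lemma S20E_endo_fr (B : 'M[R]_(4 * n)) (K : 'I_(2 * n) -> 'I_(2 * n) -> C) :
  (forall q r, wC w (mapC B *m fr q) (fr r) = K q.1 r.1 * SH q.2 r.2) ->
  (forall j k, K j k = K k j) -> \sum_j K j j = 0 -> S20E_endo j1 j2 j3 w B.
Proof.
move=> BK K_sym K_tr.
(* [j] acts on H alone, by a matrix skew for [S_H], while [BK] says that [B] acts on E alone; both
   products therefore have the same pairings with frame vectors. *)
have comm (j : 'M[R]_(4 * n)) (Q : 'M[C]_2) : j^T *m w = - (w *m j) ->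
    (forall q, mapC j *m fr q = \sum_b Q b q.2 *: fr (q.1, b)) ->
    (forall b d, \sum_b' Q b' b * SH b' d = - \sum_d' Q d' d * SH b d') -> B *m j = j *m B.
  move=> jw jQ QS; apply: eq_mapC_fr => q r; rewrite !mapC_mul -!mulmxA.
  have lin : scalar (fun X => wC w (mapC B *m X) (fr r)).
    by move=> a X X'; rewrite mulmxDr -scalemxAr wC_linl.
  apply: etrans (scalar_mapC_fr q jQ lin) _; apply: etrans (esym (wC_mapC_skew jw _ _)).
  apply: etrans (esym (congr1 -%R (scalar_mapC_fr r jQ (@wC_linr _ _ w _)))).
  rewrite (eq_bigr (fun b => K q.1 r.1 * (Q b q.2 * SH b r.2))) => [|b _]; last first.
    by rewrite BK /= mulrCA.
  rewrite -mulr_sumr QS mulrN mulr_sumr; congr (- _); apply: eq_bigr => d _.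
  by rewrite BK /= mulrCA.
have B1 : B *m j1 = j1 *m B.
  apply: (comm _ (q1 R) (qsh_w1 qsh) adapted_j1_fr) => b d; rewrite !big_ord2.
  by elim/ord2P: b; elim/ord2P: d; rewrite !quat_mx1E !q1E; ring.
have B2 : B *m j2 = j2 *m B.
  apply: (comm _ SH (qsh_w2 qsh) adapted_j2_fr) => b d; rewrite !big_ord2.
  by elim/ord2P: b; elim/ord2P: d; rewrite !quat_mx1E; ring.
split; last 1 first.
- move=> u v; apply: (@complexI R); rewrite rmorphN /= -!wC_toVC !map_mxM.
  pose h (U Z : VC) := wC w (mapC B *m U) Z; pose h' (U Z : VC) := - wC w (mapC B *m Z) U.
  rewrite -[LHS]/(h _ _) -[RHS]/(h' _ _).
  apply: (eq_form_fr f_adapted) => [W|U|W|U|[j b] [k d]]; rewrite /h /h'.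
  + by move=> a U U'; rewrite mulmxDr -scalemxAr wC_linl.
  + exact: wC_linr.
  + by move=> a U U'; rewrite wC_linr; ring.
  + by move=> a U' U''; rewrite mulmxDr -scalemxAr wC_linl; ring.
  + by rewrite !BK /= (K_sym k) (quat_mx1_skew _ d); ring.
- apply: (@complexI R); rewrite rmorph0 -trace_map_mx.
  rewrite -[map_mx _ B]/(mapC B) (mxtrace_fr f_adapted) big_pair_ord2.
  (* The factor 2 is the dimension of H, on which [B] is the identity. *)
  transitivity (2 * \sum_j K j j); last by rewrite K_tr mulr0.
  rewrite mulr_sumr; apply: eq_bigr => j _.
  rewrite fd0 fd1 (linN (@wC_linl _ _ w _)) !(wC_skew w_skew (frame_vec _ _)) !BK /=.
  by rewrite !quat_mx1E; ring.
split=> //; rewrite -(qsh_j12 qsh) mulmxA B1 -!mulmxA B2.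
by [].
Qed.

Definition endo_of t (u : V) : 'M[R]_(4 * n) := \matrix_(i, j) t u (delta_mx j 0) i 0.

Lemma endo_ofE t u v : bilin t -> endo_of t u *m v = t u v.
Proof.
move=> [tr tl].
rewrite {2}[v]col_sum_delta (lin_sum (tr u)); apply/matrixP=> i j; rewrite !mxE summxE ord1.
by apply: eq_bigr => k _; rewrite (linZ (tr u)) !mxE mulrC.
Qed.

Lemma endo_of_linear t : bilin t -> linear (endo_of t).
Proof. by move=> [tr tl] a u v; apply/matrixP=> i j; rewrite !mxE tl !mxE. Qed.

Lemma complexify_mx (A : V -> 'M[R]_(4 * n)) u (Z : VC) : linear A ->
  complexify (fun u v => A u *m v) (toVC u) Z = mapC (A u) *m Z.
Proof.
move=> A_lin; rewrite /complexify ReV_toVC ImV_toVC (lin0 A_lin) !mul0mx subr0 addr0.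
by rewrite [Z in RHS]toVC_re_im mulmxDr -scalemxAr !map_mxM.
Qed.

Lemma linear_mx_bilin (A : V -> 'M[R]_(4 * n)) : linear A -> bilin (fun u v => A u *m v).
Proof.
move=> A_lin; split=> u a v v'; first by rewrite mulmxDr scalemxAr.
by rewrite A_lin mulmxDl scalemxAl.
Qed.

(** The tensor is delta of G (x) w_H, with [G a] the coefficient at the index [a] of the first H
    slot. Real parts commute with exchanging two arguments, so delta may be taken after
    realization. *)
Lemma delta_part_realize W (G : 'I_2 -> tE) : real_submodule W ->
  (forall F, W F -> in_E_S20E F) -> (forall a, W (G a)) ->
  delta_part j1 j2 j3 w W f (realize (fun p q r =>
    G p.2 p.1 q.1 r.1 * SH q.2 r.2 - G q.2 q.1 p.1 r.1 * SH p.2 r.2)).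
Proof.
move=> W_sub WS20 WG; pose g p q r := G p.2 p.1 q.1 r.1 * SH q.2 r.2.
have g_bil : bilin (realize g) by exact: realize_bilin.
pose G' a i j k := 2^-1 * (G a i j k + bar_sign R (k := 1) a *
  sigmaE (G (bar_ord (k := 1) a)) i j k).
have WG' a : W (G' a).
  have := submoduleZ W_sub 2^-1 (submoduleD W_sub (WG a) (submoduleZ W_sub
    (bar_sign R (k := 1) a) (submodule_sigma W_sub (WG (bar_ord (k := 1) a))))).
  by move/submodule_ext; apply.
have gE i j k a b d : tcomp (realize g) (i, a) (j, b) (k, d) = G' a i j k * SH b d.
  rewrite (tcomp_realize f_adapted) /sigma /g /G' /sigmaE /sgn /bar /=.
  rewrite rmorphM /= -[RHS]mulrA mulrDl; congr (_ * (_ + _)).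
  (* [S_H] is preserved by the quaternionic structure of H, so the signs of [b] and [d] occur
     squared. *)
  have -> : conjc (SH (bar_ord (k := 1) b) (bar_ord (k := 1) d)) =
      bar_sign R (k := 1) b * bar_sign R (k := 1) d * SH b d.
    elim/ord2P: b; elim/ord2P: d; rewrite !bar_ord1E !quat_mx1E !bar_sign1E;
    by rewrite ?rmorphN ?rmorph1 ?rmorph0; ring.
  transitivity (bar_sign R (k := 1) b * bar_sign R (k := 1) b *
    (bar_sign R (k := 1) d * bar_sign R (k := 1) d) * (bar_sign R (k := 1) a *
    (bar_sign R i * bar_sign R j * bar_sign R k * conjc
    (G (bar_ord (k := 1) a) (bar_ord i) (bar_ord j) (bar_ord k))) * SH b d)).
    by ring.
  by rewrite !bar_sign_sqr !mul1r.
have A_lin := endo_of_linear g_bil.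
have AE : (fun u v => endo_of (realize g) u *m v) = realize g.
  by apply/funext=> u; apply/funext=> v; exact: endo_ofE.
exists (endo_of (realize g)); split=> //.
(* [K] is the bilinear form on E of the endomorphism attached to the real vector [u], found by
   expanding [u] in the frame. *)
- move=> u; pose K j k := \sum_p wC w (fd p) (toVC u) * G' p.2 p.1 j k.
  apply: (@S20E_endo_fr _ K) => [q r|j k|].
  + rewrite -complexify_mx // AE.
    have linl Z := @complexify_linl _ _ _ Z g_bil.
    rewrite [toVC u](fr_expand f_adapted) (lin_sum (linl _)).
    rewrite (lin_sum (@wC_linl _ _ w _)) mulr_suml; apply: eq_bigr => p _.
    rewrite (linZ (linl _)) (scalZ (@wC_linl _ _ w _)) -mulrA; congr (_ * _).
    by case: p q r => i a [j b] [k d]; exact: gE.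
  + by apply: eq_bigr => p _; have [-> _] := WS20 _ (WG' p.2).
  + rewrite exchange_big big1 // => p _; rewrite -mulr_sumr.
    by have [_ ->] := WS20 _ (WG' p.2); rewrite mulr0.
- by rewrite AE; exact: (in_real_form_HslotI WG' gE).
- move=> u v; apply: etrans _ (esym (f_equal2 (fun x y => x - y)
    (endo_ofE u v g_bil) (endo_ofE v u g_bil))).
  rewrite -(realize_swap w f g u v) -realizeN.
  exact: (realizeD w f g (fun p q r => - g q p r)).
Qed.
End Realization.

(** * The map pi_w *)

Section Bianchi.
Variables (R : realType) (n : nat) (j1 j2 j3 w : 'M[R]_(4 * n)) (f : EHframe R n).
Hypothesis f_adapted : adapted j1 j2 j3 w f.
Hypothesis qsh : quat_skewHermitian j1 j2 j3 w.
Local Notation C := R[i].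
Local Notation V := 'cV[R]_(4 * n).
Local Notation VC := 'cV[C]_(4 * n).
Local Notation toVC := (map_mx (real_complex R)).
Local Notation T := ('I_(2 * n) * 'I_2)%type.
Local Notation SH := (quat_mx R 1).
Local Notation tensor := (T -> T -> T -> C).
Local Notation tE := (Etensor R n).
Local Notation tcomp := (EHtensor w f).
Local Notation fr := (frame_vec f).
Implicit Types (p q r : T) (c : tensor) (t : V -> V -> V).

Let w_skew := qsh_skew qsh.

Definition cyc c p q r := c p q r + c q r p + c r p q.

Definition pi_wC t (U X Z : VC) : C := wC w (complexify t U X) Z
  + wC w (complexify t X Z) U + wC w (complexify t Z U) X.

Lemma pi_wC_cyc t U X Z : pi_wC t U X Z = pi_wC t X Z U.
Proof. by rewrite /pi_wC [RHS]addrC addrA. Qed.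

Lemma scalar_add (h h' : VC -> C) : scalar h -> scalar h' ->
  scalar (fun U => h U + h' U).
Proof. by move=> hl hl' a U U'; rewrite hl hl' mulrDr addrACA. Qed.

Lemma pi_wC_lin t : bilin t -> forall X Z, scalar (fun U => pi_wC t U X Z).
Proof.
move=> t_bil X Z; apply: scalar_add; last first.
  by move=> a U U'; rewrite (complexify_linr Z t_bil) wC_linl.
apply: scalar_add; last exact: wC_linr.
by move=> a U U'; rewrite (complexify_linl X t_bil) wC_linl.
Qed.

Lemma pi_wC_toVC t u v z : bilin t ->
  pi_wC t (toVC u) (toVC v) (toVC z) = (pi_w w t u v z)%:C%C.
Proof.
by move=> t_bil; rewrite /pi_wC !complexify_toVC // !wC_toVC /pi_w !rmorphD.
Qed.

Lemma scalar_toVC0 (h : VC -> C) : scalar h -> (forall u, h (toVC u) = 0) ->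
  forall U, h U = 0.
Proof.
by move=> h_lin h0 U; rewrite [U]toVC_re_im (linD h_lin) (scalZ h_lin) !h0 mulr0 addr0.
Qed.

Lemma scalar_fr0 (h : VC -> C) : scalar h -> (forall p, h (fr p) = 0) ->
  forall U, h U = 0.
Proof.
move=> h_lin h0 U; rewrite [U](fr_expand f_adapted) (lin_sum h_lin) big1 // => p _.
by rewrite (scalZ h_lin) h0 mulr0.
Qed.

(** A complex trilinear form vanishes if it does on real vectors, and also if it does on frame
    vectors. Cyclic symmetry brings each slot to the front, so linearity in the first one is
    enough. *)
Lemma pi_w0_cyc t : bilin t ->
  (forall x y z, pi_w w t x y z = 0) <-> (forall p q r, cyc (tcomp t) p q r = 0).
Proof.
move=> t_bil; have lin := pi_wC_lin t_bil.
split=> [t0 p q r|t0 x y z].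
  rewrite -[LHS]/(pi_wC t (fr p) (fr q) (fr r)).
  apply: (scalar_toVC0 (lin _ _)) => u; rewrite pi_wC_cyc.
  apply: (scalar_toVC0 (lin _ _)) => v; rewrite pi_wC_cyc.
  apply: (scalar_toVC0 (lin _ _)) => z; rewrite pi_wC_cyc.
  by rewrite pi_wC_toVC // t0.
apply: (@complexI R); rewrite -pi_wC_toVC //.
apply: (scalar_fr0 (lin _ _)) => p; rewrite pi_wC_cyc.
apply: (scalar_fr0 (lin _ _)) => q; rewrite pi_wC_cyc.
by apply: (scalar_fr0 (lin _ _)) => r; rewrite pi_wC_cyc; exact: t0.
Qed.

(** Symmetry in H lets the three terms share one order of H indices, leaving a cyclic sum over E
    alone. *)
Lemma cyc_S3H c i j k a b d : sym3H c ->
  cyc c (i, a) (j, b) (k, d) =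
  slice c a b d i j k + slice c a b d j k i + slice c a b d k i j.
Proof.
move=> [sym1 sym2]; rewrite /cyc -[c (i, a) _ _]/(slice c a b d i j k).
rewrite -[c (j, b) _ _]/(slice c b d a j k i) -[c (k, d) _ _]/(slice c d a b k i j).
by rewrite (sym2 j k i b d a) (sym1 j k i b a d) (sym1 k i j d a b) (sym2 k i j a d b).
Qed.

Definition tens (A : V -> 'M[R]_(4 * n)) : V -> V -> V := fun u v => A u *m v.

Lemma complexify_delta (A : V -> 'M[R]_(4 * n)) U X : complexify (delta A) U X =
  complexify (tens A) U X - complexify (tens A) X U.
Proof.
rewrite /complexify /delta /tens !(map_mxB, map_mxD) /=.
move: (Complex _ _) => I.
set x := toVC (_ *m _); set y := toVC (_ *m _); set z := toVC (_ *m _).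
set x' := toVC (_ *m _); set y' := toVC (_ *m _); set z' := toVC (_ *m _).
set t := toVC (_ *m _); set t' := toVC (_ *m _).
move: x y z t x' y' z' t' => x y z t x' y' z' t'.
by apply/matrixP=> i k; rewrite !mxE; ring.
Qed.

Lemma delta_bilin (A : V -> 'M[R]_(4 * n)) : linear A -> bilin (delta A).
Proof.
move=> A_lin; split=> u a v v'; rewrite /delta A_lin mulmxDr mulmxDl -scalemxAl -scalemxAr.
  by rewrite scalerBr opprD addrACA.
by rewrite scalerBr opprD addrACA.
Qed.

(** The components of delta(A) when those of [A] are G (x) w_H. *)
Definition Hslot_skew (G : 'I_2 -> tE) : tensor := fun p q r =>
  G p.2 p.1 q.1 r.1 * SH q.2 r.2 - G q.2 q.1 p.1 r.1 * SH p.2 r.2.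

Lemma tcomp_delta (A : V -> 'M[R]_(4 * n)) (G : 'I_2 -> tE) :
  (forall i j k a b d, tcomp (tens A) (i, a) (j, b) (k, d) = G a i j k * SH b d) ->
  forall p q r, tcomp (delta A) p q r = Hslot_skew G p q r.
Proof.
move=> GA [i a] [j b] [k d]; rewrite /EHtensor complexify_delta.
by rewrite (linB (@wC_linl _ _ w _)) /Hslot_skew -!GA.
Qed.

(** The six terms agree in pairs, because [G] is symmetric in its last two slots and [S_H] is skew;
    hence the factor 2. *)
Lemma cyc_alt (G : 'I_2 -> tE) i j k a b d : (forall a i j k, G a i j k = G a i k j) ->
  cyc (Hslot_skew G) (i, a) (j, b) (k, d) =
  2 * (G a i j k * SH b d + G b j k i * SH d a + G d k i j * SH a b).
Proof.
move=> G_sym; rewrite /cyc /Hslot_skew /= (G_sym b j i k) (G_sym d k j i) (G_sym a i k j).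
by rewrite (quat_mx1_skew R a d) (quat_mx1_skew R b a) (quat_mx1_skew R d b); ring.
Qed.

(** For totally symmetric [G] the H factor of the cyclic sum is alternating in three indices, and H
    has dimension 2. This is why pi_w kills X_5 and X_7. *)
Lemma cyc_alt_S3 (G : 'I_2 -> tE) p q r : (forall a i j k, G a i j k = G a i k j) ->
  (forall a i j k, G a i j k = G a j i k) -> cyc (Hslot_skew G) p q r = 0.
Proof.
move: p q r => [i a] [j b] [k d] sym1 sym2; rewrite cyc_alt //.
rewrite (sym2 b j k) (sym1 b k j) (sym2 b k i) (sym1 b i k).
rewrite (sym2 d k i) (sym1 d i k).
by elim/ord2P: a; elim/ord2P: b; elim/ord2P: d; rewrite !quat_mx1E; ring.
Qed.

Lemma X1_pi_w t : X1 w f t -> forall x y z, pi_w w t x y z = 0.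
Proof.
move=> [[tr tl _] /(in_real_form_S3HP w f t (@K_skew_sub R n))[sym slK]].
apply/(pi_w0_cyc (conj tr tl)) => -[i a] [j b] [k d].
by rewrite cyc_S3H //; have [_ -> _] := slK a b d.
Qed.

Lemma X6_pi_w t : X6 w f t -> forall x y z, pi_w w t x y z = 0.
Proof.
move=> [[tr tl _] /(in_real_form_S3HP w f t (@E_skew_sub R n))[sym slE]].
apply/(pi_w0_cyc (conj tr tl)) => -[i a] [j b] [k d].
rewrite cyc_S3H //; have [th thE] := slE a b d; rewrite !thE.
by rewrite (eq_sym k i) (eq_sym k j) (eq_sym j i); ring.
Qed.

Lemma X5_pi_w t : X5 j1 j2 j3 w f t -> forall x y z, pi_w w t x y z = 0.
Proof.
move=> [A [A_lin _ A_form tA] x y z].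
have [G [GS3 GE]] := in_real_form_HslotE (@S30E_sub R n) A_form.
have -> : t = delta A by apply/funext=> u; apply/funext=> v; exact: tA.
move: x y z; apply/(pi_w0_cyc (delta_bilin A_lin)) => p q r.
rewrite /cyc !(tcomp_delta GE) -[LHS]/(cyc (Hslot_skew G) p q r).
by apply: cyc_alt_S3 => a i j k; have [[s1 s2] s3] := GS3 a.
Qed.

Lemma X7_pi_w t : X7 j1 j2 j3 w f t -> forall x y z, pi_w w t x y z = 0.
Proof. by case. Qed.

Lemma complexifyD t t' U X :
  complexify (fun u v => t u v + t' u v) U X = complexify t U X + complexify t' U X.
Proof.
rewrite /complexify !(map_mxB, map_mxD) /=; move: (Complex _ _) => I.
set x := toVC _; set y := toVC _; set z := toVC _; set s := toVC _.
set x' := toVC _; set y' := toVC _; set z' := toVC _; set s' := toVC _.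
move: x y z s x' y' z' s' => x y z s x' y' z' s'.
by apply/matrixP=> i k; rewrite !mxE; ring.
Qed.

Lemma tcompD t t' p q r :
  tcomp (fun u v => t u v + t' u v) p q r = tcomp t p q r + tcomp t' p q r.
Proof. by rewrite /EHtensor complexifyD (linD (@wC_linl _ _ w _)). Qed.

Lemma bilinD t t' : bilin t -> bilin t' -> bilin (fun u v => t u v + t' u v).
Proof.
move=> [tr tl] [tr' tl']; split=> u a v v'; rewrite ?tr ?tl ?tr' ?tl' scalerDr addrACA //.
Qed.

Lemma eq0_tcomp t : bilin t -> (forall p q r, tcomp t p q r = 0) ->
  forall u v, t u v = 0.
Proof.
move=> t_bil t0; apply: (eq_tcomp f_adapted w_skew t_bil (t' := fun _ _ => 0)).
  by split=> u a v v'; rewrite scaler0 addr0.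
move=> p q r; rewrite t0 /EHtensor /complexify subr0 addr0 map_mx0 scaler0 addr0.
by rewrite (lin0 (@wC_linl _ _ w _)).
Qed.

Hypothesis n_gt0 : (0 < n)%N.

Lemma n_neq0 : (n%:R : C) != 0.
Proof. by rewrite pnatr_eq0 -lt0n. Qed.

(** The factor by which contraction of the first two slots of [E_sym_of th] multiplies [th]: its
    three terms contribute 2n, 1 and -1/n. *)
Definition E_sym_trace : C := 2 * n%:R + 1 - n%:R^-1.

Lemma E_sym_trace_neq0 : E_sym_trace != 0.
Proof.
suff : n%:R * E_sym_trace != 0 by apply: contra => /eqP ->; rewrite mulr0.
(* This number is (2n - 1)(n + 1); the natural subtraction is exact because n > 0. *)
have -> : n%:R * E_sym_trace = (2 * n * n + n - 1)%N%:R.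
  rewrite natrB ?natrD ?natrM; last by lia.
  by rewrite /E_sym_trace !(mulrDr, mulrN) mulfV ?n_neq0 //; ring.
by rewrite pnatr_eq0; lia.
Qed.

Definition E_sym_of (th : 'I_(2 * n) -> C) : tE := fun i j k =>
  (i == j)%:R * th k + (i == k)%:R * th j - n%:R^-1 * ((j == k)%:R * th i).

Lemma E_sym_of_trace th k : \sum_i E_sym_of th i i k = E_sym_trace * th k.
Proof.
rewrite sumrB big_split /= sum_delta_diag -mulr_sumr.
by rewrite !sum_deltar /E_sym_trace; ring.
Qed.

(* Only a totally symmetric tensor solves [cyc (Hslot_skew G) = 0]; it is then
   trace-free, so its E part vanishes, and a cyclic one is zero. *)
Lemma K_E_sym_eq0 (F3 F4 : tE) : K_sym F3 -> E_sym F4 ->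
  (forall i j k, F3 i j k + F4 i j k = F3 j k i + F4 j k i) ->
  (forall i j k, F3 i j k = 0) /\ (forall i j k, F4 i j k = 0).
Proof.
move=> [[F3_sym F3_tr] F3_cyc F3_tr'] F4E F_cyc.
have [F4_sym F4_tr] := E_sym_S20E n_gt0 F4E; have [th thE] := F4E.
have th0 k : th k = 0.
  apply: (mulfI E_sym_trace_neq0); rewrite mulr0 -E_sym_of_trace.
  transitivity (\sum_i (F3 k i i + F4 k i i)); last first.
    by rewrite big_split /= F3_tr F4_tr addr0.
  transitivity (\sum_i (F3 i i k + F4 i i k)).
    by rewrite [RHS]big_split /= F3_tr' add0r; apply: eq_bigr => i _; rewrite thE.
  by apply: eq_bigr => i _; rewrite (F_cyc k).
have F40 i j k : F4 i j k = 0 by rewrite thE !th0 !mulr0 addr0 subr0.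
split=> // i j k.
have three_neq0 : (3 : C) != 0 by rewrite pnatr_eq0.
apply: (mulfI three_neq0); rewrite mulr0 -(F3_cyc i j k).
have := F_cyc i j k; have := F_cyc j k i; rewrite !F40 !addr0 => <- <-.
ring.
Qed.

Lemma pi_w_inj t2 t3 t4 : X2 w f t2 -> X3 j1 j2 j3 w f t3 -> X4 j1 j2 j3 w f t4 ->
  (forall x y z, pi_w w t2 x y z + pi_w w t3 x y z + pi_w w t4 x y z = 0) ->
  [/\ forall u v, t2 u v = 0, forall u v, t3 u v = 0 & forall u v, t4 u v = 0].
Proof.
move=> [[tr tl _] /(in_real_form_S3HP w f t2 (@Lambda3E_sub R n))[[sym1 sym2] sl2]].
move=> [A3 [A3_lin _ A3_form]]; move=> t3E.
have {t3E} -> : t3 = delta A3 by apply/funext=> u; apply/funext=> v; exact: t3E.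
move=> [A4 [A4_lin _ A4_form]]; move=> t4E.
have {t4E} -> : t4 = delta A4 by apply/funext=> u; apply/funext=> v; exact: t4E.
have [G3 [G3K G3E]] := in_real_form_HslotE (@K_sym_sub R n) A3_form.
have [G4 [G4K G4E]] := in_real_form_HslotE (@E_sym_sub R n) A4_form.
move=> pi0; have b3 := delta_bilin A3_lin; have b4 := delta_bilin A4_lin.
pose t := fun u v => (fun u v => t2 u v + delta A3 u v) u v + delta A4 u v.
have t_bil : bilin t by apply: bilinD => //; apply: bilinD.
have tE : forall p q r, cyc (tcomp t) p q r = 0.
  apply/(pi_w0_cyc t_bil) => x y z; rewrite -(pi0 x y z) /pi_w /t.
  by rewrite !(linD (@mxform_linl _ _ w _)); ring.
have tcE p q r : tcomp t p q r = tcomp t2 p q r + Hslot_skew G3 p q r + Hslot_skew G4 p q r.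
  rewrite -(tcomp_delta G4E) -(tcomp_delta G3E).
  transitivity (tcomp (fun u v => t2 u v + delta A3 u v) p q r + tcomp (delta A4) p q r).
    exact: tcompD.
  by congr (_ + _); exact: tcompD.
pose G a i j k := G3 a i j k + G4 a i j k.
have G_sym a i j k : G a i j k = G a i k j.
  have [[s3 _] _ _] := G3K a; have [s4 _] := E_sym_S20E n_gt0 (G4K a).
  by rewrite /G s3 s4.
pose c2 := slice (tcomp t2).
(* A totally skew tensor is invariant under cyclic permutations, hence the 3; the rest is [cyc_alt]
   for the sum of the X_3 and X_4 parts. *)
have key i j k a b d : 3 * c2 a b d i j k +
  2 * (G a i j k * SH b d + G b j k i * SH d a + G d k i j * SH a b) = 0.
  rewrite -(tE (i, a) (j, b) (k, d)) -cyc_alt // /cyc !tcE.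
  have := @cyc_S3H (tcomp t2) i j k a b d (conj sym1 sym2).
  have [s12 s23] := sl2 a b d.
  rewrite (s23 j k i) (s12 j i k) opprK (s12 k i j) (s23 i k j) opprK /cyc => E.
  have -> : 3 * c2 a b d i j k = tcomp t2 (i, a) (j, b) (k, d)
    + tcomp t2 (j, b) (k, d) (i, a) + tcomp t2 (k, d) (i, a) (j, b).
    by rewrite E /c2; ring.
  by rewrite /Hslot_skew /G; ring.
have c20 a b d i j k : c2 a b d i j k = 0.
  (* 18 = 6 * 3: [key] is summed over the six orders of the H indices, and the terms with [S_H]
     cancel by skewness. *)
  have eighteen_neq0 : (18 : C) != 0 by rewrite pnatr_eq0.
  apply: (mulfI eighteen_neq0); rewrite mulr0.
  pose K a b d := 3 * c2 a b d i j k +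
    2 * (G a i j k * SH b d + G b j k i * SH d a + G d k i j * SH a b).
  have K0 a' b' d' : K a' b' d' = 0 by exact: key.
  transitivity (K a b d + K a d b + K b a d + K b d a + K d a b + K d b a).
    rewrite /K (quat_mx1_skew R d b) (quat_mx1_skew R b a) (quat_mx1_skew R a d) /c2.
    rewrite (sym2 i j k a d b) (sym1 i j k b a d) (sym2 i j k b d a) (sym1 i j k b a d).
    rewrite (sym1 i j k d a b) (sym2 i j k a d b) (sym1 i j k d b a).
    by rewrite (sym2 i j k b d a) (sym1 i j k b a d); ring.
  by rewrite !K0 !addr0.
have sol (x y e : C) : e = 0 -> e = 2 * (x - y) \/ e = 2 * (y - x) -> x = y.
  move=> ->; have two_neq0 : (2 : C) != 0 by rewrite pnatr_eq0.
  case=> /esym/eqP; rewrite mulf_eq0 (negbTE two_neq0) subr_eq0 => /eqP //.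
(* When two of the three H indices coincide, one [S_H] factor vanishes and the other two are
   opposite, so [key] compares [G] with its cyclic shift. *)
have G_cyc a i j k : G a i j k = G a j k i.
  elim/ord2P: a.
    have := key j k i 0 1 0; rewrite c20 !quat_mx1E => /(sol (G 0 i j k) (G 0 j k i)).
    by apply; right; ring.
  have := key i j k 1 1 0; rewrite c20 !quat_mx1E => /(sol (G 1 i j k) (G 1 j k i)).
  by apply; left; ring.
have GK a := K_E_sym_eq0 (G3K a) (G4K a) (G_cyc a).
split; last first.
- apply: eq0_tcomp => // p q r; rewrite (tcomp_delta G4E) /Hslot_skew.
  by rewrite (GK _).2 (GK _).2 !mul0r subrr.
- apply: eq0_tcomp => // p q r; rewrite (tcomp_delta G3E) /Hslot_skew.
  by rewrite (GK _).1 (GK _).1 !mul0r subrr.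
- by apply: eq0_tcomp => // -[i a] [j b] [k d]; exact: c20.
Qed.
End Bianchi.

(** * Decomposition of the torsion *)

Section SkewDecomposition.
Variables (R : realType) (n : nat) (j1 j2 j3 w : 'M[R]_(4 * n)) (f : EHframe R n).
Hypothesis f_adapted : adapted j1 j2 j3 w f.
Hypothesis qsh : quat_skewHermitian j1 j2 j3 w.
Local Notation C := R[i].
Local Notation V := 'cV[R]_(4 * n).
Local Notation T := ('I_(2 * n) * 'I_2)%type.
Local Notation tensor := (T -> T -> T -> C).
Local Notation tE := (Etensor R n).
Local Notation tcomp := (EHtensor w f).
Local Notation realize := (realization w f).
Local Notation fr := (frame_vec f).
Implicit Types (p q r : T) (c : tensor) (t : V -> V -> V).

Let w_skew := qsh_skew qsh.

Hypothesis n_gt0 : (0 < n)%N.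

Definition map_slices (P : tE -> tE) c : tensor := fun p q r =>
  P (slice c p.2 q.2 r.2) p.1 q.1 r.1.

(** For tensors already skew in the first two slots, total antisymmetrisation is the cyclic mean. *)
Definition Lambda3_proj (F : tE) : tE := fun i j k =>
  3^-1 * (F i j k + F j k i + F k i j).
(** Contracting slots 1 and 3 of the E tensor defined by th gives (2n - 1) th, whence the
    normalisation. *)
Definition E_skew_proj (F : tE) : tE := fun i j k =>
  (2 * n%:R - 1)^-1 * ((i == k)%:R * (\sum_l F l j l) - (j == k)%:R * (\sum_l F l i l)).
Definition K_skew_proj (F : tE) : tE := fun i j k =>
  F i j k - Lambda3_proj F i j k - E_skew_proj F i j k.

Lemma three_neq0 : (3 : C) != 0. Proof. by rewrite pnatr_eq0. Qed.

Section SkewProjections.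
Variables (F : tE) (F_skew : forall i j k, F i j k = - F j i k).

Lemma Lambda3_projP : Lambda3E (Lambda3_proj F).
Proof.
split=> i j k; rewrite /Lambda3_proj (F_skew j i) (F_skew i k) (F_skew k j); ring.
Qed.

Lemma E_skew_projP : E_skew (E_skew_proj F).
Proof.
exists (fun j => (2 * n%:R - 1)^-1 * \sum_l F l j l) => i j k.
by rewrite /E_skew_proj; ring.
Qed.

Lemma E_skew_trace_neq0 : (2 * n%:R - 1 : C) != 0.
Proof.
rewrite (_ : 2 * n%:R - 1 = (2 * n - 1)%N%:R) ?pnatr_eq0; first by lia.
by rewrite natrB ?natrM //; lia.
Qed.

Lemma K_skew_projP : K_skew (K_skew_proj F).
Proof.
have [L1 L2] := Lambda3_projP.
split=> [i j k|i j k|j].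
- by rewrite /K_skew_proj L1 F_skew /E_skew_proj; ring.
- rewrite /K_skew_proj /E_skew_proj (eq_sym j i) (eq_sym k i) (eq_sym k j).
  rewrite /Lambda3_proj; apply: (mulfI three_neq0); rewrite mulr0.
  by field; rewrite E_skew_trace_neq0.
- have L0 : \sum_i Lambda3_proj F i j i = 0.
    rewrite big1 // => i _; have : Lambda3_proj F i j i = - Lambda3_proj F i j i.
      by rewrite L1 L2 L1 L2 L1 !opprK.
    move/eqP; rewrite -addr_eq0 -mulr2n mulrn_eq0 /= => /eqP //.
  rewrite !sumrB L0 subr0 -mulr_sumr sumrB sum_delta_diag.
  rewrite sum_delta; move: (\sum_(i < 2 * n) F i j i) => s.
  by field; rewrite E_skew_trace_neq0.
Qed.

End SkewProjections.

Lemma map_slices_skew (P : tE -> tE) c :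
  (forall F, (forall i j k, F i j k = - F j i k) -> forall i j k, P F i j k = - P F j i k) ->
  (forall p q r, c p q r = - c q p r) -> sym3H c ->
  forall p q r, map_slices P c p q r = - map_slices P c q p r.
Proof.
move=> P_skew c_skew [sym1 sym2] [i a] [j b] [k d]; rewrite /map_slices /=.
have slE a' b' d' : slice c a' b' d' = slice c b' a' d'.
  by apply/funext=> i'; apply/funext=> j'; apply/funext=> k'; exact: sym1.
rewrite P_skew ?(slE a) // => i' j' k'.
by rewrite /slice c_skew; congr (- _); exact: (sym1 j' i' k' _ _ _).
Qed.

Lemma map_slices_sym (P : tE -> tE) c : sym3H c -> sym3H (map_slices P c).
Proof.
move=> [sym1 sym2]; split=> i j k a b d; rewrite /slice /map_slices /=; congr (P _ _ _ _);
  by apply/funext=> i'; apply/funext=> j'; apply/funext=> k'.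
Qed.

Lemma S3H_decomposition t : two_form_valued t -> sym3H (tcomp t) ->
  exists t1 t2 t6, [/\ X1 w f t1, X2 w f t2, X6 w f t6
    & forall u v, t u v = t1 u v + t2 u v + t6 u v].
Proof.
move=> [tr tl t_skew] t_sym.
have t_bil : bilin t by [].
have c_skew p q r : tcomp t p q r = - tcomp t q p r.
  apply: etrans _ (linN (@wC_linl _ _ w (fr r)) (complexify t (fr q) (fr p))).
  congr (wC w _ (fr r)).
  rewrite !complexifyE // exchange_big -sumrN; apply: eq_bigr => i _.
  rewrite -sumrN; apply: eq_bigr => j _.
  by rewrite t_skew map_mxN scalerN [X in X *: _]mulrC.
(* Skewness exchanges E and H indices together; symmetry in H leaves skewness in E alone, so each
   slice lies in E (x) Lambda^2 E. *)
have slice_skew a b d i j k : slice (tcomp t) a b d i j k = - slice (tcomp t) a b d j i k.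
  have [sym1 _] := t_sym.
  by rewrite {1}/slice c_skew -[tcomp t _ _ _]/(slice (tcomp t) b a d j i k) sym1.
pose part P := realize (map_slices P (tcomp t)).
have partP (W : set tE) P : real_submodule W ->
    (forall F, (forall i j k, F i j k = - F j i k) -> W (P F)) ->
    (forall F, W F -> forall i j k, F i j k = - F j i k) ->
    S3H_part w W f (part P).
  move=> W_sub WP W_skew; apply: (S3H_part_realize f_adapted W_sub).
  - apply: map_slices_skew => // F F_skew; exact: W_skew (WP F F_skew).
  - exact: map_slices_sym.
  - by move=> a b d; exact: (WP _ (slice_skew a b d)).
exists (part K_skew_proj), (part Lambda3_proj), (part E_skew_proj); split.
- apply: partP; [exact: K_skew_sub|exact: K_skew_projP|by move=> F []].
- apply: partP; [exact: Lambda3E_sub|exact: Lambda3_projP|by move=> F []].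
- apply: partP; [exact: E_skew_sub|by move=> F _; exact: E_skew_projP|].
  by move=> F [th thE] i j k; rewrite !thE; ring.
- move=> u v; rewrite -[LHS](tcomp_realK f_adapted w_skew u v t_bil).
  rewrite -!realizeD; congr (realization _ _ _ u v).
  apply/funext=> -[i a]; apply/funext=> -[j b]; apply/funext=> -[k d].
  by rewrite /map_slices /K_skew_proj /slice /=; ring.
Qed.
End SkewDecomposition.

(** * The image of delta: components in X_3, X_4, X_5 and X_7 *)

Section SymDecomposition.
Variables (R : realType) (n : nat) (j1 j2 j3 w : 'M[R]_(4 * n)) (f : EHframe R n).
Hypothesis f_adapted : adapted j1 j2 j3 w f.
Hypothesis qsh : quat_skewHermitian j1 j2 j3 w.
Local Notation C := R[i].
Local Notation V := 'cV[R]_(4 * n).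
Local Notation VC := 'cV[C]_(4 * n).
Local Notation toVC := (map_mx (real_complex R)).
Local Notation T := ('I_(2 * n) * 'I_2)%type.
Local Notation SH := (quat_mx R 1).
Local Notation tensor := (T -> T -> T -> C).
Local Notation tE := (Etensor R n).
Local Notation tcomp := (EHtensor w f).
Local Notation alt := (@Hslot_skew R n).
Local Notation realize := (realization w f).
Local Notation fr := (frame_vec f).
Local Notation fd := (fd f).
Implicit Types (p q r : T) (c : tensor) (t : V -> V -> V).

Let w_skew := qsh_skew qsh.

Hypothesis n_gt0 : (0 < n)%N.

Lemma iC_neq0 : Complex (0 : R) 1 != 0.
Proof. by apply/eqP => -[] /eqP; rewrite oner_eq0. Qed.

(** Up to a factor, [S_H] is the only bilinear form on H invariant under sp(1): [q1] is diagonal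
    with entries i and -i and kills the diagonal of [m], then [q2] makes [m] skew. *)
Lemma H_skew_invariant (m : 'I_2 -> 'I_2 -> C) :
  (forall b d, \sum_b' q1 R b' b * m b' d = - \sum_d' q1 R d' d * m b d') ->
  (forall b d, \sum_b' SH b' b * m b' d = - \sum_d' SH d' d * m b d') ->
  forall b d, m b d = m 1 0 * SH b d.
Proof.
move=> e1 e2; have i_neq0 := iC_neq0.
have two_neq0 : (2 * Complex 0 1 : C) != 0 by rewrite mulf_neq0 // pnatr_eq0.
have m00 : m 0 0 = 0.
  apply: (mulfI two_neq0); have := e1 0 0; rewrite !big_ord2 !q1E.
  by move: (Complex 0 1) => I /eqP; rewrite -subr_eq0 => /eqP E; rewrite mulr0 -E; ring.
have m11 : m 1 1 = 0.
  apply: (mulfI two_neq0); have := e1 1 1; rewrite !big_ord2 !q1E.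
  move: (Complex 0 1) => I /eqP; rewrite -subr_eq0 => /eqP E; rewrite mulr0 -[RHS]oppr0 -E; ring.
have m01 : m 0 1 = - m 1 0.
  have := e2 0 0; rewrite !big_ord2 !quat_mx1E !mul0r !mul1r !add0r => ->.
  by rewrite opprK.
by elim/ord2P => //; elim/ord2P; rewrite !quat_mx1E ?m00 ?m11 ?m01 ?mulr0 ?mulr1 ?mulrN1.
Qed.

Definition S3_proj (F : tE) : tE := fun i j k => 3^-1 * (F i j k + F j k i + F k i j).
Definition E_sym_proj (F : tE) : tE :=
  E_sym_of (fun k => (E_sym_trace R n)^-1 * \sum_i F i i k).
(** The E part is removed before symmetrising, since otherwise its trace would survive and the
    result would lie in S^3 E only. *)
Definition S30_proj (F : tE) : tE := S3_proj (fun i j k => F i j k - E_sym_proj F i j k).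
Definition K_sym_proj (F : tE) : tE := fun i j k =>
  F i j k - E_sym_proj F i j k - S30_proj F i j k.

Lemma E_sym_ofP th : E_sym (@E_sym_of R n th).
Proof. by exists th. Qed.

Lemma E_sym_ofB (h g : 'I_(2 * n) -> C) x i j k :
  E_sym_of (fun l => h l - x * g l) i j k = E_sym_of h i j k - x * E_sym_of g i j k.
Proof. by rewrite /E_sym_of; ring. Qed.

Lemma S3_projP (F : tE) : in_E_S20E F -> (forall k, \sum_i F i i k = 0) -> S30E (S3_proj F).
Proof.
move=> [F_sym F_tr] F_tr'; split; first split=> [i j k|i]; rewrite /S3_proj.
- by rewrite (F_sym i k j) (F_sym k j i) (F_sym j i k); ring.
- rewrite -mulr_sumr !big_split /= F_tr F_tr' !add0r.
  rewrite (eq_bigr (fun j => F j j i)) ?F_tr' ?mulr0 // => j _; exact: F_sym.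
- move=> i j k; rewrite /S3_proj (F_sym i k j) (F_sym k j i) (F_sym j k i); ring.
Qed.

Section SymProjections.
Variables (F : tE) (F_S20 : in_E_S20E F).
Let F' : tE := fun i j k => F i j k - E_sym_proj F i j k.

Let F'_S20 : in_E_S20E F'.
Proof.
apply: (submoduleB (@in_E_S20E_sub R n)) => //.
by apply: E_sym_S20E => //; exact: E_sym_ofP.
Qed.

Let F'_tr k : \sum_i F' i i k = 0.
Proof.
rewrite sumrB E_sym_of_trace mulrA mulfV ?mul1r ?subrr //.
exact: E_sym_trace_neq0.
Qed.

Lemma S30_projP : S30E (S30_proj F).
Proof. exact: S3_projP. Qed.

Lemma K_sym_projP : K_sym (K_sym_proj F).
Proof.
have [S_S20 S_sym] := S30_projP; have [F'_sym _] := F'_S20.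
split=> [|i j k|k].
- exact: (submoduleB (@in_E_S20E_sub R n) F'_S20 S_S20).
- rewrite /K_sym_proj /S30_proj /S3_proj -!/(F' _ _ _) -/F'.
  by apply: (mulfI (three_neq0 R)); field.
- rewrite sumrB F'_tr sub0r; apply/eqP; rewrite oppr_eq0; apply/eqP.
  rewrite (eq_bigr (fun i => S30_proj F k i i)); first by case: S_S20.
  by move=> i _; rewrite (S_S20.1 i i k) S_sym.
Qed.
End SymProjections.

(* g(B_X e, e') for B_X = th(X) Id *)
Definition line_part (th : T -> C) (a : 'I_2) : tE := fun i j k => (j == k)%:R * th (i, a).

Definition form_of (th : T -> C) (u : V) : R :=
  complex.Re (\sum_p wC w (fd p) (toVC u) * th p).

Lemma form_of_scalar th : scalar (form_of th).
Proof.
move=> a u v; rewrite /form_of.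
have -> : \sum_p wC w (fd p) (toVC (a *: u + v)) * th p =
    a%:C%C * (\sum_p wC w (fd p) (toVC u) * th p) + \sum_p wC w (fd p) (toVC v) * th p.
  rewrite mulr_sumr -big_split; apply: eq_bigr => p _ /=.
  by rewrite map_mxD map_mxZ wC_linr; ring.
by move: (\sum_p _) (\sum_p _) => [x y] [x' y'] /=; rewrite mul0r subr0.
Qed.

(** The matrix [(j == k)%:R * S_H] consists of the components of [w] itself, that is, of the
    identity endomorphism. *)
Lemma realize_line_part th u v : realize (fun p q r => line_part th p.2 p.1 q.1 r.1
   * SH q.2 r.2) u v = form_of th u *: v.
Proof.
rewrite /realization /of_comp /line_part.
have -> : \sum_p \sum_q \sum_r (wC w (fd p) (toVC u) * wC w (fd q) (toVC v) *
    ((q.1 == r.1)%:R * th (p.1, p.2) * SH q.2 r.2)) *: fd r =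
    (\sum_p wC w (fd p) (toVC u) * th p) *: toVC v.
  rewrite scaler_suml; apply: eq_bigr => -[i a] _ /=.
  rewrite {2}[toVC v](fr_expand f_adapted) scaler_sumr; apply: eq_bigr => q _.
  rewrite scalerA {1}[fr q](fd_expand f_adapted w_skew) scaler_sumr.
  apply: eq_bigr => r _; rewrite scalerA (wC_fr f_adapted); congr (_ *: _); ring.
rewrite /form_of; move: (\sum_p _) => [x y].
by apply/matrixP=> i j; rewrite !mxE /= mulr0 subr0.
Qed.

Lemma realize_alt_line_part th u v :
  realize (alt (line_part th)) u v = delta (fun y => (form_of th y)%:M) u v.
Proof.
apply: etrans _ (esym (f_equal2 (fun x y => x - y) (mul_scalar_mx (form_of th u) v)
  (mul_scalar_mx (form_of th v) u))).
rewrite -(realize_line_part th u v) -(realize_line_part th v u).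
rewrite -(realize_swap w f (fun p q r => line_part th p.2 p.1 q.1 r.1 * SH q.2 r.2) u v).
by rewrite -realizeN -realizeD.
Qed.

Lemma alt_realizeD (G G' : 'I_2 -> tE) u v :
  realize (alt (fun a i j k => G a i j k + G' a i j k)) u v =
  realize (alt G) u v + realize (alt G') u v.
Proof.
rewrite -realizeD; congr (realization _ _ _ u v).
by apply/funext=> p; apply/funext=> q; apply/funext=> r; rewrite /Hslot_skew; ring.
Qed.

Lemma cyc_realize0 c : (forall p q r, cyc c p q r = 0) ->
  forall p q r, cyc (tcomp (realize c)) p q r = 0.
Proof.
move=> c0 p q r; rewrite /cyc !(tcomp_realize f_adapted).
transitivity (2^-1 * (cyc c p q r + (sgn R p * sgn R q * sgn R r *
  conjc (cyc c (bar p) (bar q) (bar r))))); last first.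
  by rewrite !c0 conjc0 mulr0 addr0 mulr0.
by rewrite /cyc /sigma !rmorphD /=; ring.
Qed.

(* the multiple of E_sym_of th to be added to line_part th to be killed by pi_w *)
Definition X7_scale : C := n%:R / (n%:R + 1).

(** [X7_scale] is the solution s of 1 - s/n = s. With it the three Kronecker terms get equal
    coefficients, the tensor becomes totally symmetric, and [cyc_alt_S3] applies. *)
Lemma X7_realize th : X7 j1 j2 j3 w f (realize (alt (fun a i j k =>
  X7_scale * E_sym_of (fun l => th (l, a)) i j k + line_part th a i j k))).
Proof.
set G := (fun a i j k => _).
split.
  apply/(pi_w0_cyc f_adapted (realize_bilin _ _ _)); apply: cyc_realize0 => p q r.
  have n0 : (n%:R : C) != 0 by rewrite pnatr_eq0 -lt0n.
  have n1 : (n%:R + 1 : C) != 0 by rewrite natr1 pnatr_eq0.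
  apply: cyc_alt_S3 => a i j k; rewrite /G /E_sym_of /line_part /X7_scale.
    by rewrite (eq_sym k j); field; rewrite n0 n1.
  by rewrite (eq_sym j i); field; rewrite n0 n1.
exists (realize (alt (fun a i j k => X7_scale * E_sym_of (fun l => th (l, a)) i j k))),
  (form_of th); split; [|exact: form_of_scalar|].
  apply: (delta_part_realize f_adapted qsh (G := fun a i j k => _) (@E_sym_sub R n)).
    by move=> F; exact: E_sym_S20E.
  by move=> a; exact: (submoduleZ (@E_sym_sub R n) _ (E_sym_ofP _)).
by move=> u v; rewrite -realize_alt_line_part -alt_realizeD.
Qed.

Lemma ReV_mapC (j : 'M[R]_(4 * n)) (U : VC) :
  map_mx (@complex.Re R) (mapC j *m U) = j *m map_mx (@complex.Re R) U.
Proof.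
apply/matrixP=> x y; rewrite !mxE (big_morph (@complex.Re R) (id1 := 0) (op1 := +%R)) //.
  by apply: eq_bigr => k _; rewrite !mxE; case: (U k y) => a b /=; rewrite mul0r subr0.
by move=> [a b] [a' b'].
Qed.

Lemma ImV_mapC (j : 'M[R]_(4 * n)) (U : VC) :
  map_mx (@complex.Im R) (mapC j *m U) = j *m map_mx (@complex.Im R) U.
Proof.
apply/matrixP=> x y; rewrite !mxE (big_morph (@complex.Im R) (id1 := 0) (op1 := +%R)) //.
  by apply: eq_bigr => k _; rewrite !mxE; case: (U k y) => a b /=; rewrite mul0r addr0.
by move=> [a b] [a' b'].
Qed.

(** Used with e = 1 for the difference of the connections, which commutes with J, and with e = -1
    for Nijenhuis tensors, which anticommute. *)
Lemma complexify_equivr (e : R) (j : 'M[R]_(4 * n)) t :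
  (forall u v, t u (j *m v) = e *: (j *m t u v)) -> forall U X,
  complexify t U (mapC j *m X) = e%:C%C *: (mapC j *m complexify t U X).
Proof.
move=> tj U X; rewrite /complexify ReV_mapC ImV_mapC !tj -scalerBr -scalerDr.
rewrite -mulmxBr -mulmxDr !map_mxZ !map_mxM /= [mapC j *m _]mulmxDr scalerDr.
by rewrite -scalemxAr !scalerA mulrC.
Qed.

Lemma complexify_equivl (e : R) (j : 'M[R]_(4 * n)) t :
  (forall u v, t (j *m u) v = e *: (j *m t u v)) -> forall U X,
  complexify t (mapC j *m U) X = e%:C%C *: (mapC j *m complexify t U X).
Proof.
move=> tj U X; rewrite /complexify ReV_mapC ImV_mapC !tj -scalerBr -scalerDr.
rewrite -mulmxBr -mulmxDr !map_mxZ !map_mxM /= [mapC j *m _]mulmxDr scalerDr.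
by rewrite -scalemxAr !scalerA mulrC.
Qed.

Lemma delta_decomposition (A : V -> 'M[R]_(4 * n)) : linear A ->
  (forall u, A u *m j1 = j1 *m A u) -> (forall u, A u *m j2 = j2 *m A u) ->
  (forall u x y, mxform w (A u *m x) y = - mxform w (A u *m y) x) ->
  exists t3 t4 t5 t7, [/\ X3 j1 j2 j3 w f t3, X4 j1 j2 j3 w f t4, X5 j1 j2 j3 w f t5,
    X7 j1 j2 j3 w f t7 & forall u v, delta A u v = t3 u v + t4 u v + t5 u v + t7 u v].
Proof.
move=> A_lin A1 A2 Aw; have A_bil := linear_mx_bilin A_lin.
pose c := tcomp (tens A).
have c_skew p q r : c p q r = - c p r q.
  apply/eqP; rewrite -addr_eq0; apply/eqP.
  (* The hypothesis speaks of real vectors; [h] is the complex trilinear form whose vanishing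
     expresses it. *)
  pose h U X Z := wC w (complexify (tens A) U X) Z + wC w (complexify (tens A) U Z) X.
  have hU X Z : scalar (fun U => h U X Z).
    by apply: scalar_add => a U U'; rewrite (complexify_linl _ A_bil) wC_linl.
  have hX U Z : scalar (fun X => h U X Z).
    apply: scalar_add => [a X X'|]; last exact: wC_linr.
    by rewrite (complexify_linr _ A_bil) wC_linl.
  have h_sym U X Z : h U X Z = h U Z X by rewrite /h addrC.
  rewrite -[LHS]/(h (fr p) (fr q) (fr r)).
  apply: (scalar_toVC0 (hU _ _)) => u; apply: (scalar_toVC0 (hX _ _)) => x.
  rewrite h_sym; apply: (scalar_toVC0 (hX _ _)) => y.
  rewrite /h !(complexify_toVC _ _ A_bil) !wC_toVC -rmorphD /tens Aw.
  by rewrite addNr.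
have c_equiv j (Q : 'M[C]_2) : (forall u, A u *m j = j *m A u) -> j^T *m w = - (w *m j) ->
    (forall q, mapC j *m fr q = \sum_b Q b q.2 *: fr (q.1, b)) ->
    forall p j b k d, \sum_b' Q b' b * c p (j, b') (k, d) =
      - \sum_d' Q d' d * c p (j, b) (k, d').
  move=> Aj jw jQ p i b k d.
  have tj u v : tens A u (j *m v) = 1 *: (j *m tens A u v).
    by rewrite scale1r /tens mulmxA Aj -mulmxA.
  have lin : scalar (fun X => wC w (complexify (tens A) (fr p) X) (fr (k, d))).
    by move=> a X X'; rewrite (complexify_linr _ A_bil) wC_linl.
  apply: etrans (esym (scalar_mapC_fr (i, b) jQ lin)) _.
  apply: etrans _ (congr1 -%R (scalar_mapC_fr (k, d) jQ (@wC_linr _ _ w _))).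
  apply: etrans (congr1 (fun X => wC w X _) (complexify_equivr tj (fr p) (fr (i, b)))) _.
  by rewrite scale1r (wC_mapC_skew jw).
(* The last two H slots are proportional to [S_H], so they may be read off at (1, 0), where [S_H] is
   1. *)
pose G a i j k := c (i, a) (j, 1) (k, 0).
have cG i j k a b d : c (i, a) (j, b) (k, d) = G a i j k * SH b d.
  have := @H_skew_invariant (fun b d => c (i, a) (j, b) (k, d)) _ _ b d; apply.
    exact: (c_equiv j1 (q1 R) A1 (qsh_w1 qsh) (adapted_j1_fr f_adapted) (i, a) j ^~ k).
  exact: (c_equiv j2 SH A2 (qsh_w2 qsh) (adapted_j2_fr f_adapted) (i, a) j ^~ k).
have G_sym a i j k : G a i j k = G a i k j.
  by rewrite /G c_skew cG quat_mx1E mulrN1 opprK.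
move: c_skew c_equiv => _ _.
(* The trace is divided by 2n, the dimension of E, to isolate the multiple of Id. *)
pose th p := (2 * n%:R)^-1 * \sum_j G p.2 p.1 j j.
pose G0 a i j k := G a i j k - line_part th a i j k.
have G0_S20 a : in_E_S20E (G0 a).
  split=> [i j k|i]; first by rewrite /G0 G_sym /line_part (eq_sym k).
  rewrite sumrB sum_delta_diag /th mulrA mulfV ?mul1r ?subrr //.
  by rewrite mulf_neq0 ?pnatr_eq0 // -lt0n.
(* The Id part enters X_7 together with this E part, which is therefore subtracted from the X_4
   component [G4]. *)
pose th7 p := X7_scale * th p.
pose G4 a := E_sym_of (fun k => (E_sym_trace R n)^-1 * (\sum_i G0 a i i k) - th7 (k, a)).
pose G7 a i j k := X7_scale * E_sym_of (fun l => th (l, a)) i j k + line_part th a i j k.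
exists (realize (alt (fun a => K_sym_proj (G0 a)))), (realize (alt G4)),
  (realize (alt (fun a => S30_proj (G0 a)))), (realize (alt G7)); split.
- apply: (delta_part_realize f_adapted qsh (@K_sym_sub R n)); first by move=> F [].
  by move=> a; exact: K_sym_projP.
- apply: (delta_part_realize f_adapted qsh (@E_sym_sub R n)).
    by move=> F; exact: E_sym_S20E.
  by move=> a; exact: E_sym_ofP.
- apply: (delta_part_realize f_adapted qsh (@S30E_sub R n)); first by move=> F [].
  by move=> a; exact: S30_projP.
- exact: X7_realize.
- move=> u v; rewrite -!alt_realizeD.
  rewrite -[LHS](tcomp_realK f_adapted w_skew u v (delta_bilin A_lin)).
  congr (realization _ _ _ u v).
  apply/funext=> p; apply/funext=> q; apply/funext=> r.
  rewrite (tcomp_delta cG) /Hslot_skew.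
  have GE a i j k : G a i j k = K_sym_proj (G0 a) i j k + G4 a i j k
      + S30_proj (G0 a) i j k + G7 a i j k.
    have -> : G4 a i j k = E_sym_proj (G0 a) i j k
        - X7_scale * E_sym_of (fun l => th (l, a)) i j k.
      exact: E_sym_ofB.
    have split_eq (x y z s l : C) : x + l = x - y - s + (y - z) + s + (z + l) by ring.
    rewrite -[LHS](subrK (line_part th a i j k)); exact: split_eq.
  by rewrite !GE.
Qed.
End SymDecomposition.

(** * The torsion of the Obata connection is symmetric in H *)

Section ObataTorsion.
Variables (R : realType) (n : nat) (j1 j2 j3 w : 'M[R]_(4 * n)) (f : EHframe R n).
Hypothesis f_adapted : adapted j1 j2 j3 w f.
Hypothesis qsh : quat_skewHermitian j1 j2 j3 w.
Local Notation C := R[i].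
Local Notation V := 'cV[R]_(4 * n).
Local Notation VC := 'cV[C]_(4 * n).
Local Notation T := ('I_(2 * n) * 'I_2)%type.
Local Notation tensor := (T -> T -> T -> C).
Local Notation tE := (Etensor R n).
Local Notation tcomp := (EHtensor w f).
Local Notation fr := (frame_vec f).
Implicit Types (p q r : T) (c : tensor) (t : V -> V -> V).

(** The two alternatives cover [q2] and [q3], with nonzero lower left entry, and [q1], diagonal with
    distinct entries. In the first the identity at (0, 0) suffices; in the second both off-diagonal
    entries of [m] vanish. *)
Lemma H_sym (Q : 'M[C]_2) (m : 'I_2 -> 'I_2 -> C) :
  (Q 1 0 != 0) || [&& Q 0 1 == 0, Q 1 0 == 0 & Q 0 0 != Q 1 1] ->
  (forall a b, \sum_a' Q a' a * m a' b = \sum_b' Q b' b * m a b') ->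
  forall a b, m a b = m b a.
Proof.
move=> Q_cond e; have {Q_cond} m01 : m 0 1 = m 1 0.
  case/orP: Q_cond => [Q10|/and3P[/eqP Q01 /eqP Q10 Qd]].
    by have := e 0 0; rewrite !big_ord2 => /addrI /(mulfI Q10) ->.
  have Qd' : Q 0 0 - Q 1 1 != 0 by rewrite subr_eq0.
  have m0 x : Q 0 0 * x = Q 1 1 * x -> x = 0.
    move=> Qx; apply: (mulfI Qd'); rewrite mulr0.
    by apply/eqP; rewrite mulrBl subr_eq0; apply/eqP.
  have := e 0 1; rewrite !big_ord2 Q01 Q10 !mul0r add0r addr0 => /m0 ->.
  by have := e 1 0; rewrite !big_ord2 Q01 Q10 !mul0r add0r addr0 => /esym /m0 ->.
by elim/ord2P; elim/ord2P.
Qed.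

(** Moving J out of an argument costs a sign, and moving it across [w] costs another. So [Q] acts
    equally in all three H slots, and [H_sym] applies to neighbouring ones. *)
Lemma anti_sym3H (j : 'M[R]_(4 * n)) (Q : 'M[C]_2) t : bilin t ->
  (forall u v, t (j *m u) v = (-1) *: (j *m t u v)) ->
  (forall u v, t u (j *m v) = (-1) *: (j *m t u v)) ->
  j^T *m w = - (w *m j) ->
  (forall q, mapC j *m fr q = \sum_b Q b q.2 *: fr (q.1, b)) ->
  (Q 1 0 != 0) || [&& Q 0 1 == 0, Q 1 0 == 0 & Q 0 0 != Q 1 1] ->
  sym3H (tcomp t).
Proof.
move=> t_bil tl tr jw jQ Q_cond.
have moveZ (U Z : VC) : wC w ((-1)%:C%C *: (mapC j *m U)) Z = wC w U (mapC j *m Z).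
  by rewrite (scalZ (@wC_linl _ _ w Z)) (wC_mapC_skew jw) rmorphN1 mulrNN mul1r.
have slot3 U X r : wC w (complexify t U X) (mapC j *m fr r) =
    \sum_d Q d r.2 * wC w (complexify t U X) (fr (r.1, d)).
  exact: (scalar_mapC_fr _ jQ (@wC_linr _ _ w _)).
have e13 p q r : \sum_a Q a p.2 * tcomp t (p.1, a) q r =
    \sum_d Q d r.2 * tcomp t p q (r.1, d).
  have := slot3 (fr p) (fr q) r; rewrite -(moveZ _ (fr r)) => <-.
  rewrite -(complexify_equivl tl (fr p) (fr q)).
  have lin : scalar (fun U => wC w (complexify t U (fr q)) (fr r)).
    by move=> a U U'; rewrite (complexify_linl _ t_bil) wC_linl.
  exact: (esym (scalar_mapC_fr p jQ lin)).
have e23 p q r : \sum_b Q b q.2 * tcomp t p (q.1, b) r =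
    \sum_d Q d r.2 * tcomp t p q (r.1, d).
  have := slot3 (fr p) (fr q) r; rewrite -(moveZ _ (fr r)) => <-.
  rewrite -(complexify_equivr tr (fr p) (fr q)).
  have lin : scalar (fun X => wC w (complexify t (fr p) X) (fr r)).
    by move=> a U U'; rewrite (complexify_linr _ t_bil) wC_linl.
  exact: (esym (scalar_mapC_fr q jQ lin)).
split=> i k l a b d; rewrite /slice.
  apply: (H_sym (m := fun a b => tcomp t (i, a) (k, b) (l, d)) Q_cond) => a' b'.
  exact: (etrans (e13 (i, a') (k, b') (l, d)) (esym (e23 (i, a') (k, b') (l, d)))).
apply: (H_sym (m := fun b d => tcomp t (i, a) (k, b) (l, d)) Q_cond) => b' d'.
exact: (e23 (i, a) (k, b') (l, d')).
Qed.

(** The Nijenhuis tensor of J in terms of the torsion [t] of a connection for which J is parallel: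
    the covariant derivatives cancel, and each bracket leaves minus a torsion. *)
Definition nij (j : 'M[R]_(4 * n)) t : V -> V -> V := fun u v =>
  - (t (j *m u) (j *m v) - t u v - j *m t (j *m u) v - j *m t u (j *m v)).

Lemma nij_bilin j t : bilin t -> bilin (nij j t).
Proof.
move=> [tr tl].
have comb a (x y z s x' y' z' s' : V) : - (a *: x + x' - (a *: y + y')
    - (a *: z + z') - (a *: s + s')) = a *: - (x - y - z - s) + - (x' - y' - z' - s').
  by apply/matrixP=> i k; rewrite !mxE; ring.
split=> u a v v'; rewrite /nij mulmxDr -scalemxAr.
  by rewrite !tr !mulmxDr -!scalemxAr comb.
have tl' b x y z := tl z b x y.
by rewrite !tl' !mulmxDr -!scalemxAr comb.
Qed.

Lemma nij_anti (j : 'M[R]_(4 * n)) t : bilin t -> j *m j = - 1%:M -> forall u v,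
  nij j t (j *m u) v = (-1) *: (j *m nij j t u v) /\
  nij j t u (j *m v) = (-1) *: (j *m nij j t u v).
Proof.
move=> [tr tl] jj u v.
have jjE (x : V) : j *m (j *m x) = - x by rewrite mulmxA jj mulNmx mul1mx.
rewrite /nij !jjE !(linN (tl _)) !(linN (tr _)) !(mulmxBr, mulmxN) !jjE scaleN1r.
move: (t u v) (t (j *m u) v) (t u (j *m v)) (t (j *m u) (j *m v)) => x y z s.
by split; rewrite !(opprB, opprD, opprK); apply/matrixP=> a b; rewrite !mxE; ring.
Qed.

Lemma complexifyZ (a : R) t U X :
  complexify (fun u v => a *: t u v) U X = a%:C%C *: complexify t U X.
Proof.
rewrite /complexify -scalerBr -scalerDr !map_mxZ scalerDr !scalerA.
by rewrite [Complex _ _ * _]mulrC.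
Qed.

Lemma tcompZ (a : R) t p q r : tcomp (fun u v => a *: t u v) p q r = a%:C%C * tcomp t p q r.
Proof. by rewrite /EHtensor complexifyZ (scalZ (@wC_linl _ _ w _)). Qed.

Lemma sym3H_lin (a : C) c c' c'' : sym3H c -> sym3H c' -> sym3H c'' ->
  sym3H (fun p q r => a * (c p q r + c' p q r + c'' p q r)).
Proof.
move=> [s1 s2] [s1' s2'] [s1'' s2'']; rewrite /slice in s1 s2 s1' s2' s1'' s2'' *.
by split=> i j k x y z; rewrite /slice; congr (_ * (_ + _ + _)).
Qed.

(** The Obata condition is a fixed-point equation for [t]. It is not solved: each [nij] anticommutes
    with its J whatever [t] is, and that decides the type of the right-hand side. *)
Lemma obata_sym3H t : bilin t ->
  (forall u v, t u v = 6^-1 *: (nij j1 t u v + nij j2 t u v + nij j3 t u v)) ->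
  sym3H (tcomp t).
Proof.
move=> t_bil tE; have b j := nij_bilin j t_bil.
have j3E := qsh_j12 qsh; have j21 := qsh_j21 qsh.
have j3_sqr : j3 *m j3 = - 1%:M.
  rewrite -{1}j3E -j21 mulmxN mulmxA -(mulmxA j1) (qsh_j2 qsh) mulmxN mulmx1 mulNmx.
  by rewrite (qsh_j1 qsh) opprK.
have w3 : j3^T *m w = - (w *m j3).
  rewrite -[in LHS]j3E trmx_mul -mulmxA (qsh_w1 qsh) mulmxN mulmxA (qsh_w2 qsh).
  by rewrite mulNmx opprK -mulmxA -j21 mulmxN opprK.
have sym (j : 'M[R]_(4 * n)) (Q : 'M[C]_2) : j *m j = - 1%:M -> j^T *m w = - (w *m j) ->
    (forall q, mapC j *m fr q = \sum_b Q b q.2 *: fr (q.1, b)) ->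
    (Q 1 0 != 0) || [&& Q 0 1 == 0, Q 1 0 == 0 & Q 0 0 != Q 1 1] ->
    sym3H (tcomp (nij j t)).
  move=> jj jw jQ Q_cond; apply: (anti_sym3H (b j) _ _ jw jQ Q_cond) => u v.
    by have [-> _] := nij_anti t_bil jj u v.
  by have [_ ->] := nij_anti t_bil jj u v.
pose N u v := nij j1 t u v + nij j2 t u v + nij j3 t u v.
have tN : t = fun u v => 6^-1 *: N u v.
  by apply/funext=> u; apply/funext=> v; exact: tE.
have -> : tcomp t = fun p q r => 6^-1%:C%C * (tcomp (nij j1 t) p q r
    + tcomp (nij j2 t) p q r + tcomp (nij j3 t) p q r).
  apply/funext=> p; apply/funext=> q; apply/funext=> r.
  apply: etrans (congr1 (fun t0 => tcomp t0 p q r) tN) _.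
  apply: etrans (tcompZ _ _ _ _ _) _; congr (_ * _).
  apply: etrans (tcompD _ _ (fun u v => nij j1 t u v + nij j2 t u v) _ _ _ _) _.
  by congr (_ + _); exact: tcompD.
have i_neq0 := iC_neq0 R.
apply: sym3H_lin.
- apply: (sym _ _ (qsh_j1 qsh) (qsh_w1 qsh) (adapted_j1_fr f_adapted)).
  by rewrite !q1E eqxx /= -addr_eq0 -mulr2n mulrn_eq0.
- apply: (sym _ _ (qsh_j2 qsh) (qsh_w2 qsh) (adapted_j2_fr f_adapted)).
  by rewrite !quat_mx1E oner_eq0.
- apply: (sym _ (q3 R) j3_sqr w3 (fun q => adapted_j3 f_adapted q.1 q.2)).
  by rewrite /q3 mxE big_ord2 !q1E /q2 !quat_mx1E mul0r add0r mulr1 oppr_eq0 i_neq0.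
Qed.
End ObataTorsion.

(** * Existence of adapted frames *)

Section AdaptedFrame.
Variables (R : realType) (n : nat) (j1 j2 j3 w : 'M[R]_(4 * n)).
Hypothesis qsh : quat_skewHermitian j1 j2 j3 w.
Local Notation C := R[i].
Local Notation V := 'cV[R]_(4 * n).
Local Notation VC := 'cV[C]_(4 * n).
Local Notation toVC := (map_mx (real_complex R)).
Local Notation iC := (Complex (0 : R) 1).
Local Notation B := (mxform w).
Implicit Types u v x y : V.

Let j11 u : j1 *m (j1 *m u) = - u.
Proof. by rewrite mulmxA (qsh_j1 qsh) mulNmx mul1mx. Qed.
Let j22 u : j2 *m (j2 *m u) = - u.
Proof. by rewrite mulmxA (qsh_j2 qsh) mulNmx mul1mx. Qed.
Let j12 u : j1 *m (j2 *m u) = j3 *m u.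
Proof. by rewrite mulmxA (qsh_j12 qsh). Qed.
Let j21 u : j2 *m (j1 *m u) = - (j3 *m u).
Proof. by rewrite mulmxA -(qsh_j21 qsh) mulNmx opprK. Qed.
Let j13 u : j1 *m (j3 *m u) = - (j2 *m u).
Proof. by rewrite -j12 j11. Qed.
Let j23 u : j2 *m (j3 *m u) = j1 *m u.
Proof. by rewrite -[j3 *m u]opprK -j21 mulmxN j22 opprK. Qed.
Let j31 u : j3 *m (j1 *m u) = j2 *m u.
Proof. by rewrite -j12 j21 mulmxN j13 opprK. Qed.
Let j32 u : j3 *m (j2 *m u) = - (j1 *m u).
Proof. by rewrite -j12 j22 mulmxN. Qed.
Let j33 u : j3 *m (j3 *m u) = - u.
Proof. by rewrite -[X in _ *m X]j12 j31 j22. Qed.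

Let jE := (j11, j22, j12, j21, j13, j23, j31, j32, j33).

Let B_linl v := @mxform_linl R n w v.
Let B_linr u := @mxform_linr R n w u.
Let BDl u u' v : B (u + u') v = B u v + B u' v. Proof. exact: (linD (B_linl v)). Qed.
Let BDr u v v' : B u (v + v') = B u v + B u v'. Proof. exact: (linD (B_linr u)). Qed.
Let BZl a u v : B (a *: u) v = a * B u v. Proof. exact: (scalZ (B_linl v)). Qed.
Let BZr a u v : B u (a *: v) = a * B u v. Proof. exact: (scalZ (B_linr u)). Qed.
Let BNl u v : B (- u) v = - B u v. Proof. exact: (linN (B_linl v)). Qed.
Let BNr u v : B u (- v) = - B u v. Proof. exact: (linN (B_linr u)). Qed.
Let BE := (BDl, BDr, BZl, BZr, BNl, BNr).

Let mxform_j j : j^T *m w = - (w *m j) -> forall u v, B (j *m u) v = - B u (j *m v).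
Proof.
move=> jw u v; rewrite /mxform trmx_mul -(mulmxA u^T j^T w) jw mulmxN mulNmx !mulmxA.
by rewrite mxE.
Qed.

Let B1 u v : B (j1 *m u) v = - B u (j1 *m v). Proof. exact: mxform_j (qsh_w1 qsh) u v. Qed.
Let B2 u v : B (j2 *m u) v = - B u (j2 *m v). Proof. exact: mxform_j (qsh_w2 qsh) u v. Qed.
Let B3 u v : B (j3 *m u) v = - B u (j3 *m v).
Proof. by rewrite -j12 B1 B2 j21 BNr !opprK. Qed.
Let BJ := (B1, B2, B3).

Let B_skew u v : B u v = - B v u. Proof. exact: mxform_skew (qsh_skew qsh) u v. Qed.
Let B_sym1 u v : B u (j1 *m v) = B v (j1 *m u). Proof. by rewrite B_skew B1 opprK. Qed.
Let B_sym2 u v : B u (j2 *m v) = B v (j2 *m u). Proof. by rewrite B_skew B2 opprK. Qed.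
Let B_sym3 u v : B u (j3 *m v) = B v (j3 *m u). Proof. by rewrite B_skew B3 opprK. Qed.

Let Bself u : B u u = 0.
Proof. by have /eqP := B_skew u u; rewrite -addr_eq0 -mulr2n mulrn_eq0 /= => /eqP. Qed.

Let jZ (j : 'M[R]_(4 * n)) a u : j *m (a *: u) = a *: (j *m u).
Proof. by rewrite -scalemxAr. Qed.
Let jD (j : 'M[R]_(4 * n)) u v : j *m (u + v) = j *m u + j *m v.
Proof. by rewrite mulmxDr. Qed.
Let jN (j : 'M[R]_(4 * n)) u : j *m (- u) = - (j *m u).
Proof. by rewrite mulmxN. Qed.
(** Normal form for values of [w]: products of the J_a are reduced, scalars pulled out, and every
    J_a moved to the second argument. *)
Let simpB := (jE, jZ, jD, jN, BE, BJ, Bself).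

Record jstable (U : V -> Prop) : Prop := Jstable {
  jstable_lin : forall a u v, U u -> U v -> U (a *: u + v);
  jstable_j1 : forall u, U u -> U (j1 *m u);
  jstable_j2 : forall u, U u -> U (j2 *m u)
}.

Lemma jstable_comb U (x y : R) u v : jstable U -> U u -> U v -> U (x *: u + y *: v).
Proof.
move=> U_stable Uu Uv; apply: (jstable_lin U_stable) => //.
rewrite -[_ *: _]addr0 -(addNr u) -scaleN1r; apply: (jstable_lin U_stable) => //.
exact: jstable_lin.
Qed.

(** With q_a(u) = w(u, J_a u), passing from u to (x + y J_2) u multiplies q_1 + i q_3 by (x - iy)^2
    and q_2 by x^2 + y^2. *)
Lemma rotate_j2 u (x y : R) : let v := x *: u + y *: (j2 *m u) in
  [/\ B v (j1 *m v) = (x ^+ 2 - y ^+ 2) * B u (j1 *m u) + 2 * x * y * B u (j3 *m u),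
      B v (j2 *m v) = (x ^+ 2 + y ^+ 2) * B u (j2 *m u)
    & B v (j3 *m v) = (x ^+ 2 - y ^+ 2) * B u (j3 *m u) - 2 * x * y * B u (j1 *m u)].
Proof.
move=> v; rewrite /v; split; rewrite !simpB.
- ring.
- ring.
- ring.
Qed.

Lemma rotate_j1 u (x y : R) : let v := x *: u + y *: (j1 *m u) in
  [/\ B v (j3 *m v) = (x ^+ 2 - y ^+ 2) * B u (j3 *m u) + 2 * x * y * B u (j2 *m u),
      B v (j1 *m v) = (x ^+ 2 + y ^+ 2) * B u (j1 *m u)
    & B v (j2 *m v) = (x ^+ 2 - y ^+ 2) * B u (j2 *m u) - 2 * x * y * B u (j3 *m u)].
Proof.
move=> v; rewrite /v; split; rewrite !simpB.
- ring.
- ring.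
- ring.
Qed.

(** Polarisation: if the quadratic form w(u, J_1 u) vanishes at u and at J_1 v, its value at u + J_1
    v is -2 w(u, v). *)
Lemma j1_anisotropic U : jstable U -> (exists u v, [/\ U u, U v & B u v != 0]) ->
  exists2 u, U u & B u (j1 *m u) != 0.
Proof.
move=> U_stable [u [v [Uu Uv uv0]]]; have Uj := jstable_j1 U_stable Uv.
have Us : U (1 *: u + j1 *m v) by exact: jstable_lin.
have [u0|] := eqVneq (B u (j1 *m u)) 0; last by exists u.
have [v0|] := eqVneq (B (j1 *m v) (j1 *m (j1 *m v))) 0; last by exists (j1 *m v).
exists (1 *: u + j1 *m v) => //; apply: contra uv0 => /eqP s0.
have : B (1 *: u + j1 *m v) (j1 *m (1 *: u + j1 *m v)) = B u (j1 *m u)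
    + B (j1 *m v) (j1 *m (j1 *m v)) - 2 * B u v.
  by rewrite !simpB (B_skew v u); ring.
by rewrite s0 u0 v0 => /eqP; rewrite !add0r eq_sym oppr_eq0 mulf_eq0 pnatr_eq0.
Qed.

(* A combination of u and J_2 u makes B(v, J_1 v) vanish; a combination of v and
   J_1 v then makes B(v, J_3 v) vanish and keeps B(v, J_1 v) = 0. *)
Lemma normalized_vector U : jstable U -> (exists u v, [/\ U u, U v & B u v != 0]) ->
  exists v, [/\ U v, B v (j1 *m v) = 0, B v (j3 *m v) = 0 & B v (j2 *m v) = - 2^-1].
Proof.
move=> U_stable /(j1_anisotropic U_stable)[u Uu q1_neq0].
have [q1 Eq1] : exists q, q = B u (j1 *m u) by eexists.
have [q3 Eq3] : exists q, q = B u (j3 *m u) by eexists.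
have [rho Erho] : exists r, r = Num.sqrt (q1 ^+ 2 + q3 ^+ 2) by eexists.
have rho_sqr : rho ^+ 2 = q1 ^+ 2 + q3 ^+ 2.
  by rewrite Erho sqr_sqrtr // addr_ge0 // sqr_ge0.
(* A half-angle choice: by [rotate_j2] the new value of q_1 is q1 (q1^2 + q3^2 - rho^2) = 0. *)
pose u' := q1 *: u + (q3 + rho) *: (j2 *m u).
have [] := rotate_j2 u q1 (q3 + rho); rewrite -/u' -Eq1 -Eq3 => e1 _ e3.
have Uu' : U u' by apply: jstable_comb => //; exact: jstable_j2.
have e1_0 : B u' (j1 *m u') = 0.
  by rewrite e1; ring: rho_sqr.
have e3_neq0 : B u' (j3 *m u') != 0.
  have q1_0 : q1 != 0 by rewrite Eq1.
  (* The rotation multiplies q_1^2 + q_3^2 by a positive number; with q_1 gone, q_3 cannot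
     vanish. *)
  have : 0 < (q1 ^+ 2 + (q3 + rho) ^+ 2) ^+ 2 * (q1 ^+ 2 + q3 ^+ 2).
    rewrite mulr_gt0 ?exprn_gt0 // ltr_pwDl ?sqr_ge0 //;
    by rewrite lt_neqAle sqr_ge0 andbT eq_sym sqrf_eq0.
  have -> : (q1 ^+ 2 + (q3 + rho) ^+ 2) ^+ 2 * (q1 ^+ 2 + q3 ^+ 2) =
      B u' (j1 *m u') ^+ 2 + B u' (j3 *m u') ^+ 2 by rewrite e1 e3; ring.
  by rewrite e1_0 expr0n add0r; apply: contraTneq => ->; rewrite expr0n ltxx.
move: {e1 e3 Eq1 Eq3 Erho rho_sqr q1_neq0} u' Uu' e1_0 e3_neq0 => {Uu q1 q3 rho}u' Uu' e1 e3.
have [p2 Ep2] : exists q, q = B u' (j2 *m u') by eexists.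
have [p3 Ep3] : exists q, q = B u' (j3 *m u') by eexists.
pose s := Num.sqrt (p2 ^+ 2 + p3 ^+ 2).
have s_sqr : s ^+ 2 = p2 ^+ 2 + p3 ^+ 2 by rewrite sqr_sqrtr // addr_ge0 // sqr_ge0.
have p3_gt0 : 0 < p3 ^+ 2 by rewrite lt_neqAle sqr_ge0 andbT eq_sym sqrf_eq0 Ep3.
have s_ge0 : 0 <= s by exact: sqrtr_ge0.
have s_gt : 0 < s + p2 by rewrite ltNge; apply/negP => sp; nra.
pose v := p3 *: u' + (p2 + s) *: (j1 *m u').
have [] := rotate_j1 u' p3 (p2 + s); rewrite -/v -Ep2 -Ep3 e1 mulr0 => f3 f1 f2.
have Uv : U v by apply: jstable_comb => //; exact: jstable_j1.
have f3_0 : B v (j3 *m v) = 0 by rewrite f3; ring: s_sqr.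
(* With the root +s, the value w(v, J_2 v) = -2 s^2 (s + p2) is negative whatever the sign of p2, so
   a real rescaling reaches -1/2. *)
pose d := 4 * (s ^+ 2 * (s + p2)).
have d_gt0 : 0 < d.
  rewrite mulr_gt0 // mulr_gt0 // s_sqr; apply: ltr_wpDl => //; exact: sqr_ge0.
have f2_d : B v (j2 *m v) = - (d / 2).
  have -> : d / 2 = 2 * (s ^+ 2 * (s + p2)) by rewrite /d; field.
  by rewrite f2; ring: s_sqr.
pose c := Num.sqrt d^-1.
have c_sqr : c ^+ 2 * d = 1 by rewrite sqr_sqrtr ?invr_ge0 ?ltW // mulVf // gt_eqF.
have scale (j : 'M[R]_(4 * n)) : B (c *: v) (j *m (c *: v)) = c ^+ 2 * B v (j *m v).
  by rewrite jZ BZl BZr; ring.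
exists (c *: v); split; rewrite ?scale ?f1 ?f3_0 ?mulr0 //.
- rewrite -[c *: v]addr0 -(scale0r v); exact: jstable_comb.
- by rewrite f2_d mulrN mulrA c_sqr mul1r.
Qed.

(** The value -1/2 is dictated by the frame: for f_0 = r - i J_1 r and f_1 = J_2 f_0 it gives w(f_0,
    f_1) = 2 w(r, J_2 r) = -1, which is [S_H 0 1]. *)
Definition orthogonal_family k (v : nat -> V) := forall i l, (i < k)%N -> (l < k)%N ->
  [/\ B (v i) (v l) = 0, B (v i) (j1 *m v l) = 0, B (v i) (j3 *m v l) = 0
    & B (v i) (j2 *m v l) = - 2^-1 * (i == l)%:R].

Section Extension.
Variables (k : nat) (v : nat -> V).
Hypotheses (k_lt_n : (k < n)%N) (v_orth : orthogonal_family k v).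

Definition orthogonal_to u := forall i, (i < k)%N ->
  [/\ B u (v i) = 0, B u (j1 *m v i) = 0, B u (j2 *m v i) = 0 & B u (j3 *m v i) = 0].

Lemma orthogonal_to_jstable : jstable orthogonal_to.
Proof.
split=> [a x y Ux Uy|x Ux|x Ux] i ik; have [x0 x1 x2 x3] := Ux i ik.
- have [y0 y1 y2 y3] := Uy i ik.
  by rewrite !BDl !BZl x0 x1 x2 x3 y0 y1 y2 y3 mulr0 addr0.
- by rewrite !B1 !jE !BNr x0 x1 x2 x3 !oppr0.
- by rewrite !B2 !jE !BNr x0 x1 x2 x3 !oppr0.
Qed.

(** The [k] quaternionic vectors impose 4k real linear conditions in dimension 4n, and k < n. *)
Lemma orthogonal_to_neq0 : exists2 u, u != 0 & orthogonal_to u.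
Proof.
pose M (j : 'M[R]_(4 * n)) : 'M[R]_(4 * n, k) := \matrix_(x < 4 * n, i < k) (w *m (j *m v i)) x 0.
pose N := row_mx (row_mx (M 1%:M) (M j1)) (row_mx (M j2) (M j3)).
have ker_neq0 : kermx N != 0.
  rewrite -mxrank_eq0 mxrank_ker subn_eq0 -ltnNge.
  by apply: leq_ltn_trans (rank_leq_col _) _; lia.
pose r := nz_row (kermx N); have r_neq0 : r != 0 by rewrite nz_row_eq0.
have rN : r *m N = 0 by apply/sub_kermxP; exact: nz_row_sub.
exists r^T; first by rewrite trmx_eq0.
move: rN; rewrite !mul_mx_row -(row_mx0 _ _ (k + k)) => /eq_row_mx[].
rewrite -!(row_mx0 _ _ k) => /eq_row_mx[r0 r1] /eq_row_mx[r2 r3] i ik.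
have entry j : r *m M j = 0 -> B r^T (j *m v i) = 0.
  move=> /matrixP/(_ 0 (Ordinal ik)); rewrite !mxE => E.
  rewrite /mxform trmxK -mulmxA mxE -[RHS]E; apply: eq_bigr => x _.
  by rewrite [M j _ _]mxE.
by rewrite -{1}[v i]mul1mx !entry.
Qed.

Lemma orthogonal_to_nondegenerate : exists x y,
  [/\ orthogonal_to x, orthogonal_to y & B x y != 0].
Proof.
have [u u_neq0 Uu] := orthogonal_to_neq0.
have [z uz] : exists z, B u z != 0.
  apply/not_existsP => Bu0; case/negP: u_neq0; apply/eqP.
  have uw : u^T *m w = 0.
    apply/matrixP=> i l; rewrite ord1 [RHS]mxE.
    have /negP := Bu0 (delta_mx l 0); rewrite negbK => /eqP.
    by rewrite /mxform -colE mxE.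
  by apply: trmx_inj; rewrite -[u^T](mulmxK (qsh_unit qsh)) uw mul0mx trmx0.
(* The projection to the quaternionic line of [v i]: there [w] pairs v with J_2 v and J_1 v with J_3
   v, both with value -1/2, hence the factors 2 and their signs. *)
pose proj i := (- 2 * B z (j2 *m v i)) *: v i + (- 2 * B z (j3 *m v i)) *: (j1 *m v i)
  + (2 * B z (v i)) *: (j2 *m v i) + (2 * B z (j1 *m v i)) *: (j3 *m v i).
exists u, (z - \sum_(i < k) proj i); split=> //; last first.
  rewrite BDr BNr (lin_sum (B_linr u)) big1 ?subr0 // => i _.
  have [u0 u1 u2 u3] := Uu i (ltn_ord i).
  by rewrite !BDr !BZr u0 u1 u2 u3 !mulr0 !addr0.
move=> l lk; rewrite !BDl !BNl !(lin_sum (B_linl _)).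
have sumE (j : 'M[R]_(4 * n)) : (forall i, (i < k)%N -> B (proj i) (j *m v l) =
      (i == l)%:R * B z (j *m v l)) ->
    \sum_(i < k) B (proj i) (j *m v l) = B z (j *m v l).
  move=> E; rewrite (bigD1 (Ordinal lk)) //= big1 ?addr0 => [|i il].
    by rewrite E // eqxx mul1r.
  by rewrite E // -val_eqE /= in il *; rewrite (negbTE il) mul0r.
have two_neq0 : (2 : R) != 0 by rewrite pnatr_eq0.
have := sumE 1%:M; rewrite mul1mx => ->; last first.
  move=> i ik; have [h0 h1 h3 h2] := v_orth ik lk.
  rewrite /proj !simpB h0 h1 h2 h3.
  by case: eqP => [->|_] /=; field.
rewrite !sumE ?subrr //.
- move=> i ik; have [h0 h1 h3 h2] := v_orth ik lk.
  rewrite /proj !simpB h0 h1 h2 h3.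
  by case: eqP => [->|_] /=; field.
- move=> i ik; have [h0 h1 h3 h2] := v_orth ik lk.
  rewrite /proj !simpB h0 h1 h2 h3.
  by case: eqP => [->|_] /=; field.
- move=> i ik; have [h0 h1 h3 h2] := v_orth ik lk.
  rewrite /proj !simpB h0 h1 h2 h3.
  by case: eqP => [->|_] /=; field.
Qed.
End Extension.

Lemma orthogonal_family_exists k : (k <= n)%N -> exists v : nat -> V, orthogonal_family k v.
Proof.
elim: k => [_|k IHk k_lt_n]; first by exists (fun=> 0).
have [v v_orth] := IHk (ltnW k_lt_n).
have [x [Ux x1 x3 x2]] := normalized_vector (@orthogonal_to_jstable k v)
  (orthogonal_to_nondegenerate k_lt_n v_orth).
exists (fun i => if i == k then x else v i) => i l.
rewrite ltnS leq_eqVlt => i_k; rewrite ltnS leq_eqVlt => l_k; move: i_k l_k.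
case: (eqVneq i k) => [->|ik] /= iltk; case: (eqVneq l k) => [->|lk] /= lltk.
- by rewrite Bself x1 x2 x3 ?eqxx ?mulr1.
- by have [-> -> -> ->] := Ux l lltk; rewrite ?(eq_sym k) ?(negbTE lk) ?mulr0.
- have [x0 x1' x2' x3'] := Ux i iltk.
  by rewrite B_skew B_sym1 B_sym2 B_sym3 x0 x1' x2' x3' ?(negbTE ik) ?oppr0 ?mulr0.
- by have [-> -> -> ->] := v_orth i l iltk lltk.
Qed.

Lemma adapted_frame_exists : exists f : EHframe R n, adapted j1 j2 j3 w f.
Proof.
have [v v_orth] := orthogonal_family_exists (leqnn n).
(* The second half is forced by reality: the conjugate of [f i 0] must be a signed
   [f (bar_ord i) 1], so [r (bar_ord i)] is a signed J_2 image of [r i]. *)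
pose r (i : 'I_(2 * n)) := if (i < n)%N then v i else - (j2 *m v (i - n)%N).
pose sg (i : 'I_(2 * n)) : R := (-1) ^+ (n <= i)%N.
have r_bar i : r (bar_ord i) = - sg i *: (j2 *m r i).
  rewrite /r /sg /=; have := ltn_ord i; case: (ltnP i n) => i_n i_2n.
    by rewrite ltnNge leq_addl /= addnK expr0 scaleN1r.
  by rewrite ifT ?expr1 ?opprK ?scale1r ?mulmxN ?j22 ?opprK //; lia.
have r_orth i l : B (r i) (j2 *m r l) = - 2^-1 * (i == l)%:R /\ B (r i) (j3 *m r l) = 0.
  have [i_2n l_2n] := (ltn_ord i, ltn_ord l).
  rewrite /r -(inj_eq val_inj) /=; case: (ltnP i n) => i_n; case: (ltnP l n) => l_n; rewrite ?simpB.
  - by have [_ _ -> ->] := v_orth i l i_n l_n.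
  - have [|-> -> _ _] := v_orth i (l - n)%N i_n; first by lia.
    by rewrite (_ : (_ == _) = false) ?mulr0 ?opprK; first split; last by apply/eqP; lia.
  - have [| h0 h1 _ _] := v_orth (i - n)%N l _ l_n; first by lia.
    by rewrite h0 h1 (_ : (_ == _) = false) ?mulr0 ?oppr0 ?opprK; last by apply/eqP; lia.
  - have [| |_ _ h3 h2] := v_orth (i - n)%N (l - n)%N; [by lia|by lia|].
    rewrite ?simpB ?h2 ?h3 ?opprK ?oppr0; split=> //.
    by congr (_ * (nat_of_bool _)%:R); apply/eqP/eqP; lia.
(* [f i 0] is the eigenvector of J_1 for the eigenvalue i with real part [r i], and [f i 1] is its
   image under J_2. *)
pose f (i : 'I_(2 * n)) (a : 'I_2) : VC := if a == 0 then
    toVC (r i) - iC *: toVC (j1 *m r i)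
  else toVC (j2 *m r i) + iC *: toVC (j3 *m r i).
have f0 i : f i 0 = toVC (r i) - iC *: toVC (j1 *m r i) by [].
have f1 i : f i 1 = toVC (j2 *m r i) + iC *: toVC (j3 *m r i) by [].
have toVCN u : toVC (- u) = - toVC u by exact: map_mxN.
have mapC_toVC (j : 'M[R]_(4 * n)) u : mapC j *m toVC u = toVC (j *m u).
  by rewrite /mapC -map_mxM.
have mapC_f (j : 'M[R]_(4 * n)) u (a : C) x : mapC j *m (toVC u + a *: toVC x) =
    toVC (j *m u) + a *: toVC (j *m x).
  by rewrite mulmxDr -scalemxAr !mapC_toVC.
have vec_eq (I : C) (u x u' x' : VC) : u = u' -> x = x' -> u + I *: x = u' + I *: x'.
  by move=> -> ->.
have f1j i : mapC j2 *m f i 0 = f i 1.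
  by rewrite f0 f1 -scaleNr mapC_f j21 toVCN scaleNr scalerN opprK.
have f0j i : mapC j2 *m f i 1 = - f i 0.
  by rewrite f0 f1 mapC_f j22 j23 toVCN opprB addrC.
have g0j i : mapC j1 *m f i 0 = iC *: f i 0.
  rewrite f0 -scaleNr mapC_f j11 toVCN scalerN -scaleNr opprK scalerDr scalerA.
  by rewrite mulrN iC_sqr opprK scale1r addrC.
have g1j i : mapC j1 *m f i 1 = - iC *: f i 1.
  rewrite f1 mapC_f j12 j13 toVCN scalerN -scaleNr scalerDr scalerA mulNr iC_sqr.
  by rewrite opprK scale1r addrC.
have conj_i : conjc iC = - iC by rewrite -[RHS]/(Complex _ _) oppr0.
have conjN : conjc (- iC) = iC by rewrite -conj_i conjcK.
have cc_comb u (a : C) x : map_mx (@conjc R) (toVC u + a *: toVC x) =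
    toVC u + conjc a *: toVC x.
  by rewrite map_mxD ccZ !cc_toVC.
have toVCZ (a : R) u : toVC (a *: u) = a%:C%C *: toVC u by rewrite map_mxZ.
have bsE i : bar_sign R i = (sg i)%:C%C by rewrite /bar_sign /sg rmorphXn rmorphN rmorph1.
have wC_comb u (a : C) x u' (b : C) x' :
    wC w (toVC u + a *: toVC x) (toVC u' + b *: toVC x') =
    (B u u')%:C%C + b * (B u x')%:C%C + a * ((B x u')%:C%C + b * (B x x')%:C%C).
  rewrite (linD (@wC_linl _ _ w _)) (scalZ (@wC_linl _ _ w _)).
  rewrite !(linD (@wC_linr _ _ w _)) !(scalZ (@wC_linr _ _ w _)).
  by rewrite !wC_toVC.
have bar2 i : toVC (j2 *m r (bar_ord i)) = bar_sign R i *: toVC (r i).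
  by rewrite r_bar jZ j22 scaleNr scalerN opprK toVCZ bsE.
have bar3 i : toVC (j3 *m r (bar_ord i)) = bar_sign R i *: toVC (j1 *m r i).
  by rewrite r_bar jZ j32 scaleNr scalerN opprK toVCZ bsE.
have bar0 i : toVC (r (bar_ord i)) = - (bar_sign R i *: toVC (j2 *m r i)).
  by rewrite r_bar scaleNr toVCN toVCZ bsE.
have bar1 i : toVC (j1 *m r (bar_ord i)) = - (bar_sign R i *: toVC (j3 *m r i)).
  by rewrite r_bar jZ j12 scaleNr toVCN toVCZ bsE.
exists f; split.
- move=> i a; rewrite sum_quat_mx; elim/ord2P: a; rewrite bar_ord1E bar_sign1E.
    rewrite mulr1 f0 -scaleNr cc_comb conjN f1 bar2 bar3.
    by rewrite scalerDr (scalerA iC) (mulrC iC) !scalerA mulrA bar_sign_sqr mul1r scale1r.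
  rewrite f1 cc_comb conj_i f0 bar0 bar1.
  move: (toVC (j2 *m r i)) (toVC (j3 *m r i)) (bar_sign_sqr R i) => X Y.
  move: (bar_sign R i) iC => b I bb; apply/matrixP=> k l; rewrite !mxE.
  by move: (X k l) (Y k l) => x y; ring: bb.
- move=> i a; rewrite big_ord2; elim/ord2P: a.
    by rewrite g0j !q1E scale0r addr0.
  by rewrite g1j !q1E scale0r add0r.
- move=> i a; rewrite big_ord2 /q2; elim/ord2P: a.
    by rewrite f1j !quat_mx1E scale0r add0r scale1r.
  by rewrite f0j !quat_mx1E scale0r addr0 scaleN1r.
- move=> i a; rewrite big_ord2 /q3 !mxE !big_ord2 /q2 /mapC -(qsh_j12 qsh) map_mxM -mulmxA.
  elim/ord2P: a.
    rewrite -/(mapC j2) f1j -/(mapC j1) g1j !q1E !quat_mx1E.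
    by rewrite !mulr0 !mul0r !mulr1 !add0r scale0r add0r.
  rewrite -/(mapC j2) f0j mulmxN -/(mapC j1) g0j !q1E !quat_mx1E.
  by rewrite !mulr0 !mul0r !addr0 scale0r addr0 mulrN1 scaleNr.
- move=> i l a b.
  have [h2 h3] := r_orth i l.
  have hD : 2 * (B (r i) (j2 *m r l))%:C%C = - (i == l)%:R :> C.
    rewrite -(rmorph_nat (real_complex R) 2) -rmorphM h2 mulrA mulrN mulfV ?pnatr_eq0 //.
    by rewrite mulN1r rmorphN rmorph_nat.
  have {}hD : (i == l)%:R = - (2 * (B (r i) (j2 *m r l))%:C%C) :> C by rewrite hD opprK.
  have I2 := iC_sqr R.
  elim/ord2P: a; elim/ord2P: b;
    rewrite !quat_mx1E ?f0 ?f1 -?scaleNr wC_comb !simpB ?h3 hD !(rmorphN, rmorph0) /=;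
    by move: iC I2 => I I2; ring: I2.
Qed.
End AdaptedFrame.

(** * Fields and connections in charts *)

(** The difference [g - f] vanishes near [a], so it is differentiable there with zero
    differential. *)
Lemma near_eq_differentiable (R : realType) (V W : normedModType R) (f g : V -> W) (a : V) :
  (\forall x \near a, f x = g x) -> differentiable f a -> differentiable g a.
Proof.
move=> fg df; have -> : g = f + (g - f) by rewrite addrC subrK.
apply: (differentiableD df); apply/diff_locallyP.
have h0 : (g - f) a = 0 by rewrite !fctE (nbhs_singleton fg) subrr.
have hE : (g - f) \o shift a = cst ((g - f) a) + (0 : V -> W) +o_ 0 id.
  apply/eqaddoP => e e0; rewrite h0.
  have : \forall y \near (0 : V), f (y + a) = g (y + a).
    by move: fg; rewrite (near_shift 0) subr0.
  apply: filterS => y /= fgy.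
  rewrite !fctE /= fgy.
  by rewrite subrr !add0r -[(0 : V -> W) y]/(0 : W) oppr0 normr0 mulr_ge0 // ltW.
have c0 : continuous (0 : V -> W) by exact: cst_continuous.
have d0 : 'd (g - f) a = (0 : V -> W) :> (V -> W).
  exact: (@diff_unique _ _ _ (g - f) (\0 : {linear V -> W}) a c0 hE).
by rewrite d0; split.
Qed.

Section Vectors.
Variables (R : realType) (m : nat).
Local Notation V := 'cV[R]_m.

Lemma vec_differentiable (f : V -> V) (p : V) :
  (forall i, differentiable (fun q => f q i 0) p) -> differentiable f p.
Proof.
move=> df; have -> : f = \sum_i (fun q => f q i 0 *: (delta_mx i 0 : V)).
  apply/funext=> q; rewrite fct_sumE {1}[f q]matrix_sum_delta.
  by apply: eq_bigr => i _; rewrite big_ord1.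
by apply: differentiable_sum => i; exact: differentiableZl.
Qed.

Lemma vec_derive (f : V -> V) (p v : V) i : differentiable f p ->
  ('D_v f p) i 0 = 'D_v (fun q => f q i 0) p.
Proof. by move=> df; rewrite derive_mx ?mxE //; exact: diff_derivable. Qed.

Lemma Ck_sub k (U U' : set V) (f : V -> R) : U' `<=` U -> Ck k U f -> Ck k U' f.
Proof.
move=> UU'; elim: k f => [|k IHk] f /=; first by move=> fU p /UU'; exact: fU.
by case=> df Df; split=> [p /UU'|i]; [exact: df|exact: IHk (Df i)].
Qed.

(** Openness of [U] passes the equality on to the partial derivatives, which makes the induction
    work. *)
Lemma Ck_eq k (U : set V) (f g : V -> R) : open U ->
  (forall p, U p -> f p = g p) -> Ck k U f -> Ck k U g.
Proof.
move=> U_open; elim: k f g => [|k IHk] f g fg.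
  move=> fU p Up; have fg_near : \forall q \near p, f q = g q.
    by apply: filterS fg _; exact: open_nbhs_nbhs.
  have := fU p Up; rewrite /prop_for /continuous_at (fg p Up).
  by apply: cvg_trans; exact: (near_eq_cvg fg_near).
case=> df Df; split=> [p Up|i].
  by apply: near_eq_differentiable (df p Up); apply: filterS fg _; exact: open_nbhs_nbhs.
apply: IHk (Df i) => p Up; apply: near_eq_derive.
by apply: filterS fg _; exact: open_nbhs_nbhs.
Qed.

Lemma smooth_near_eq (p : V) (f g : V -> R) :
  (\forall q \near p, f q = g q) -> smooth_near p f -> smooth_near p g.
Proof.
move=> fg [U [U_open Up fU]].
have : nbhs p (U `&` [set q | f q = g q]) by apply: filterI => //; exact: open_nbhs_nbhs.
rewrite nbhsE => -[W [W_open Wp] WU]; exists W; split=> // k.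
apply: (Ck_eq (f := f) W_open) => [q /WU[]//|].
by apply: (Ck_sub _ (fU k)) => q /WU[].
Qed.

Lemma smooth_near_cst (p : V) (a : R) : smooth_near p (fun=> a).
Proof.
exists setT; split=> //; first exact: openT.
move=> k; elim: k a => [|k IHk] a; first by move=> q _; exact: cst_continuous.
split=> [q _|i]; first exact: differentiable_cst.
apply: (Ck_eq openT _ (IHk 0)) => q _; exact: (esym (derive_cst _ _ _)).
Qed.

Lemma smooth_near_differentiable (p : V) (f : V -> R) : smooth_near p f ->
  differentiable f p.
Proof. by case=> U [_ Up /(_ 1)[fU _]]; exact: fU. Qed.

End Vectors.

Section Manifold.
Variables (R : realType) (m : nat) (M : smoothManifold R m).
Local Notation V := 'cV[R]_m.
Implicit Types (x y z : M) (X Y Z : vfield M) (p q : V).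

(* [vector.coord] would otherwise shadow the chart *)
Local Notation coord := Defs.coord.

Definition source x : set M := chart_source (chart_at x).
Definition target x : set V := chart_target (chart_at x).

Lemma source_coord_inv x p : target x p -> source x (coord_inv x p).
Proof. exact: chart_invP. Qed.
Lemma target_coord x y : source x y -> target x (coord x y).
Proof. exact: chart_funP. Qed.
Lemma coordK x y : source x y -> coord_inv x (coord x y) = y.
Proof. exact: chart_funK. Qed.
Lemma coord_invK x p : target x p -> coord x (coord_inv x p) = p.
Proof. exact: chart_invK. Qed.
Lemma source_self x : source x x. Proof. exact: chart_at_source. Qed.
Hint Resolve source_self : core.

Lemma coordK_self x : coord_inv x (coord x x) = x. Proof. exact: coordK. Qed.

Lemma target_near x y : source x y -> \forall p \near coord x y, target x p.
Proof.
move=> xy; apply: open_nbhs_nbhs; split; first exact: chart_target_open.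
exact: target_coord.
Qed.

Lemma source_near x y : source x y -> \forall z \near y, source x z.
Proof. by move=> xy; apply: open_nbhs_nbhs; split; first exact: chart_source_open. Qed.

Lemma near_coord_inv x y (P : set M) : source x y ->
  (\forall z \near y, P z) -> \forall p \near coord x y, P (coord_inv x p).
Proof.
move=> xy Py; have := @chart_inv_continuous _ _ _ (chart_at x) _ (target_coord xy).
by apply; rewrite -[chart_inv _ _]/(coord_inv x _) coordK.
Qed.

Definition trans x y : V -> V := coord y \o coord_inv x.

Lemma trans_differentiable x y p : target x p -> source y (coord_inv x p) ->
  differentiable (trans x y) p.
Proof.
move=> xp yp; apply: vec_differentiable => i.
exact/smooth_near_differentiable/(chart_at_compat xp yp).
Qed.

Definition dtrans x y z : V -> V := 'd (trans x y) (coord x z).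

Lemma dtrans_linear x y z : linear (dtrans x y z).
Proof. exact: linearP. Qed.

Lemma dtransK x y z : source x z -> source y z -> cancel (dtrans x y z) (dtrans y x z).
Proof.
move=> xz yz u.
have xzt := target_coord xz; have yzt := target_coord yz.
have trans_z : trans x y (coord x z) = coord y z by rewrite /trans /= coordK.
have d1 : differentiable (trans x y) (coord x z).
  by apply: trans_differentiable => //; rewrite coordK.
have d2 : differentiable (trans y x) (trans x y (coord x z)).
  by rewrite trans_z; apply: trans_differentiable => //; rewrite coordK.
have : 'd (trans y x \o trans x y) (coord x z) u = u.
  rewrite -deriveE; last exact: differentiable_comp.
  rewrite (@near_eq_derive _ _ _ _ id) ?derive_id //.
  have := near_coord_inv xz (source_near yz).
  have := target_near xz; apply: filterS2 => p xp yp.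
  by rewrite /trans /= coordK // coord_invK.
have dE q v : q = coord y z -> 'd (trans y x) q v = dtrans y x z v by move=> ->.
by rewrite (diff_comp d1 d2) /= (dE _ _ trans_z).
Qed.
End Manifold.

(** * Fields constant in a chart, and Christoffel symbols *)

Section Fields.
Variables (R : realType) (m : nat) (M : smoothManifold R m).
Local Notation V := 'cV[R]_m.
Local Notation coord := Defs.coord.
Implicit Types (x y z : M) (X Y Z : vfield M) (p q u v : V).
Hint Resolve source_self : core.

Lemma local_repE x X p : target x p -> local_rep x X p =
  dtrans (coord_inv x p) x (coord_inv x p) (X (coord_inv x p)).
Proof.
move=> xp; rewrite /local_rep deriveE //; apply: trans_differentiable.
  exact: target_coord.
by rewrite coordK //; exact: source_coord_inv.
Qed.

Lemma local_rep_self x X : local_rep x X (coord x x) = X x.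
Proof.
rewrite local_repE; last exact: target_coord.
rewrite coordK_self /dtrans -deriveE; last first.
  by apply: trans_differentiable; rewrite ?coordK_self //; exact: target_coord.
rewrite (@near_eq_derive _ _ _ _ id) ?derive_id //.
by have := target_near (source_self x); apply: filterS => p; exact: coord_invK.
Qed.

(** The sum over basis directions, instead of one derivative along [u], makes the field linear in
    [u] at every point, also where the transition map need not be differentiable. *)
Definition const_field x u : vfield M := fun y =>
  \sum_j u j 0 *: 'D_(delta_mx j 0) (trans x y) (coord x y).

Lemma const_field_lin x a u v y :
  const_field x (a *: u + v) y = a *: const_field x u y + const_field x v y.
Proof.
rewrite /const_field scaler_sumr -big_split; apply: eq_bigr => j _ /=.
by rewrite !mxE scalerDl scalerA.
Qed.

Lemma const_fieldE x u y : source x y -> const_field x u y = dtrans x y y u.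
Proof.
move=> xy; rewrite {2}[u]col_sum_delta (lin_sum (@dtrans_linear _ _ _ _ _ _)); apply: eq_bigr => j _.
rewrite (linZ (@dtrans_linear _ _ _ _ _ _)) /dtrans deriveE //.
by apply: trans_differentiable; [exact: target_coord|rewrite coordK].
Qed.

Lemma local_rep_const_field x u p : target x p -> local_rep x (const_field x u) p = u.
Proof.
move=> xp; have xq := source_coord_inv xp.
by rewrite local_repE // const_fieldE // dtransK.
Qed.

Lemma const_field_self x u : const_field x u x = u.
Proof. by rewrite -local_rep_self local_rep_const_field //; exact: target_coord. Qed.

Lemma smooth_near_rep x X (F : V -> V) : (\forall p \near coord x x, local_rep x X p = F p) ->
  (forall i, smooth_near (coord x x) (fun p => F p i 0)) -> smooth_vfield_near x X.
Proof.
move=> XF F_smooth i; apply: smooth_near_eq (F_smooth i).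
by apply: filterS XF => p ->.
Qed.

Lemma const_field_smooth x u : smooth_vfield_near x (const_field x u).
Proof.
apply: (@smooth_near_rep _ _ (fun=> u)) => [|i]; last exact: smooth_near_cst.
by have := target_near (source_self x); apply: filterS => p; exact: local_rep_const_field.
Qed.

Definition component x X j : M -> R := fun y => local_rep x X (coord x y) j 0.

Lemma field_expand x X y : source x y ->
  X y = \sum_j component x X j y *: const_field x (delta_mx j 0) y.
Proof.
move=> xy; rewrite /component; set c := local_rep x X (coord x y).
have -> : X y = const_field x c y.
  by rewrite const_fieldE // /c local_repE ?coordK ?dtransK //; exact: target_coord.
have lin : linear (const_field x ^~ y) by move=> a u v; exact: const_field_lin.
rewrite {1}[c]col_sum_delta (lin_sum lin); apply: eq_bigr => j _; exact: (linZ lin).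
Qed.

Lemma component_coord_inv x X j p : target x p ->
  component x X j (coord_inv x p) = local_rep x X p j 0.
Proof. by move=> xp; rewrite /component coord_invK. Qed.

Lemma component_smooth x X j : smooth_vfield_near x X -> smooth_fun_near x (component x X j).
Proof.
move=> X_smooth; apply: smooth_near_eq (X_smooth j).
by have := target_near (source_self x); apply: filterS => p xp; rewrite /= component_coord_inv.
Qed.

Lemma local_rep_eq x X Y p : X (coord_inv x p) = Y (coord_inv x p) ->
  local_rep x X p = local_rep x Y p.
Proof. by rewrite /local_rep => ->. Qed.

Lemma smooth_vfield_eq x X Y : (\forall y \near x, X y = Y y) ->
  smooth_vfield_near x X -> smooth_vfield_near x Y.
Proof.
move=> XY X_smooth i; apply: smooth_near_eq (X_smooth i).
have := near_coord_inv (source_self x) XY; apply: filterS => p XYp.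
by rewrite (local_rep_eq XYp).
Qed.

Lemma smooth_fun_eq x (f g : M -> R) : (\forall y \near x, f y = g y) ->
  smooth_fun_near x f -> smooth_fun_near x g.
Proof. by move=> fg; apply: smooth_near_eq; exact: (near_coord_inv (source_self x) fg). Qed.

Lemma smooth_fun_cst x (a : R) : smooth_fun_near x (fun=> a).
Proof. exact: smooth_near_cst. Qed.

Lemma dfun_eq x v (f g : M -> R) : (\forall y \near x, f y = g y) ->
  dfun x v f = dfun x v g.
Proof.
by move=> fg; apply: near_eq_derive; exact: (near_coord_inv (source_self x) fg).
Qed.

Lemma dfun_cst x v (a : R) : dfun x v (fun=> a) = 0.
Proof. exact: derive_cst. Qed.

Lemma smooth_fun_differentiable x (f : M -> R) : smooth_fun_near x f ->
  differentiable (f \o coord_inv x) (coord x x).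
Proof. exact: smooth_near_differentiable. Qed.

Lemma dfun_linv x (f : M -> R) : smooth_fun_near x f -> scalar (fun v => dfun x v f).
Proof.
move=> /smooth_fun_differentiable df a u v; rewrite /dfun !deriveE //.
exact: linearP.
Qed.

Lemma dfun_lin x v a (f g : M -> R) : smooth_fun_near x f -> smooth_fun_near x g ->
  dfun x v (fun y => a * f y + g y) = a * dfun x v f + dfun x v g.
Proof.
move=> /smooth_fun_differentiable df /smooth_fun_differentiable dg.
rewrite /dfun -[LHS]/('D_v (a *: (f \o coord_inv x) + (g \o coord_inv x)) (coord x x)).
rewrite deriveD ?deriveZ //; try exact: diff_derivable.
exact/diff_derivable/differentiableZ.
Qed.

Lemma dfun_component x v X j : smooth_vfield_near x X ->
  dfun x v (component x X j) = ('D_v (local_rep x X) (coord x x)) j 0.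
Proof.
move=> X_smooth; rewrite vec_derive; last first.
  by apply: vec_differentiable => i; exact: smooth_near_differentiable.
apply: near_eq_derive; have := target_near (source_self x).
by apply: filterS => p xp; rewrite /= component_coord_inv.
Qed.

Section Connection.
Variables (nabla : covderiv M) (nablaC : is_connection nabla).

(* Leibniz rule for the indicator of X = Y, which is smooth near x *)
Lemma connection_local x v X Y : smooth_vfield_near x X ->
  (\forall y \near x, X y = Y y) -> nabla x v X = nabla x v Y.
Proof.
move=> X_smooth XY; have Y_smooth := smooth_vfield_eq XY X_smooth.
pose f (y : M) : R := (`[< X y = Y y >])%:R.
have f1 : \forall y \near x, 1 = f y by apply: filterS XY => y XYy; rewrite /f asboolT.
have f_smooth := smooth_fun_eq f1 (smooth_fun_cst x 1).
have df : dfun x v f = 0 by rewrite -(dfun_eq v f1) dfun_cst.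
have fx : f x = 1 by rewrite -(nbhs_singleton f1).
have leib Z : smooth_vfield_near x Z -> nabla x v (fun y => f y *: Z y) = nabla x v Z.
  by move=> Z_smooth; rewrite (connection_leibniz nablaC) // df fx scale0r add0r scale1r.
rewrite -(leib X) // -(leib Y) //; congr (nabla x v _); apply/funext => y.
by rewrite /f; case: asboolP => [->//|_]; rewrite !scale0r.
Qed.

Lemma connection0 x v : nabla x v (fun=> 0) = 0.
Proof.
have s0 : smooth_vfield_near x (fun=> 0 : V).
  have := const_field_smooth x 0; apply: smooth_vfield_eq; apply: filterE => y.
  by rewrite /const_field big1 // => j _; rewrite mxE scale0r.
have := connection_leibniz nablaC v (smooth_fun_cst x 0) s0.
rewrite dfun_cst scale0r add0r scale0r => E; rewrite -[RHS]E.
by congr (nabla x v _); apply/funext=> y; rewrite scale0r.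
Qed.

(* [christoffel x v u] is the derivative along v of the field with constant
   components u in the chart at x *)
Definition christoffel x v u : V := \sum_j u j 0 *: nabla x v (const_field x (delta_mx j 0)).

Lemma connectionE x v X : smooth_vfield_near x X ->
  nabla x v X = 'D_v (local_rep x X) (coord x x) + christoffel x v (X x).
Proof.
move=> X_smooth.
pose E j := const_field x (delta_mx j 0).
(* Partial sums over a list allow induction with two-term additivity. For a duplicate-free list each
   coordinate of the sum is 0 or that of [X], which gives smoothness. *)
pose part (s : seq 'I_m) : vfield M := fun y => \sum_(j <- s) component x X j y *: E j y.
have part_rep s p : target x p ->
    local_rep x (part s) p = \sum_(j <- s) local_rep x X p j 0 *: delta_mx j 0.
  move=> xp; have xq := source_coord_inv xp.
  rewrite local_repE // (lin_sum (@dtrans_linear _ _ _ _ _ _)); apply: eq_bigr => j _.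
  rewrite (linZ (@dtrans_linear _ _ _ _ _ _)) component_coord_inv //.
  by rewrite -local_repE // local_rep_const_field.
have part_smooth s : uniq s -> smooth_vfield_near x (part s).
  move=> s_uniq; apply: (@smooth_near_rep _ _
    (fun p => \sum_(j <- s) local_rep x X p j 0 *: delta_mx j 0)) => [|i].
    by have := target_near (source_self x); apply: filterS => p; exact: part_rep.
  have [is_s|is_s] := boolP (i \in s); last first.
    apply: smooth_near_eq (smooth_near_cst (coord x x) 0); apply: filterE => p.
    rewrite summxE big1_seq // => j /= js; rewrite !mxE.
    by rewrite (_ : (i == j) = false) ?mulr0 //; apply: contraNF is_s => /eqP ->.
  apply: smooth_near_eq (X_smooth i); apply: filterE => p.
  rewrite summxE (bigD1_seq i) //= big1 ?addr0 => [|j ji].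
    by rewrite !mxE !eqxx mulr1.
  by rewrite !mxE eq_sym (negbTE ji) mulr0.
have nabla_part s : uniq s -> nabla x v (part s) =
    \sum_(j <- s) (dfun x v (component x X j) *: E j x + component x X j x *: nabla x v (E j)).
  elim: s => [_|j s IHs /= /andP[js s_uniq]].
    rewrite big_nil -[RHS](connection0 x v); congr (nabla x v _).
    by apply/funext=> y; rewrite /part big_nil.
  have s1 : smooth_vfield_near x (fun y => component x X j y *: E j y).
    have := part_smooth [:: j] isT; apply: smooth_vfield_eq; apply: filterE => y.
    by rewrite /part big_seq1.
  have leib := connection_leibniz nablaC v (component_smooth j X_smooth)
    (const_field_smooth x (delta_mx j 0)).
  have add := connection_additive nablaC v s1 (part_smooth s s_uniq).
  rewrite big_cons -(IHs s_uniq) -leib -add.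
  by congr (nabla x v _); apply/funext=> y; rewrite /part big_cons.
rewrite (@connection_local x v X (part (index_enum 'I_m))) //; last first.
  by have := source_near (source_self x); apply: filterS => y; exact: field_expand.
rewrite nabla_part ?index_enum_uniq // big_split /=; congr (_ + _).
  rewrite [RHS]matrix_sum_delta; apply: eq_bigr => j _.
  by rewrite big_ord1 /E const_field_self dfun_component.
by apply: eq_bigr => j _; rewrite /component local_rep_self.
Qed.

Lemma christoffel_linl x u : linear (fun v => christoffel x v u).
Proof.
move=> a v v'; rewrite /christoffel scaler_sumr -big_split; apply: eq_bigr => j _ /=.
rewrite (connection_linear nablaC); last exact: const_field_smooth.
by rewrite scalerDr !scalerA mulrC.
Qed.

Lemma christoffel_linr x v : linear (christoffel x v).
Proof.
move=> a u u'; rewrite /christoffel scaler_sumr -big_split; apply: eq_bigr => j _ /=.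
by rewrite !mxE scalerDl scalerA.
Qed.

Lemma nabla_const_field x v u : nabla x v (const_field x u) = christoffel x v u.
Proof.
rewrite connectionE; last exact: const_field_smooth.
rewrite const_field_self (@near_eq_derive _ _ _ _ (cst u)) ?derive_cst ?add0r //.
by have := target_near (source_self x); apply: filterS => p; exact: local_rep_const_field.
Qed.

(** The derivatives of the components in the covariant derivatives cancel against the bracket, so
    only the Christoffel terms remain and the torsion is pointwise. *)
Definition torsion_tensor x u v : V := christoffel x u v - christoffel x v u.

Lemma torsion_tensorP x : torsion_at nabla x (torsion_tensor x).
Proof.
move=> X Y X_smooth Y_smooth; rewrite /torsion !connectionE //.
have cancel_mid (a b c d : V) : a + c - (b + d) - (a - b) = c - d.
  by apply/matrixP=> i j; rewrite !mxE; ring.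
exact: cancel_mid.
Qed.

Lemma torsion_tensor_lin x : (forall u, linear (torsion_tensor x u)) /\
  (forall v, linear (torsion_tensor x ^~ v)).
Proof.
split=> u a v v'; rewrite /torsion_tensor christoffel_linl christoffel_linr;
  by rewrite scalerBr opprD addrACA.
Qed.

Lemma torsion_tensor_skew x u v : torsion_tensor x u v = - torsion_tensor x v u.
Proof. by rewrite /torsion_tensor opprB. Qed.

End Connection.

End Fields.

(** * The canonical connection *)

Section SkewHermitian.
Variables (R : realType) (n : nat) (M : smoothManifold R (4 * n)).
Variables (H : almostHypercomplex M) (w : scalarForm H) (nablaH : covderiv M).
Hypothesis hH : is_obata H nablaH.
Local Notation V := 'cV[R]_(4 * n).
Implicit Types (x : M) (X Y Z : vfield M) (u v z : V).

Let nablaC := obata_connection hH.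

Lemma form_invariant_skew (j b : 'M[R]_(4 * n)) : j *m j = - 1%:M ->
  (forall u v, mxform b (j *m u) (j *m v) = mxform b u v) -> j^T *m b = - (b *m j).
Proof.
move=> jj bj; have jbj : j^T *m b *m j = b.
  apply/matrixP=> i k; have := bj (delta_mx i 0) (delta_mx k 0).
  rewrite /mxform trmx_mul trmx_delta -!mulmxA [b *m (j *m _)]mulmxA.
  rewrite [j^T *m (b *m j *m _)]mulmxA [j^T *m (b *m j)]mulmxA.
  by rewrite -!colE -!rowE !mxE.
by rewrite -[b in b *m j]jbj -!mulmxA jj !mulmxN mulmx1 opprK.
Qed.

Lemma quat_skewHermitian_at x :
  quat_skewHermitian (J1 H x) (J2 H x) (J3 H x) (sform w x).
Proof.
split; [exact: sform_skew|exact: sform_nondegenerate|exact: J1_sqr|exact: J2_sqr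
  |exact: J12|exact: J21| |].
  by apply: form_invariant_skew; [exact: J1_sqr|exact: sform_J1].
by apply: form_invariant_skew; [exact: J2_sqr|exact: sform_J2].
Qed.

Let w_skew x u v : mxform (sform w x) u v = - mxform (sform w x) v u.
Proof. exact/mxform_skew/sform_skew. Qed.

Lemma eq_form x u v : (forall z, mxform (sform w x) u z = mxform (sform w x) v z) -> u = v.
Proof.
move=> uv; have uwv : u^T *m sform w x = v^T *m sform w x.
  apply/matrixP=> i l; rewrite ord1.
  by have := uv (delta_mx l 0); rewrite /mxform -!colE !mxE.
apply: trmx_inj; rewrite -[u^T](mulmxK (sform_nondegenerate w x)) uwv.
exact: (mulmxK (sform_nondegenerate w x)).
Qed.

Let app_smooth x Y Z : smooth_vfield_near x Y -> smooth_vfield_near x Z ->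
  smooth_fun_near x (app_form w Y Z).
Proof. exact: sform_smooth. Qed.

Lemma cov_form_skew x v Y Z : smooth_vfield_near x Y -> smooth_vfield_near x Z ->
  cov_form nablaH w x v Z Y = - cov_form nablaH w x v Y Z.
Proof.
move=> Ys Zs; rewrite /cov_form.
(* The sign is put as a linear combination with the zero function, to which [dfun_lin] applies. *)
have -> : app_form w Z Y = fun y => -1 * app_form w Y Z y + (fun=> 0) y.
  by apply/funext=> y; rewrite /app_form w_skew mulN1r addr0.
rewrite dfun_lin //; [|exact: app_smooth|exact: smooth_fun_cst].
rewrite dfun_cst (w_skew x (nablaH x v Z)) (w_skew x (Z x)); ring.
Qed.

Let cf x v u z := cov_form nablaH w x v (const_field x u) (const_field x z).

Lemma cov_form_linv x u z : scalar (fun v => cf x v u z).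
Proof.
move=> a v v'; rewrite /cf /cov_form !(nabla_const_field nablaC).
rewrite (dfun_linv (app_smooth (const_field_smooth x u) (const_field_smooth x z))).
rewrite (christoffel_linl nablaC x u a v v') (christoffel_linl nablaC x z a v v').
move: (christoffel _ _ _ _) (christoffel _ _ _ _) (christoffel _ _ _ _) (christoffel _ _ _ _).
move=> *; rewrite mxform_linl mxform_linr.
move: (mxform _ _ _) (mxform _ _ _) (mxform _ _ _) (mxform _ _ _) (dfun _ _ _) (dfun _ _ _).
by move=> *; ring.
Qed.

Lemma cov_form_lin x v z : scalar (fun u => cf x v u z).
Proof.
move=> a u u'; rewrite /cf /cov_form !(nabla_const_field nablaC).
have -> : app_form w (const_field x (a *: u + u')) (const_field x z) = fun y =>
    a * app_form w (const_field x u) (const_field x z) y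
    + app_form w (const_field x u') (const_field x z) y.
  by apply/funext=> y; rewrite /app_form const_field_lin mxform_linl.
rewrite dfun_lin; [|by apply: app_smooth; exact: const_field_smooth..].
rewrite const_field_lin (christoffel_linr nablaH) 2!mxform_linl.
move: (mxform _ _ _) (mxform _ _ _) (mxform _ _ _) (mxform _ _ _) (dfun _ _ _) (dfun _ _ _).
by move=> *; ring.
Qed.

Lemma cov_form_J (J : mxfield M) x v Y Z : parallel_endo nablaH J ->
  (forall y u z, mxform (sform w y) (J y *m u) (J y *m z) = mxform (sform w y) u z) ->
  smooth_vfield_near x Y -> smooth_vfield_near x Z ->
  cov_form nablaH w x v (app_endo J Y) (app_endo J Z) = cov_form nablaH w x v Y Z.
Proof.
move=> J_par J_inv Ys Zs; rewrite /cov_form !J_par // !J_inv.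
by congr (dfun x v _ - _ - _); apply/funext=> y; exact: J_inv.
Qed.

(** Brackets become covariant derivatives minus torsion; J is parallel, so the covariant derivatives
    cancel. *)
Lemma obata_nij (J : mxfield M) x u v : smooth_endo J -> parallel_endo nablaH J ->
  J x *m J x = - 1%:M ->
  nijenhuis J (const_field x u) (const_field x v) x =
  nij (J x) (torsion_tensor nablaH x) u v.
Proof.
move=> J_smooth J_par JJ.
set X := const_field x u; set Y := const_field x v.
have Xs : smooth_vfield_near x X by exact: const_field_smooth.
have Ys : smooth_vfield_near x Y by exact: const_field_smooth.
have JXs := J_smooth _ _ Xs; have JYs := J_smooth _ _ Ys.
have brE A B : smooth_vfield_near x A -> smooth_vfield_near x B ->
    bracket A B x = nablaH x (A x) B - nablaH x (B x) A
      - torsion_tensor nablaH x (A x) (B x).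
  move=> As Bs; rewrite -(torsion_tensorP nablaC As Bs) /torsion.
  by rewrite opprB addrC subrK.
have JJE (a : V) : J x *m (J x *m a) = - a by rewrite mulmxA JJ mulNmx mul1mx.
rewrite /nijenhuis !brE // !J_par // /app_endo /nij -/(app_endo J) /X /Y.
rewrite !const_field_self; move: (torsion_tensor nablaH x) => t.
rewrite !(mulmxBr, mulmxN) !JJE.
move: (nablaH _ _ _) (nablaH _ _ _) (J x *m nablaH _ _ _) (J x *m nablaH _ _ _).
move: (t _ _) (t _ _) (J x *m t _ _) (J x *m t _ _).
by move=> *; apply/matrixP=> i k; rewrite !mxE; ring.
Qed.

Lemma obata_torsion_tensor x u v : torsion_tensor nablaH x u v = 6^-1 *:
  (nij (J1 H x) (torsion_tensor nablaH x) u v + nij (J2 H x) (torsion_tensor nablaH x) u v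
   + nij (J3 H x) (torsion_tensor nablaH x) u v).
Proof.
have us := const_field_smooth x u; have vs := const_field_smooth x v.
have := torsion_tensorP nablaC us vs; rewrite !const_field_self => <-.
have N1 := obata_nij u v (@J1_smooth _ _ _ H) (obata_J1 hH) (J1_sqr H x).
have N2 := obata_nij u v (@J2_smooth _ _ _ H) (obata_J2 hH) (J2_sqr H x).
have N3 := obata_nij u v (@J3_smooth _ _ _ H) (obata_J3 hH) (J3_sqr H x).
by rewrite (obata_torsion hH us vs) N1 N2 N3.
Qed.

End SkewHermitian.

Lemma eq_mulmxV (K : pzSemiRingType) m p (B C : 'M[K]_(m, p)) :
  (forall v : 'cV_p, B *m v = C *m v) -> B = C.
Proof.
by move=> BC; apply/matrixP=> i k; have := BC (delta_mx k 0);
  rewrite -!colE => /matrixP/(_ i 0); rewrite !mxE.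
Qed.

(** * The difference tensor, the canonical torsion and dw *)

Section Canonical.
Variables (R : realType) (n : nat) (M : smoothManifold R (4 * n)).
Variables (H : almostHypercomplex M) (w : scalarForm H) (nablaH nabla : covderiv M).
Hypothesis hH : is_obata H nablaH.
Variable A : M -> 'cV[R]_(4 * n) -> 'cV[R]_(4 * n) -> 'cV[R]_(4 * n).
Hypothesis Aw : forall (x : M) v Y Z, smooth_vfield_near x Y -> smooth_vfield_near x Z ->
  mxform (sform w x) (A x v (Y x)) (Z x) = 2%:R^-1 * cov_form nablaH w x v Y Z.
Hypothesis An : forall (x : M) v Y, smooth_vfield_near x Y ->
  nabla x v Y = nablaH x v Y + A x v (Y x).
Local Notation V := 'cV[R]_(4 * n).
Implicit Types (x : M) (X Y Z : vfield M) (u v z : V).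

Let nablaC := obata_connection hH.
Let w_skew x u v : mxform (sform w x) u v = - mxform (sform w x) v u.
Proof. exact/mxform_skew/sform_skew. Qed.

Lemma difference_form x v u z : mxform (sform w x) (A x v u) z =
  2%:R^-1 * cov_form nablaH w x v (const_field x u) (const_field x z).
Proof. by rewrite -Aw ?const_field_self //; exact: const_field_smooth. Qed.

Lemma difference_bilin x : bilin (A x).
Proof.
split=> u a v v'; apply: (@eq_form _ _ _ _ w x) => z.
  rewrite mxform_linl !difference_form cov_form_lin //; ring.
rewrite mxform_linl !difference_form cov_form_linv //; ring.
Qed.

Lemma difference_skew x v a b :
  mxform (sform w x) (A x v a) b = - mxform (sform w x) (A x v b) a.
Proof.
rewrite !difference_form cov_form_skew; [by rewrite mulrN|exact: const_field_smooth..].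
Qed.

Lemma difference_J (J : mxfield M) x v u : smooth_endo J -> parallel_endo nablaH J ->
  J x *m J x = - 1%:M ->
  (forall y u z, mxform (sform w y) (J y *m u) (J y *m z) = mxform (sform w y) u z) ->
  A x v (J x *m u) = J x *m A x v u.
Proof.
move=> J_smooth J_par JJ J_inv; apply: (@eq_form _ _ _ _ w x) => z.
have JJK (a : V) : J x *m (J x *m - a) = a by rewrite !mulmxN mulmxA JJ mulNmx mul1mx opprK.
(* The second field takes the value J(-z) at x, so that applying J to it returns z. *)
have us := const_field_smooth x u; have zs := const_field_smooth x (J x *m - z).
have := Aw v (J_smooth _ _ us) (J_smooth _ _ zs).
rewrite /app_endo !const_field_self JJK => ->.
rewrite (cov_form_J _ J_par) // -Aw // !const_field_self.
by rewrite -(J_inv x) JJK.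
Qed.

Definition difference_endo x := endo_of (A x).

Lemma difference_endoE x v u : difference_endo x v *m u = A x v u.
Proof. exact: (endo_ofE _ _ (difference_bilin x)). Qed.

Definition canonical_torsion x u v := torsion_tensor nablaH x u v + delta (difference_endo x) u v.

Lemma canonical_torsionP x : torsion_at nabla x (canonical_torsion x).
Proof.
move=> X Y Xs Ys; rewrite /torsion !An // /canonical_torsion -torsion_tensorP //.
rewrite /torsion /delta !difference_endoE.
move: (nablaH _ _ _) (nablaH _ _ _) (A _ _ _) (A _ _ _) (bracket _ _ _) => *.
by apply/matrixP=> i k; rewrite !mxE; ring.
Qed.

(** The covariant derivative of [w] is skew in its last two arguments, so each slot of [w] absorbs
    one half of it; this is the reason for the factor 1/2. *)
Lemma cov_form_canonical x v Y Z : smooth_vfield_near x Y -> smooth_vfield_near x Z ->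
  cov_form nabla w x v Y Z = 0.
Proof.
move=> Ys Zs; rewrite /cov_form !An //.
have := Aw v Zs Ys; have := Aw v Ys Zs; rewrite (cov_form_skew w nablaH v Ys Zs).
rewrite (linD (mxform_linl _ _)) (linD (mxform_linr _ _)).
rewrite (w_skew x (Y x) (A x v (Z x))) => -> ->.
rewrite /cov_form; move: (mxform _ _ _) (mxform _ _ _) (dfun _ _ _) => a b c.
by field.
Qed.

(** With [w] parallel, each derivative is a pairing with covariant derivatives; these cancel against
    the brackets up to torsion. *)
Lemma ext_d_torsion x t X Y Z : torsion_at nabla x t -> smooth_vfield_near x X ->
  smooth_vfield_near x Y -> smooth_vfield_near x Z ->
  ext_d w X Y Z x = pi_w (sform w x) t (X x) (Y x) (Z x).
Proof.
move=> tP Xs Ys Zs.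
have dE v Y' Z' : smooth_vfield_near x Y' -> smooth_vfield_near x Z' ->
    dfun x v (app_form w Y' Z') =
    mxform (sform w x) (nabla x v Y') (Z' x) - mxform (sform w x) (nabla x v Z') (Y' x).
  move=> Ys' Zs'; have := cov_form_canonical v Ys' Zs'; rewrite /cov_form => /eqP.
  by rewrite subr_eq0 subr_eq => /eqP->; rewrite addrC (w_skew x (Y' x)).
have brE X' Y' : smooth_vfield_near x X' -> smooth_vfield_near x Y' ->
    bracket X' Y' x = nabla x (X' x) Y' - nabla x (Y' x) X' - t (X' x) (Y' x).
  by move=> Xs' Ys'; rewrite -(tP _ _ Xs' Ys') /torsion opprB addrC subrK.
rewrite /ext_d /app_form /= !dE // !brE // /pi_w.
have wB u v z : mxform (sform w x) (u - v) z =
    mxform (sform w x) u z - mxform (sform w x) v z by exact: (linB (mxform_linl _ _)).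
rewrite !wB; ring.
Qed.

Hypothesis n_gt0 : (0 < n)%N.

Lemma canonical_torsion_components x f : adapted_at w x f ->
  exists t_, Xcomponents_at w x [:: 1; 2; 3; 4; 5; 6; 7]%N f (canonical_torsion x) t_.
Proof.
move=> fa; have qsh := quat_skewHermitian_at w x.
have t_two : two_form_valued (torsion_tensor nablaH x).
  by have [] := torsion_tensor_lin nablaC x; split=> // u v; exact: torsion_tensor_skew.
have t_bil : bilin (torsion_tensor nablaH x) by case: t_two.
have [t1 [t2 [t6 [X1t X2t X6t tE]]]] := S3H_decomposition fa qsh n_gt0 t_two
  (obata_sym3H fa qsh t_bil (obata_torsion_tensor hH x)).
have AJ1 u : difference_endo x u *m J1 H x = J1 H x *m difference_endo x u.
  apply: eq_mulmxV => v; rewrite -!mulmxA !difference_endoE.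
  by apply: difference_J; [exact: J1_smooth|exact: obata_J1|exact: J1_sqr|exact: sform_J1].
have AJ2 u : difference_endo x u *m J2 H x = J2 H x *m difference_endo x u.
  apply: eq_mulmxV => v; rewrite -!mulmxA !difference_endoE.
  by apply: difference_J; [exact: J2_smooth|exact: obata_J2|exact: J2_sqr|exact: sform_J2].
have A_skew u a b : mxform (sform w x) (difference_endo x u *m a) b =
    - mxform (sform w x) (difference_endo x u *m b) a.
  by rewrite !difference_endoE difference_skew.
have [t3 [t4 [t5 [t7 [X3t X4t X5t X7t dE]]]]] :=
  delta_decomposition fa qsh n_gt0 (endo_of_linear (difference_bilin x)) AJ1 AJ2 A_skew.
(* Components are numbered from 1, hence the predecessor. *)
exists (fun i => nth (fun _ _ => 0) [:: t1; t2; t3; t4; t5; t6; t7] i.-1).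
split=> [i i7|u v].
  case: i i7 => [|[|[|[|[|[|[|[|i]]]]]]]] i7; [exact: notF|exact: X1t|exact: X2t|exact: X3t
    |exact: X4t|exact: X5t|exact: X6t|exact: X7t|exact: notF].
rewrite /canonical_torsion tE dE !big_cons big_nil /=.
move: (t1 u v) (t2 u v) (t3 u v) (t4 u v) (t5 u v) (t6 u v) (t7 u v) => *.
by apply/matrixP=> i k; rewrite !mxE; ring.
Qed.
End Canonical.

Lemma pi_w_sum (R : realType) (n : nat) (b : 'M[R]_(4 * n))
    (t : 'cV[R]_(4 * n) -> 'cV[R]_(4 * n) -> 'cV[R]_(4 * n)) (s : seq nat) t_ u v z :
  (forall u v, t u v = \sum_(i <- s) t_ i u v) ->
  pi_w b t u v z = \sum_(i <- s) pi_w b (t_ i) u v z.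
Proof.
by move=> tE; rewrite /pi_w !tE !(lin_sum (mxform_linl b _)) -!big_split.
Qed.

(** * Closedness of [w] and the type of the torsion *)

Section TorsionType.
Variables (R : realType) (n : nat) (M : smoothManifold R (4 * n)).
Variables (H : almostHypercomplex M) (w : scalarForm H) (nablaH nabla : covderiv M).
Hypotheses (hH : is_obata H nablaH) (hw : is_canonical w nablaH nabla).
Hypothesis n_gt0 : (0 < n)%N.
Local Notation V := 'cV[R]_(4 * n).
Implicit Types (x : M) (f : EHframe R n) (t : V -> V -> V).

Let pi0 t x := forall u v z, pi_w (sform w x) t u v z = 0.

Lemma Xcomponents_pi_w_eq0 x f t (T : nat -> V -> V -> V) : adapted_at w x f ->
  Xcomponents_at w x [:: 1; 2; 3; 4; 5; 6; 7]%N f t T -> pi0 t x ->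
  [/\ forall u v, T 2%N u v = 0, forall u v, T 3%N u v = 0 & forall u v, T 4%N u v = 0].
Proof.
move=> fa [TX tE] t0.
apply: (pi_w_inj fa (quat_skewHermitian_at w x) n_gt0 (TX 2%N isT) (TX 3%N isT) (TX 4%N isT)).
move=> u v z; have := t0 u v z; rewrite (pi_w_sum _ _ _ _ tE) !big_cons big_nil.
rewrite (X1_pi_w fa (TX 1%N isT)) (X5_pi_w fa (TX 5%N isT)) (X6_pi_w fa (TX 6%N isT)).
by rewrite (X7_pi_w (TX 7%N isT)) !addr0 add0r addrA.
Qed.

Lemma Xcomponents1567_pi_w x f t (T : nat -> V -> V -> V) : adapted_at w x f ->
  Xcomponents_at w x [:: 1; 5; 6; 7]%N f t T -> pi0 t x.
Proof.
move=> fa [TX tE] u v z; rewrite (pi_w_sum _ _ _ _ tE) !big_cons big_nil.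
rewrite (X1_pi_w fa (TX 1%N isT)) (X5_pi_w fa (TX 5%N isT)) (X6_pi_w fa (TX 6%N isT)).
by rewrite (X7_pi_w (TX 7%N isT)) !addr0.
Qed.

Lemma Xcomponents1567 x f t (T : nat -> V -> V -> V) :
  Xcomponents_at w x [:: 1; 2; 3; 4; 5; 6; 7]%N f t T ->
  (forall u v, T 2%N u v = 0) -> (forall u v, T 3%N u v = 0) ->
  (forall u v, T 4%N u v = 0) -> Xcomponents_at w x [:: 1; 5; 6; 7]%N f t T.
Proof.
move=> [TX tE] z2 z3 z4; split=> [i|u v].
  by rewrite !inE => /or4P[] /eqP->; exact: TX.
by rewrite tE !big_cons z2 z3 z4 !add0r.
Qed.

Lemma closed_pi_w x t : torsion_at nabla x t -> closed_form w -> pi0 t x.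
Proof.
have [A [Aw An]] := hw; move=> tP w_closed u v z.
have := w_closed x _ _ _ (const_field_smooth x u) (const_field_smooth x v) (const_field_smooth x z).
by rewrite (ext_d_torsion Aw An tP) ?const_field_self //; exact: const_field_smooth.
Qed.

Lemma pi_w_closed : (forall x, exists2 t, torsion_at nabla x t & pi0 t x) -> closed_form w.
Proof.
have [A [Aw An]] := hw; move=> w0 x X Y Z Xs Ys Zs; have [t tP t0] := w0 x.
by rewrite (ext_d_torsion Aw An tP) // t0.
Qed.

Lemma torsion_components_exist x f : adapted_at w x f ->
  exists t (T : nat -> V -> V -> V), torsion_at nabla x t /\
    Xcomponents_at w x [:: 1; 2; 3; 4; 5; 6; 7]%N f t T.
Proof.
have [A [Aw An]] := hw; move=> fa.
have [T TX] := canonical_torsion_components hH Aw n_gt0 fa.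
by exists (canonical_torsion nablaH A x), T; split=> //; exact: (canonical_torsionP hH Aw An).
Qed.

(** The hypothesis is universal and the conclusion existential, so the existence of an adapted frame
    and of all seven components is what carries this implication. *)
Lemma vanish_torsion_type : torsion_components_vanish w nabla [:: 2; 3; 4]%N ->
  torsion_type w nabla [:: 1; 5; 6; 7]%N.
Proof.
move=> van x; have [f fa] := adapted_frame_exists (quat_skewHermitian_at w x).
have [t [T [tP TX]]] := torsion_components_exist fa.
have T0 i := van x f t T fa tP TX i.
exists f, t, T; split=> //.
exact: (Xcomponents1567 TX (T0 2%N isT) (T0 3%N isT) (T0 4%N isT)).
Qed.

Lemma closed_vanish : closed_form w -> torsion_components_vanish w nabla [:: 2; 3; 4]%N.
Proof.
move=> w_closed x f t T fa tP TX i.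
have [z2 z3 z4] := Xcomponents_pi_w_eq0 fa TX (closed_pi_w tP w_closed).
by rewrite !inE => /or3P[] /eqP->.
Qed.

Lemma torsion_type_closed : torsion_type w nabla [:: 1; 5; 6; 7]%N -> closed_form w.
Proof.
move=> tt; apply: pi_w_closed => x; have [f [t [T [fa tP TX]]]] := tt x.
by exists t => //; exact: Xcomponents1567_pi_w fa TX.
Qed.
End TorsionType.

Local Close Scope ring_scope.
Local Close Scope classical_set_scope.

Theorem theorem1p9 (R : realType) (n : nat) (hn : (1 < n)%N)
    (M : smoothManifold R (4 * n)) (H : almostHypercomplex M)
    (w : scalarForm H) (nablaH nabla : covderiv M)
    (hH : is_obata H nablaH) (hw : is_canonical w nablaH nabla) :
  (closed_form w <-> torsion_type w nabla [:: 1; 5; 6; 7]%N) /\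
  (torsion_type w nabla [:: 1; 5; 6; 7]%N <->
     torsion_components_vanish w nabla [:: 2; 3; 4]%N).
Proof.
have n_gt0 : (0 < n)%N by exact: ltnW.
have closedP := closed_vanish hw n_gt0.
have vanishP := @vanish_torsion_type _ _ _ _ _ _ _ hH hw n_gt0.
have typeP := torsion_type_closed hw.
by split; [split=> [/closedP/vanishP|/typeP]|split=> [/typeP/closedP|/vanishP]].
Qed.
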